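(* Let $M\models\mathrm{PA}$ be an arbitrary countable model. Then there exists an elementary extension $M\prec M'$ such that $M'$ is $\omega_1$-like and there exists $T\subset M'$ for which $(M',T)\models\mathrm{CT}^-$.
   Context: A model $M\models\mathrm{PA}$ is $\omega_1$-like if $|M|=\aleph_1$ but every proper initial segment of $M$ is countable. $\mathscr{L}_{\mathrm{PA}}$ is the language of arithmetic with $0,S,+,\times,=$ ($<$ is defined as usual); logical primitives are $\neg,\wedge,\exists$, others being abbreviations. Syntax is formalised in $\mathrm{PA}$ in the standard way: $\mathrm{Sent}_{\mathscr{L}_{\mathrm{PA}}}$, $\mathrm{Form}_{\mathscr{L}_{\mathrm{PA}}}$, $\mathrm{Form}^{\leq 1}_{\mathscr{L}_{\mathrm{PA}}}$, $\mathrm{ClTerm}_{\mathscr{L}_{\mathrm{PA}}}$, $\mathrm{ClTermSeq}_{\mathscr{L}_{\mathrm{PA}}}$ define the (codes of) arithmetical sentences, formulae, formulae with at most one free variable, closed terms, and coded sequences of closed terms; $\underline{x}$ is the numeral of $x$, and $t^{\circ}$ is the value of a closed term $t$ (for a sequence $\bar t$, $\overline{t^{\circ}}$ is the sequence of values). $\mathrm{CT}^-$ is the theory in the language $\mathscr{L}_{\mathrm{PA}}$ extended with one fresh unary predicate $T$ whose axioms are those of $\mathrm{PA}$ (with induction only for $\mathscr{L}_{\mathrm{PA}}$-formulae) and: 1. $\forall x\,(T(x)\rightarrow \mathrm{Sent}_{\mathscr{L}_{\mathrm{PA}}}(x))$. 2. $\forall s,t\in\mathrm{ClTerm}_{\mathscr{L}_{\mathrm{PA}}}\,(T(s=t)\equiv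 s^{\circ}=t^{\circ})$. 3. $\forall\phi\in\mathrm{Sent}_{\mathscr{L}_{\mathrm{PA}}}\,(T\neg\phi\equiv\neg T\phi)$. 4. $\forall\phi,\psi\in\mathrm{Sent}_{\mathscr{L}_{\mathrm{PA}}}\,(T(\phi\wedge\psi)\equiv T\phi\wedge T\psi)$. 5. $\forall\phi\in\mathrm{Form}^{\leq 1}_{\mathscr{L}_{\mathrm{PA}}}\,(T\exists v\,\phi(v)\equiv\exists x\,T\phi(\underline{x}))$. 6. $\forall\bar s,\bar t\in\mathrm{ClTermSeq}_{\mathscr{L}_{\mathrm{PA}}}\,\forall\phi\in\mathrm{Form}_{\mathscr{L}_{\mathrm{PA}}}\,(\overline{s^{\circ}}=\overline{t^{\circ}}\rightarrow (T\phi(\bar s)\equiv T\phi(\bar t)))$. *)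

(* Defs.v *)
From mathcomp Require Import all_boot.
From mathcomp Require Import boolp classical_sets functions cardinality wochoice.

Set Implicit Arguments.
Unset Strict Implicit.
Unset Printing Implicit Defensive.

Local Open Scope classical_set_scope.

(** * The language of arithmetic, its structures, PA *)

Inductive aterm : Type :=
| AVar of nat
| AZero
| ASucc of aterm
| AAdd of aterm & aterm
| AMul of aterm & aterm.

Inductive aform : Type :=
| AEq of aterm & aterm
| ANeg of aform
| AAnd of aform & aform
| AEx of nat & aform.

Record arith : Type := Arith {
  dom :> Type;
  azero : dom;
  asucc : dom -> dom;
  aadd : dom -> dom -> dom;
  amul : dom -> dom -> dom }.

Arguments azero {a}.
Arguments asucc {a} _.
Arguments aadd {a} _ _.
Arguments amul {a} _ _.

Declare Scope arith_scope.
Delimit Scope arith_scope with A.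
Local Notation "0" := azero : arith_scope.
Local Notation "x + y" := (aadd x y) : arith_scope.
Local Notation "x * y" := (amul x y) : arith_scope.

Definition upd (D : Type) (e : nat -> D) (n : nat) (a : D) : nat -> D :=
  fun k => if k == n then a else e k.

Fixpoint aeval (M : arith) (e : nat -> M) (t : aterm) : M :=
  match t with
  | AVar n => e n
  | AZero => azero
  | ASucc t => asucc (aeval e t)
  | AAdd t u => aadd (aeval e t) (aeval e u)
  | AMul t u => amul (aeval e t) (aeval e u)
  end.

Fixpoint sat (M : arith) (e : nat -> M) (phi : aform) : Prop :=
  match phi with
  | AEq t u => aeval e t = aeval e u
  | ANeg phi => ~ sat e phi
  | AAnd phi psi => sat e phi /\ sat e psi
  | AEx n phi => exists a : M, sat (upd e n a) phi
  end.

(* Induction for the formula phi in the variable v_n; the other free variables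
   of phi, interpreted by e, are the parameters. *)
Record PA (M : arith) : Prop := {
  pa_succ0 : forall x : M, asucc x <> azero;
  pa_succI : forall x y : M, asucc x = asucc y -> x = y;
  pa_add0 : forall x : M, aadd x azero = x;
  pa_addS : forall x y : M, aadd x (asucc y) = asucc (aadd x y);
  pa_mul0 : forall x : M, amul x azero = azero;
  pa_mulS : forall x y : M, amul x (asucc y) = aadd (amul x y) x;
  pa_ind : forall (phi : aform) (n : nat) (e : nat -> M),
    sat (upd e n azero) phi ->
    (forall a : M, sat (upd e n a) phi -> sat (upd e n (asucc a)) phi) ->
    forall a : M, sat (upd e n a) phi }.

Definition arith_lt (M : arith) (x y : M) : Prop := exists z : M, aadd x (asucc z) = y.

Local Notation "x < y" := (arith_lt x y) : arith_scope.

(** * Elementary extensions and omega_1-like models *)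

Definition elementary_embedding (M N : arith) (f : M -> N) : Prop :=
  forall (phi : aform) (e : nat -> M), sat e phi <-> sat (f \o e) phi.

(* The cardinal aleph_1 is the first uncountable ordinal: D carries a
   (reflexive) well-order of type omega_1. *)
Definition card_aleph1 (D : Type) : Prop :=
  ~ countable [set: D] /\
  exists R : rel D, well_order R /\ forall x : D, countable [set y : D | R y x].

Definition initial_segment (M : arith) (I : set M) : Prop :=
  forall x y : M, I y -> (x < y)%A -> I x.

Definition omega1_like (M : arith) : Prop :=
  card_aleph1 M /\
  forall I : set M, initial_segment I -> I <> [set: M] -> countable I.

(** * Arithmetised syntax

   Everything below is evaluated inside an arbitrary structure M, standard or
   not.  All quantifiers range over elements of M and all atoms are equations
   between terms, so each predicate is the interpretation in M of a fixed
   formula of the language of arithmetic.  (A natural number k in [ctag k] only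
   abbreviates the closed term S...S0, and the predicate parameters in [derived]
   are only ever instantiated by such formulas.)  A function F of PA is given
   by its graph, and "F(x) has property P" is written
   [exists y, F x y /\ P y]. *)

Section Syntax.
Variable M : arith.
Implicit Types x y z i j l a b c s t u v w p q r : M.
Local Open Scope arith_scope.

(* (x + y)^2 + x is injective in (x, y). *)
Definition cpair x y : M := (x + y) * (x + y) + x.

(* Goedel's beta function:
   x is the remainder of a modulo 1 + (i + 1) * b. *)
Definition beta a b i x : Prop :=
  exists q, a = q * asucc (asucc i * b) + x /\ x < asucc (asucc i * b).

(* The sequence of length l coded by <l, <a, b>>; a sequence has many codes,
   so sequences are only ever compared entrywise. *)
Definition seqlen s l : Prop := exists a b, s = cpair l (cpair a b).

Definition entry s i x : Prop :=
  exists l a b, [/\ s = cpair l (cpair a b), i < l & beta a b i x].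

(* x is an entry of a coded sequence each of whose entries is obtained from
   earlier entries by the rule [step]. *)
Definition derived (step : (M -> Prop) -> M -> Prop) x : Prop :=
  exists s,
    (exists i, entry s i x) /\
    forall i y, entry s i y -> step (fun z => exists j, j < i /\ entry s j z) y.

(** Codes of terms and formulas *)

Definition ctag (k : nat) x : M := cpair (iter k asucc 0) x.

Definition cZero : M := ctag 0%N 0.
Definition cVar i : M := ctag 1%N i.
Definition cSucc t : M := ctag 2 t.
Definition cAdd t u : M := ctag 3 (cpair t u).
Definition cMul t u : M := ctag 4 (cpair t u).
Definition cEq t u : M := ctag 5 (cpair t u).
Definition cNeg p : M := ctag 6 p.
Definition cAnd p q : M := ctag 7 (cpair p q).
Definition cEx i p : M := ctag 8 (cpair i p).

Definition Term : M -> Prop := derived (fun P x =>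
  x = cZero \/
  (exists i, x = cVar i) \/
  (exists t, P t /\ x = cSucc t) \/
  (exists t u, [/\ P t, P u & x = cAdd t u]) \/
  (exists t u, [/\ P t, P u & x = cMul t u])).

Definition Form : M -> Prop := derived (fun P x =>
  (exists t u, [/\ Term t, Term u & x = cEq t u]) \/
  (exists p, P p /\ x = cNeg p) \/
  (exists p q, [/\ P p, P q & x = cAnd p q]) \/
  (exists i p, P p /\ x = cEx i p)).

(* v_i occurs free in the given term or formula. *)
Definition Free i : M -> Prop := derived (fun P x =>
  x = cVar i \/
  (exists t, P t /\ x = cSucc t) \/
  (exists t u, (P t \/ P u) /\ x = cAdd t u) \/
  (exists t u, (P t \/ P u) /\ x = cMul t u) \/
  (exists t u, (P t \/ P u) /\ x = cEq t u) \/
  (exists p, P p /\ x = cNeg p) \/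
  (exists p q, (P p \/ P q) /\ x = cAnd p q) \/
  (exists j p, [/\ P p, j <> i & x = cEx j p])).

Definition ClTerm t : Prop := Term t /\ forall i, ~ Free i t.

Definition Sent p : Prop := Form p /\ forall i, ~ Free i p.

(* p(v_i): a formula in which at most v_i is free. *)
Definition Form1 i p : Prop := Form p /\ forall j, Free j p -> j = i.

Definition ClTermSeq s : Prop :=
  (exists l, seqlen s l) /\ forall i t, entry s i t -> ClTerm t.

(** Numerals and values: t is the numeral of x; x is the value of t *)

Definition Numeral x t : Prop := derived (fun P w =>
  w = cpair 0 cZero \/
  (exists y u, P (cpair y u) /\ w = cpair (asucc y) (cSucc u))) (cpair x t).

Definition Value t x : Prop := derived (fun P w =>
  w = cpair cZero 0 \/
  (exists u y, P (cpair u y) /\ w = cpair (cSucc u) (asucc y)) \/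
  (exists u v y z, [/\ P (cpair u y), P (cpair v z) &
                       w = cpair (cAdd u v) (y + z)]) \/
  (exists u v y z, [/\ P (cpair u y), P (cpair v z) &
                       w = cpair (cMul u v) (y * z)])) (cpair t x).

(* The sequences of values of s and t are the same. *)
Definition SameValues s t : Prop :=
  (exists l, seqlen s l /\ seqlen t l) /\
  forall i u v, entry s i u -> entry t i v -> exists x, Value u x /\ Value v x.

(** Simultaneous substitution of s_i for the free occurrences of v_i, for i less
    than the length of s.  Bound variables are not renamed: only closed terms
    are ever substituted. *)

(* t is what s substitutes for v_i. *)
Definition subst_image s i t : Prop :=
  entry s i t \/ (~ (exists u, entry s i u) /\ t = cVar i).

(* r substitutes like s, except that it leaves v_i alone. *)
Definition subst_except s i r : Prop :=
  forall j t, subst_image r j t <-> (j = i /\ t = cVar i) \/ (j <> i /\ subst_image s j t).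

Definition Subst s x y : Prop :=
  let triple r t u := cpair r (cpair t u) in
  derived (fun P w =>
    (exists r, w = triple r cZero cZero) \/
    (exists r i t, subst_image r i t /\ w = triple r (cVar i) t) \/
    (exists r t t', P (triple r t t') /\ w = triple r (cSucc t) (cSucc t')) \/
    (exists r t t' u u', [/\ P (triple r t t'), P (triple r u u') &
                             w = triple r (cAdd t u) (cAdd t' u')]) \/
    (exists r t t' u u', [/\ P (triple r t t'), P (triple r u u') &
                             w = triple r (cMul t u) (cMul t' u')]) \/
    (exists r t t' u u', [/\ P (triple r t t'), P (triple r u u') &
                             w = triple r (cEq t u) (cEq t' u')]) \/
    (exists r p p', P (triple r p p') /\ w = triple r (cNeg p) (cNeg p')) \/
    (exists r p p' q q', [/\ P (triple r p p'), P (triple r q q') &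
                             w = triple r (cAnd p q) (cAnd p' q')]) \/
    (exists r r' i p p', [/\ subst_except r i r', P (triple r' p p') &
                             w = triple r (cEx i p) (cEx i p')]))
  (triple s x y).

(* Substitution of t for the single variable v_i, by means of the sequence
   (v_0, ..., v_(i-1), t). *)
Definition Subst1 i t x y : Prop :=
  exists s, [/\ seqlen s (asucc i), entry s i t,
                forall j, j < i -> entry s j (cVar j) & Subst s x y].

End Syntax.

(** * The theory CT^- *)

Record CTminus (M : arith) (T : set M) : Prop := {
  ct_pa : PA M;
  ct_sent : forall x : M, T x -> Sent x;
  ct_eq : forall s t : M, ClTerm s -> ClTerm t ->
    (T (cEq s t) <-> exists x : M, Value s x /\ Value t x);
  ct_neg : forall p : M, Sent p -> (T (cNeg p) <-> ~ T p);
  ct_and : forall p q : M, Sent p -> Sent q -> (T (cAnd p q) <-> T p /\ T q);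
  ct_ex : forall i p : M, Form1 i p ->
    (T (cEx i p) <->
     exists x t q : M, [/\ Numeral x t, Subst1 i t p q & T q]);
  ct_reg : forall s t p : M,
    ClTermSeq s -> ClTermSeq t -> Form p -> SameValues s t ->
    ((exists q : M, Subst s p q /\ T q) <-> (exists q : M, Subst t p q /\ T q)) }.

(* Main.v *)
(* M' is the limit of a chain of models, each an elementary extension of the one
   before it and carrying a truth predicate that is correct on all sentences whose
   skeleton (the sentence with its atomic parts erased) lies in the one before
   (Enayat and Visser).  In a single step, the truth of the sentences with skeleton
   in a given finite list is defined by recursion on skeletons, which preserves
   induction, and an ultraproduct over all finite lists is taken.

   To make M' omega_1-like, the whole construction is carried out in the presence
   of an action of the automorphisms of a dense linear order I, uncountable but with
   countable initial segments, and of a cofinal sequence d indexed by I on which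
   they act accordingly.  It starts from the ultrapower of M iterated along I
   (MacDowell and Specker, Gaifman), in which an element below d i is fixed by all
   automorphisms that fix the indices up to i; only families with finite support are
   used in the ultraproducts, so that this property persists.  Finally M' consists of
   the values of the Skolem terms over M and d, one of the Skolem functions choosing
   a true instance of a true existential sentence.  An element below d i is not
   changed by moving the indices above i in a term for it, so it is the value of one
   of countably many terms. *)

Require Import Defs.
From mathcomp Require Import all_boot order ssralg ssrnum rat.
From mathcomp Require Import boolp classical_sets functions cardinality filter wochoice.
From Stdlib Require Import Ring.
From Stdlib Require List.

Set Implicit Arguments.
Unset Strict Implicit.
Unset Printing Implicit Defensive.

Local Open Scope classical_set_scope.

(** * First-order formulas with parameters and unary predicate symbols *)

(** Full induction for [T] is out of reach: it would prove the consistency of PA, while [M] is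
    arbitrary. So MacDowell and Specker cannot be applied to pairs of a model and a truth predicate.
    Instead the elements [d i] are put in first, and truth is added without losing the symmetry that
    makes the elements below [d i] insensitive to the indices above [i].

    Induction survives locally. A skeleton has at most two immediate constituents, and all numeral
    instances of an existential sentence share one skeleton; hence truth near one skeleton is
    definable from finitely many earlier pieces. This local induction yields least true instances,
    and thereby the Skolem function for truth.

    Symmetry has a price: truth must be added for whole orbits of skeletons, and recursion over
    infinitely many skeletons might be ill-founded. It is not, because an automorphism never carries
    a code to one of its proper constituents: the stabiliser of the code would be contained in that
    of its image, and over a dense order finite supports then force the automorphism to fix the
    code. So the depth of the recursion is bounded by the number of orbits. *)

(* De Bruijn indices for the bound variables; [TPar] variables are never bound
   and serve as parameters. *)
Inductive tm : Type :=
| TVar of nat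
| TPar of nat
| TZero
| TSucc of tm
| TAdd of tm & tm
| TMul of tm & tm.

Inductive fm (C : Type) : Type :=
| FEq of tm & tm
| FP of C & tm
| FNeg of fm C
| FAnd of fm C & fm C
| FEx of fm C.

Arguments FEq {C}.

Definition scons (D : Type) (a : D) (e : nat -> D) (n : nat) : D :=
  if n is n'.+1 then e n' else a.

Fixpoint tev (N : arith) (r e : nat -> N) (t : tm) : N :=
  match t with
  | TVar n => e n
  | TPar n => r n
  | TZero => azero
  | TSucc t => asucc (tev r e t)
  | TAdd t u => aadd (tev r e t) (tev r e u)
  | TMul t u => amul (tev r e t) (tev r e u)
  end.

Fixpoint ev (N : arith) (C : Type) (U : C -> N -> Prop) (r e : nat -> N)
    (phi : fm C) : Prop :=
  match phi with
  | FEq t u => tev r e t = tev r e u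
  | FP c t => U c (tev r e t)
  | FNeg phi => ~ ev U r e phi
  | FAnd phi psi => ev U r e phi /\ ev U r e psi
  | FEx phi => exists a, ev U r (scons a e) phi
  end.

Fixpoint tbound (t : tm) : nat :=
  match t with
  | TVar n | TPar n => n.+1
  | TZero => 0
  | TSucc t => tbound t
  | TAdd t u | TMul t u => maxn (tbound t) (tbound u)
  end.

(** A crude bound, not lowered under [FEx]. Only its finiteness matters: the truth value of a
    formula depends on finitely many entries of the environments ([ev_agree]). *)
Fixpoint fbound (C : Type) (phi : fm C) : nat :=
  match phi with
  | FEq t u => maxn (tbound t) (tbound u)
  | FP _ t => tbound t
  | FNeg phi | FEx phi => fbound phi
  | FAnd phi psi => maxn (fbound phi) (fbound psi)
  end.

Fixpoint occurs (C : Type) (c : C) (phi : fm C) : Prop :=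
  match phi with
  | FEq _ _ => False
  | FP c' _ => c = c'
  | FNeg phi | FEx phi => occurs c phi
  | FAnd phi psi => occurs c phi \/ occurs c psi
  end.

Fixpoint tinst (sv sp : nat -> tm) (t : tm) : tm :=
  match t with
  | TVar n => sv n
  | TPar n => sp n
  | TZero => TZero
  | TSucc t => TSucc (tinst sv sp t)
  | TAdd t u => TAdd (tinst sv sp t) (tinst sv sp u)
  | TMul t u => TMul (tinst sv sp t) (tinst sv sp u)
  end.

Definition tshift : tm -> tm := tinst (fun n => TVar n.+1) TPar.

Fixpoint finst (C : Type) (sv sp : nat -> tm) (phi : fm C) : fm C :=
  match phi with
  | FEq t u => FEq (tinst sv sp t) (tinst sv sp u)
  | FP c t => FP c (tinst sv sp t)
  | FNeg phi => FNeg (finst sv sp phi)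
  | FAnd phi psi => FAnd (finst sv sp phi) (finst sv sp psi)
  | FEx phi => FEx (finst (scons (TVar 0) (tshift \o sv)) (tshift \o sp) phi)
  end.

Lemma tev_agree (N : arith) (r r' e e' : nat -> N) t :
  (forall n, n < tbound t -> r n = r' n) -> (forall n, n < tbound t -> e n = e' n) ->
  tev r e t = tev r' e' t.
Proof.
elim: t => [n|n||t IH|t IHt u IHu|t IHt u IHu] //= hr he; rewrite ?hr ?he //.
- by rewrite IH.
- by rewrite IHt ?IHu // => n hn; rewrite ?hr ?he // leq_max hn ?orbT.
- by rewrite IHt ?IHu // => n hn; rewrite ?hr ?he // leq_max hn ?orbT.
Qed.

Lemma ev_agree (N : arith) C (U U' : C -> N -> Prop) phi :
  (forall c, occurs c phi -> forall x, U c x <-> U' c x) ->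
  forall (r r' e e' : nat -> N),
  (forall n, n < fbound phi -> r n = r' n) -> (forall n, n < fbound phi -> e n = e' n) ->
  ev U r e phi <-> ev U' r' e' phi.
Proof.
elim: phi => [t u|c t|phi IH|phi IHp psi IHq|phi IH] //= hU r r' e e' hr he.
- rewrite (@tev_agree _ r r' e e' t) ?(@tev_agree _ r r' e e' u) //
    => n hn; rewrite ?hr ?he // leq_max hn ?orbT //.
- rewrite (@tev_agree _ r r' e e' t) //; exact: hU.
- by rewrite (IH hU r r' e e').
- rewrite (IHp _ r r' e e') ?(IHq _ r r' e e') //;
    try by [move=> c hc; apply: hU; tauto | move=> n hn; rewrite ?hr ?he // leq_max hn ?orbT].
- split=> -[a ha]; exists a; move: ha; rewrite (IH hU r r' (scons a e) (scons a e')) //;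
    by case=> [|n] //= hn; apply: he; apply: ltnW.
Qed.

Lemma tev_inst (N : arith) (r e : nat -> N) sv sp t :
  tev r e (tinst sv sp t) = tev (tev r e \o sp) (tev r e \o sv) t.
Proof. by elim: t => //= [t ->|t -> u ->|t -> u ->]. Qed.

Lemma tev_shift (N : arith) (r e : nat -> N) a t : tev r (scons a e) (tshift t) = tev r e t.
Proof. by rewrite /tshift tev_inst. Qed.

Lemma ev_inst (N : arith) C (U : C -> N -> Prop) phi : forall sv sp (r e : nat -> N),
  ev U r e (finst sv sp phi) <-> ev U (tev r e \o sp) (tev r e \o sv) phi.
Proof.
elim: phi => [t u|c t|phi IH|phi IHp psi IHq|phi IH] /= sv sp r e; rewrite ?tev_inst //.
- by rewrite IH.
- by rewrite IHp IHq.
have E1 a : tev r (scons a e) \o (tshift \o sp) = tev r e \o sp.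
  by apply/funext => n /=; rewrite tev_shift.
have E2 a : tev r (scons a e) \o scons (TVar 0) (tshift \o sv) = scons a (tev r e \o sv).
  by apply/funext; case=> [|n] //=; rewrite tev_shift.
by split=> -[a ha]; exists a; move: ha; rewrite IH E1 E2.
Qed.

(** * Definable families of relations *)

Section Definability.
Variables (X : Type) (N : X -> arith) (C : Type) (U : forall x : X, C -> N x -> Prop).
Variable P : set (forall x, N x).
Hypothesis P0 : P (fun=> azero).

Definition DT (t : forall x, (nat -> N x) -> N x) : Prop :=
  exists u (r : nat -> forall x, N x),
    (forall n, P (r n)) /\ forall x e, t x e = tev (r^~ x) e u.

(** One formula and one sequence of sections in [P] serve all structures [N x] simultaneously. With
    [X = unit] this is definability with parameters in a single structure ([PD]); with only the zero
    section in [P] it is uniform definability ([ud_dfn]); with [X] the index set of a product it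
    describes definable families. *)
Definition Dfn (R : forall x, (nat -> N x) -> Prop) : Prop :=
  exists phi (r : nat -> forall x, N x),
    (forall n, P (r n)) /\ forall x e, R x e <-> ev (@U x) (r^~ x) e phi.

Lemma dt_var k : DT (fun x e => e k).
Proof. by exists (TVar k), (fun _ _ => azero). Qed.

Lemma dt_par f : P f -> DT (fun x e => f x).
Proof. by move=> hf; exists (TPar 0), (fun=> f). Qed.

Lemma dt_zero : DT (fun x e => azero).
Proof. by exists TZero, (fun _ _ => azero). Qed.

Lemma dt_succ t : DT t -> DT (fun x e => asucc (t x e)).
Proof. by move=> [u [r [hr h]]]; exists (TSucc u), r; split=> // x e /=; rewrite h. Qed.

(** Interleaving lets two formulas share one parameter sequence without any bound on the parameters
    that occur in them. *)
Definition pmerge (r1 r2 : nat -> forall x, N x) n : forall x, N x :=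
  if odd n then r2 n./2 else r1 n./2.

Lemma merge1 r1 r2 x e t :
  tev ((pmerge r1 r2)^~ x) e (tinst TVar (fun n => TPar n.*2) t) = tev (r1^~ x) e t.
Proof. by rewrite tev_inst; congr tev; apply/funext => n /=; rewrite /pmerge odd_double doubleK. Qed.

Lemma merge2 r1 r2 x e t :
  tev ((pmerge r1 r2)^~ x) e (tinst TVar (fun n => TPar n.*2.+1) t) = tev (r2^~ x) e t.
Proof.
rewrite tev_inst; congr tev; apply/funext => n /=.
by rewrite /pmerge /= odd_double /= uphalf_double.
Qed.

Lemma fmerge1 r1 r2 x e phi :
  ev (@U x) ((pmerge r1 r2)^~ x) e (finst TVar (fun n => TPar n.*2) phi)
  <-> ev (@U x) (r1^~ x) e phi.
Proof.
rewrite ev_inst (_ : _ \o _ = r1^~ x) //.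
by apply/funext => n /=; rewrite /pmerge odd_double doubleK.
Qed.

Lemma fmerge2 r1 r2 x e phi :
  ev (@U x) ((pmerge r1 r2)^~ x) e (finst TVar (fun n => TPar n.*2.+1) phi)
  <-> ev (@U x) (r2^~ x) e phi.
Proof.
rewrite ev_inst (_ : _ \o _ = r2^~ x) //.
by apply/funext => n /=; rewrite /pmerge /= odd_double /= uphalf_double.
Qed.

Lemma pmergeP r1 r2 : (forall n, P (r1 n)) -> (forall n, P (r2 n)) ->
  forall n, P (pmerge r1 r2 n).
Proof. by move=> h1 h2 n; rewrite /pmerge; case: ifP. Qed.

Lemma dt_add t u : DT t -> DT u -> DT (fun x e => aadd (t x e) (u x e)).
Proof.
move=> [t' [r [hr h]]] [u' [r' [hr' h']]].
exists (TAdd (tinst TVar (fun n => TPar n.*2) t') (tinst TVar (fun n => TPar n.*2.+1) u')).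
exists (pmerge r r'); split; first exact: pmergeP.
by move=> x e /=; rewrite merge1 merge2 h h'.
Qed.

Lemma dt_mul t u : DT t -> DT u -> DT (fun x e => amul (t x e) (u x e)).
Proof.
move=> [t' [r [hr h]]] [u' [r' [hr' h']]].
exists (TMul (tinst TVar (fun n => TPar n.*2) t') (tinst TVar (fun n => TPar n.*2.+1) u')).
exists (pmerge r r'); split; first exact: pmergeP.
by move=> x e /=; rewrite merge1 merge2 h h'.
Qed.

Lemma dfn_ext (R R' : forall x, (nat -> N x) -> Prop) :
  (forall x e, R x e <-> R' x e) -> Dfn R -> Dfn R'.
Proof. by move=> hRR [phi [r [hr h]]]; exists phi, r; split=> // x e; rewrite -hRR. Qed.

Lemma dfn_eq t u : DT t -> DT u -> Dfn (fun x e => t x e = u x e).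
Proof.
move=> [t' [r [hr h]]] [u' [r' [hr' h']]].
exists (FEq (tinst TVar (fun n => TPar n.*2) t') (tinst TVar (fun n => TPar n.*2.+1) u')).
exists (pmerge r r'); split; first exact: pmergeP.
by move=> x e /=; rewrite merge1 merge2 h h'.
Qed.

Lemma dfn_pred c t : DT t -> Dfn (fun x e => @U x c (t x e)).
Proof. by move=> [t' [r [hr h]]]; exists (FP c t'), r; split=> // x e /=; rewrite h. Qed.

Lemma dfn_not R : Dfn R -> Dfn (fun x e => ~ R x e).
Proof. by move=> [phi [r [hr h]]]; exists (FNeg phi), r; split=> // x e /=; rewrite h. Qed.

Lemma dfn_and R S : Dfn R -> Dfn S -> Dfn (fun x e => R x e /\ S x e).
Proof.
move=> [t' [r [hr h]]] [u' [r' [hr' h']]].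
exists (FAnd (finst TVar (fun n => TPar n.*2) t') (finst TVar (fun n => TPar n.*2.+1) u')).
exists (pmerge r r'); split; first exact: pmergeP.
by move=> x e /=; rewrite fmerge1 fmerge2 h h'.
Qed.

Lemma dfn_ex (R : forall x, (nat -> N x) -> N x -> Prop) :
  Dfn (fun x e => R x (fun n => e n.+1) (e 0)) -> Dfn (fun x e => exists a, R x e a).
Proof.
move=> [phi [r [hr h]]]; exists (FEx phi), r; split=> // x e /=.
by split=> -[a ha]; exists a; apply/(h x (scons a e)).
Qed.

Lemma dfn_all (R : forall x, (nat -> N x) -> N x -> Prop) :
  Dfn (fun x e => R x (fun n => e n.+1) (e 0)) -> Dfn (fun x e => forall a, R x e a).
Proof.
move=> h; apply: dfn_ext (dfn_not (dfn_ex (R := fun x e a => ~ R x e a) (dfn_not h))).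
by move=> x e; rewrite -forallNE; split=> hh a; [apply: contrapT|rewrite notE].
Qed.

Lemma dfn_or R S : Dfn R -> Dfn S -> Dfn (fun x e => R x e \/ S x e).
Proof.
move=> hR hS; apply: dfn_ext (dfn_not (dfn_and (dfn_not hR) (dfn_not hS))) => x e.
have := EM (R x e); have := EM (S x e); tauto.
Qed.

Lemma dfn_imp R S : Dfn R -> Dfn S -> Dfn (fun x e => R x e -> S x e).
Proof.
move=> hR hS; apply: dfn_ext (dfn_or (dfn_not hR) hS) => x e.
have := EM (R x e); tauto.
Qed.

Lemma dfn_iff R S : Dfn R -> Dfn S -> Dfn (fun x e => R x e <-> S x e).
Proof. by move=> hR hS; apply: dfn_and; apply: dfn_imp. Qed.

Lemma dfn_true : Dfn (fun x e => True).
Proof. by apply: dfn_ext (dfn_eq dt_zero dt_zero). Qed.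

Lemma dfn_false : Dfn (fun x e => False).
Proof. by apply: dfn_ext (dfn_not dfn_true) => x e; tauto. Qed.

Lemma dfn_and3 R S T : Dfn R -> Dfn S -> Dfn T -> Dfn (fun x e => [/\ R x e, S x e & T x e]).
Proof.
by move=> hR hS hT; apply: dfn_ext (dfn_and hR (dfn_and hS hT)) => x e;
  split=> [[? []]|[]].
Qed.

Lemma dfn_and4 R S T V : Dfn R -> Dfn S -> Dfn T -> Dfn V ->
  Dfn (fun x e => [/\ R x e, S x e, T x e & V x e]).
Proof.
by move=> hR hS hT hV; apply: dfn_ext (dfn_and hR (dfn_and hS (dfn_and hT hV))) => x e;
  split=> [[? [? []]]|[]].
Qed.

(** The values of all variables but one become parameters. This is the form in which induction and
    the least number principle are applied to a formula in an environment. *)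
Lemma dfn_inst phi (r e : nat -> forall x, N x) : (forall n, P (r n)) -> (forall n, P (e n)) ->
  Dfn (fun x e' => ev (@U x) (r^~ x) (scons (e' 0) (e^~ x)) phi).
Proof.
move=> hr he; pose sv := scons (TVar 0) (fun n => TPar n.*2.+1).
exists (finst sv (fun n => TPar n.*2) phi), (pmerge r e); split; first exact: pmergeP.
move=> x e'; rewrite ev_inst.
have -> : tev ((pmerge r e)^~ x) e' \o (fun n => TPar n.*2) = r^~ x.
  by apply/funext => n /=; rewrite /pmerge odd_double doubleK.
suff -> : tev ((pmerge r e)^~ x) e' \o sv = scons (e' 0) (e^~ x) by [].
by apply/funext; case=> [|n] //=; rewrite /pmerge /= odd_double /= uphalf_double.
Qed.

End Definability.

(** * Elimination of definable parameters and of definable predicates *)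

Section Reparametrisation.
Variables (X : Type) (N : X -> arith) (C : Type) (U : forall x : X, C -> N x -> Prop).
Variable P : set (forall x, N x).
Hypothesis P0 : P (fun=> azero).

Lemma dfn_ren (s : nat -> nat) (R : forall x, (nat -> N x) -> Prop) :
  Dfn U P R -> Dfn U P (fun x e => R x (e \o s)).
Proof.
move=> [phi [r [hr h]]]; exists (finst (TVar \o s) TPar phi), r; split=> // x e.
by rewrite ev_inst h.
Qed.

Variable P' : set (forall x, N x).
Hypothesis P'P : forall f, P' f -> Dfn U P (fun x e => f x = e 0).

(** Each parameter is replaced by its definition. A definable section need not be the value of a
    term, so terms are first turned into their graphs, with the value in variable 0. *)
Lemma dfn_reparam (R : forall x, (nat -> N x) -> Prop) : Dfn U P' R -> Dfn U P R.
Proof.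
move=> [phi [r [hr h]]].
suff: Dfn U P (fun x e => ev (@U x) (r^~ x) e phi) by apply: dfn_ext => x e; rewrite h.
have graph t : Dfn U P (fun x e => tev (r^~ x) (fun n => e n.+1) t = e 0).
  elim: t => [n|n||t IH|t IHt u IHu|t IHt u IHu] /=.
  - by apply: dfn_eq => //; apply: dt_var.
  - exact: P'P.
  - by apply: dfn_eq => //; [apply: dt_zero|apply: dt_var].
  - apply: (dfn_ext (R := fun x e => exists a,
      tev (r^~ x) (fun n => e n.+1) t = a /\ asucc a = e 0)).
      by move=> x e; split=> [[a [-> ->]]|h1] //; eexists; split; [reflexivity|].
    apply: dfn_ex; apply: dfn_and => //.
      exact: (dfn_ren (scons 0 (fun n => n.+2)) IH).
    by apply: dfn_eq => //; [apply: dt_succ|]; apply: dt_var.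
  - apply: (dfn_ext (R := fun x e => exists a b,
      (tev (r^~ x) (fun n => e n.+1) t = a /\ tev (r^~ x) (fun n => e n.+1) u = b)
      /\ aadd a b = e 0)).
      by move=> x e; split=> [[a [b [[-> ->] ->]]]|h1] //; do 2!eexists; split; [split; reflexivity|].
    apply: dfn_ex; apply: dfn_ex; apply: dfn_and => //; first apply: dfn_and => //.
    + exact: (dfn_ren (scons 1 (fun n => n.+3)) IHt).
    + exact: (dfn_ren (scons 0 (fun n => n.+3)) IHu).
    by apply: dfn_eq => //; [apply: dt_add => //|]; apply: dt_var.
  - apply: (dfn_ext (R := fun x e => exists a b,
      (tev (r^~ x) (fun n => e n.+1) t = a /\ tev (r^~ x) (fun n => e n.+1) u = b)
      /\ amul a b = e 0)).
      by move=> x e; split=> [[a [b [[-> ->] ->]]]|h1] //; do 2!eexists; split; [split; reflexivity|].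
    apply: dfn_ex; apply: dfn_ex; apply: dfn_and => //; first apply: dfn_and => //.
    + exact: (dfn_ren (scons 1 (fun n => n.+3)) IHt).
    + exact: (dfn_ren (scons 0 (fun n => n.+3)) IHu).
    by apply: dfn_eq => //; [apply: dt_mul => //|]; apply: dt_var.
elim: phi {R h} => [t u|c t|phi IH|phi IHp psi IHq|phi IH] /=.
- apply: (dfn_ext (R := fun x e => exists a, tev (r^~ x) e t = a /\ tev (r^~ x) e u = a)).
    by move=> x e; split=> [[a [-> ->]]|h1] //; eexists; split; [reflexivity|].
  by apply: dfn_ex; apply: dfn_and.
- apply: (dfn_ext (R := fun x e => exists a, tev (r^~ x) e t = a /\ @U x c a)).
    by move=> x e; split=> [[a [-> ]]|h1] //; eexists; split; [reflexivity|].
  by apply: dfn_ex; apply: dfn_and => //; apply: dfn_pred; apply: dt_var.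
- exact: dfn_not.
- exact: dfn_and.
- apply: (dfn_ex (R := fun x e a => ev (@U x) (r^~ x) (scons a e) phi)).
  have -> : (fun x e => ev (@U x) (r^~ x) (scons (e 0) (fun n => e n.+1)) phi)
    = (fun x e => ev (@U x) (r^~ x) e phi) :> (forall x, (nat -> N x) -> Prop).
    by apply: functional_extensionality_dep => x; apply/funext => e; congr ev; apply/funext; case.
  exact: IH.
Qed.

End Reparametrisation.

Lemma dfn_pred_subst X (N : X -> arith) C D (U : forall x : X, C -> N x -> Prop)
    (V : forall x : X, D -> N x -> Prop) (P : set (forall x, N x)) :
  P (fun=> azero) ->
  (forall d, Dfn U P (fun x e => @V x d (e 0))) ->
  forall R, Dfn V P R -> Dfn U P R.
Proof.
move=> P0 hV R [phi [r [hr h]]].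
suff: Dfn U P (fun x e => ev (@V x) (r^~ x) e phi) by apply: dfn_ext => x e; rewrite h.
have dt t : DT P (fun x e => tev (r^~ x) e t) by exists t, r.
elim: phi {R h} => [t u|c t|phi IH|phi IHp psi IHq|phi IH] /=.
- by apply: dfn_eq.
- apply: (dfn_ext (R := fun x e => exists a, tev (r^~ x) e t = a /\ @V x c a)).
    by move=> x e; split=> [[a [-> ]]|h1] //; eexists; split; [reflexivity|].
  apply: dfn_ex; apply: dfn_and => //.
  apply: dfn_eq => //; last by apply: dt_var.
  by exists (tshift t), r; split=> // x e; rewrite tev_inst.
- exact: dfn_not.
- exact: dfn_and.
- apply: (dfn_ex (R := fun x e a => ev (@V x) (r^~ x) (scons a e) phi)).
  have -> : (fun x e => ev (@V x) (r^~ x) (scons (e 0) (fun n => e n.+1)) phi)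
    = (fun x e => ev (@V x) (r^~ x) e phi) :> (forall x, (nat -> N x) -> Prop).
    by apply: functional_extensionality_dep => x; apply/funext => e; congr ev; apply/funext; case.
  exact: IH.
Qed.

(** * Uniform definability and induction *)

(** No parameters and no reference to a particular structure: such relations are preserved by
    isomorphisms ([ud_iso]) and transfer through reduced products ([los_ud]). *)
Definition UD C (R : forall N : arith, (C -> N -> Prop) -> (nat -> N) -> Prop) : Prop :=
  exists phi : fm C, forall N U r e, R N U e <-> ev U r e phi.

(** The index type is the class of all expanded structures, so the closure properties of [Dfn] give
    uniform definability as well. *)
Lemma ud_dfn C (R : forall N : arith, (C -> N -> Prop) -> (nat -> N) -> Prop) :
  Dfn (X := {N : arith & C -> N -> Prop}) (N := @projT1 _ _) (@projT2 _ _)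
      [set fun=> azero] (fun x e => R (projT1 x) (projT2 x) e) -> UD R.
Proof.
move=> [phi [r [hr h]]]; exists (finst TVar (fun=> TZero) phi) => N U r' e.
rewrite ev_inst (h (existT _ N U) e) /=.
by rewrite (_ : r^~ _ = (fun=> azero)) //; apply/funext => n; rewrite hr.
Qed.

Definition IND (N : arith) C (U : C -> N -> Prop) : Prop :=
  forall (phi : fm C) (r e : nat -> N), ev U r (scons azero e) phi ->
    (forall a, ev U r (scons a e) phi -> ev U r (scons (asucc a) e) phi) ->
    forall a, ev U r (scons a e) phi.

Definition PD (N : arith) C (U : C -> N -> Prop) (R : (nat -> N) -> Prop) : Prop :=
  Dfn (X := unit) (N := fun=> N) (fun=> U) setT (fun=> R).

Lemma IND_PD (N : arith) C (U : C -> N -> Prop) (Q : N -> Prop) :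
  IND U -> PD U (fun e => Q (e 0)) ->
  Q azero -> (forall a, Q a -> Q (asucc a)) -> forall a, Q a.
Proof.
move=> hI [phi [r [_ h]]] h0 hS a.
have E b : Q b <-> ev U (r^~ tt) (scons b (fun=> azero)) phi by rewrite -(h tt).
by apply/E/hI => [|b]; rewrite -!E //; apply: hS.
Qed.

(** Every induction principle for a new truth predicate comes from here: each of its pieces is
    definable from predicates that already satisfy induction, jointly with them. *)
Lemma IND_subst (N : arith) C D (U : C -> N -> Prop) (V : D -> N -> Prop) :
  IND U -> (forall d, PD U (fun e => V d (e 0))) -> IND V.
Proof.
move=> hI hV phi r e h0 hS a.
apply: (IND_PD (Q := fun a => ev V r (scons a e) phi) hI) => //.
have := @dfn_pred_subst unit (fun=> N) C D (fun=> U) (fun=> V) setT I hV.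
by apply; exact: (@dfn_inst unit (fun=> N) D (fun=> V) setT phi (fun n _ => r n) (fun n _ => e n)).
Qed.

Fixpoint tr_tm (k : nat) (t : tm) : aterm :=
  match t with
  | TVar n => AVar (if n < k then (k.-1 - n) * 3 else (n - k) * 3 + 1)
  | TPar n => AVar (n * 3 + 2)
  | TZero => AZero
  | TSucc t => ASucc (tr_tm k t)
  | TAdd t u => AAdd (tr_tm k t) (tr_tm k u)
  | TMul t u => AMul (tr_tm k t) (tr_tm k u)
  end.

(* The variable bound at depth k is named 3k; free and parameter variables get
   names congruent to 1 and 2, so that no capture can occur. *)
Fixpoint tr_fm (k : nat) (phi : fm void) : aform :=
  match phi with
  | FEq t u => AEq (tr_tm k t) (tr_tm k u)
  | FP c t => match c with end
  | FNeg phi => ANeg (tr_fm k phi)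
  | FAnd phi psi => AAnd (tr_fm k phi) (tr_fm k psi)
  | FEx phi => AEx (k * 3) (tr_fm k.+1 phi)
  end.

Definition tr_env (N : arith) k (E r e : nat -> N) : Prop :=
  [/\ forall n, n < k -> E ((k.-1 - n) * 3) = e n,
      forall n, E (n * 3 + 1) = e (n + k) & forall n, E (n * 3 + 2) = r n].

Lemma tr_tmP (N : arith) k (E r e : nat -> N) t :
  tr_env k E r e -> aeval E (tr_tm k t) = tev r e t.
Proof.
move=> [h1 h2 h3]; elim: t => //= [n|t ->|t -> u ->|t -> u ->] //.
by case: ltnP => hn; [rewrite h1|rewrite h2 subnK].
Qed.

Lemma tr_fmP (N : arith) (U : void -> N -> Prop) phi : forall k (E r e : nat -> N),
  tr_env k E r e -> sat E (tr_fm k phi) <-> ev U r e phi.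
Proof.
elim: phi => [t u|[]|phi IH|phi IHp psi IHq|phi IH] //= k E r e hE.
- by rewrite !(tr_tmP _ hE).
- by rewrite (IH _ _ _ _ hE).
- by rewrite (IHp _ _ _ _ hE) (IHq _ _ _ _ hE).
suff H a : tr_env k.+1 (upd E (k * 3) a) r (scons a e).
  by split=> -[a ha]; exists a; move: ha; rewrite (IH _ _ _ _ (H a)).
case: hE => h1 h2 h3; split=> n; rewrite /upd.
- case: n => [|n] /=; first by rewrite subn0 eqxx.
  rewrite ltnS => hn; rewrite -h1 //= eqn_mul2r /= ifF; last first.
    have hlt : k - n.+1 < k by rewrite ltn_subrL (leq_ltn_trans _ hn).
    by apply/eqP => h; move: hlt; rewrite h ltnn.
  by congr (E (_ * 3)); rewrite -subn1 -subnDA add1n.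
- rewrite (addnS n k) /= -h2 ifF //.
  by apply/eqP => /(congr1 (modn^~ 3)); rewrite modnMl modnMDl.
- by rewrite -h3 ifF //; apply/eqP => /(congr1 (modn^~ 3)); rewrite modnMl modnMDl.
Qed.

Lemma PA_IND (N : arith) (U : void -> N -> Prop) : PA N -> IND U.
Proof.
move=> hPA phi r e h0 hS a.
(* At depth 0 the free variable 0 has the name 1, so [pa_ind] is used for the variable 1. Names
   divisible by 3 are only used for bound variables and may have any value here. *)
pose E b n := if n %% 3 == 1 then scons b e (n %/ 3) else r (n %/ 3).
have EE b : tr_env 0 (E b) r (scons b e).
  split=> // n; rewrite /E.
    by rewrite modnMDl divnMDl //= addn0 addn0.
  by rewrite modnMDl divnMDl //= addn0.
have Eu b : E b = upd (E b) 1 b.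
  by apply/funext => n; rewrite /upd; case: eqP => // ->.
have Eu' b c : upd (E b) 1 c = E c.
  apply/funext => n; rewrite /upd; case: eqP => [-> //|hn].
  rewrite /E; case: eqP => // h3; case hq: (n %/ 3) => [|q] //.
  by case: hn; rewrite (divn_eq n 3) hq h3.
have H b : sat (upd (E azero) 1 b) (tr_fm 0 phi) <-> ev U r (scons b e) phi.
  by rewrite Eu'; apply: tr_fmP.
by apply/H; apply: (pa_ind hPA) => [|b]; rewrite !H //; apply: hS.
Qed.

(** [s] gives the de Bruijn index of each name bound so far; all other names become parameters and
    so keep their value in the environment [r]. *)
Fixpoint rt_tm (s : nat -> option nat) (t : aterm) : tm :=
  match t with
  | AVar n => if s n is Some k then TVar k else TPar n
  | AZero => TZero
  | ASucc t => TSucc (rt_tm s t)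
  | AAdd t u => TAdd (rt_tm s t) (rt_tm s u)
  | AMul t u => TMul (rt_tm s t) (rt_tm s u)
  end.

Fixpoint rt_fm (s : nat -> option nat) (phi : aform) : fm void :=
  match phi with
  | AEq t u => FEq (rt_tm s t) (rt_tm s u)
  | ANeg phi => FNeg (rt_fm s phi)
  | AAnd phi psi => FAnd (rt_fm s phi) (rt_fm s psi)
  | AEx n phi => FEx (rt_fm (fun m => if m == n then Some 0 else omap S (s m)) phi)
  end.

Lemma rt_fmP (N : arith) (U : void -> N -> Prop) phi : forall s (r e : nat -> N),
  ev U r e (rt_fm s phi) <-> sat (fun n => if s n is Some k then e k else r n) phi.
Proof.
have T t s (r e : nat -> N) :
    tev r e (rt_tm s t) = aeval (fun n => if s n is Some k then e k else r n) t.
  by elim: t => //= [n|t ->|t -> u ->|t -> u ->] //; case: (s n).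
elim: phi => [t u|phi IH|phi IHp psi IHq|n phi IH] //= s r e; rewrite ?T //.
- by rewrite IH.
- by rewrite IHp IHq.
by split=> -[a]; [rewrite IH => ha|move=> ha]; exists a; [|rewrite IH]; move: ha;
   congr sat; apply/funext => m; rewrite /upd; case: eqP => // _; case: (s m).
Qed.

Record PAax (N : arith) : Prop := {
  ax_succ0 : forall x : N, asucc x <> azero;
  ax_succI : forall x y : N, asucc x = asucc y -> x = y;
  ax_add0 : forall x : N, aadd x azero = x;
  ax_addS : forall x y : N, aadd x (asucc y) = asucc (aadd x y);
  ax_mul0 : forall x : N, amul x azero = azero;
  ax_mulS : forall x y : N, amul x (asucc y) = aadd (amul x y) x }.

Lemma PA_ax (N : arith) : PA N -> PAax N.
Proof. by case=> *; split. Qed.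

Lemma IND_PA (N : arith) C (U : C -> N -> Prop) : PAax N -> IND U -> PA N.
Proof.
move=> [? ? ? ? ? ?] hI; split=> // phi n e h0 hS a.
have hI' : IND (fun (c : void) (x : N) => False).
  by apply: IND_subst hI _; case.
have H b : sat (upd e n b) phi <->
    ev (fun (c : void) (x : N) => False) e (scons b e)
      (rt_fm (fun m => if m == n then Some 0 else None) phi).
  rewrite rt_fmP; suff -> : upd e n b = fun m => if (if m == n then Some 0 else None) is Some k then scons b e k else e m by [].
  by apply/funext => m; rewrite /upd; case: eqP.
by apply/H/hI' => [|b]; rewrite -!H //; apply: hS.
Qed.

(** * Substitution of terms, and automation for proofs of definability *)

Section Substitution.
Variables (X : Type) (N : X -> arith) (C : Type) (U : forall x : X, C -> N x -> Prop).
Variable P : set (forall x, N x).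
Hypothesis P0 : P (fun=> azero).

Lemma dt_shift t : DT P t -> DT P (fun x e => t x (fun n => e n.+1)).
Proof. by move=> [u [r [hr h]]]; exists (tshift u), r; split=> // x e; rewrite tev_inst h. Qed.

(** The substitution is made semantically, by an existential quantifier over the value of the
    term. *)
Lemma dfn_sub (R : forall x, (nat -> N x) -> Prop) t : Dfn U P R -> DT P t ->
  Dfn U P (fun x e => R x (scons (t x e) e)).
Proof.
move=> hR ht; apply: (dfn_ext (R := fun x e => exists a, t x e = a /\ R x (scons a e))).
  by move=> x e; split=> [[a [-> ]]|h] //; eexists; split; [reflexivity|].
apply: dfn_ex; apply: dfn_and => //.
  by apply: dfn_eq => //; [apply: dt_shift|apply: dt_var].
apply: dfn_ext hR => x e.
by rewrite (_ : scons _ _ = e) //; apply/funext; case.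
Qed.

Lemma dfn_sub1 (R : forall x, N x -> Prop) t :
  Dfn U P (fun x e => R x (e 0)) -> DT P t -> Dfn U P (fun x e => R x (t x e)).
Proof. by move=> hR ht; apply: dfn_sub hR ht. Qed.

Lemma dfn_sub2 (R : forall x, N x -> N x -> Prop) t u :
  Dfn U P (fun x e => R x (e 0) (e 1)) -> DT P t -> DT P u ->
  Dfn U P (fun x e => R x (t x e) (u x e)).
Proof. by move=> hR ht hu; apply: (dfn_sub (dfn_sub hR (dt_shift ht)) hu). Qed.

Lemma dfn_sub3 (R : forall x, N x -> N x -> N x -> Prop) t u v :
  Dfn U P (fun x e => R x (e 0) (e 1) (e 2)) -> DT P t -> DT P u -> DT P v ->
  Dfn U P (fun x e => R x (t x e) (u x e) (v x e)).
Proof.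
move=> hR ht hu hv.
exact: (dfn_sub (dfn_sub (dfn_sub hR (dt_shift (dt_shift ht))) (dt_shift hu)) hv).
Qed.

Lemma dfn_sub4 (R : forall x, N x -> N x -> N x -> N x -> Prop) t u v w :
  Dfn U P (fun x e => R x (e 0) (e 1) (e 2) (e 3)) -> DT P t -> DT P u -> DT P v -> DT P w ->
  Dfn U P (fun x e => R x (t x e) (u x e) (v x e) (w x e)).
Proof.
move=> hR ht hu hv hw.
have h1 := dfn_sub hR (dt_shift (dt_shift (dt_shift ht))).
exact: (dfn_sub (dfn_sub (dfn_sub h1 (dt_shift (dt_shift hu))) (dt_shift hv)) hw).
Qed.

Lemma dt_iter_succ k t : DT P t -> DT P (fun x e => iter k asucc (t x e)).
Proof. by move=> ht; elim: k => //= k; apply: dt_succ. Qed.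

Lemma dt_cpair t u : DT P t -> DT P u -> DT P (fun x e => cpair (t x e) (u x e)).
Proof.
by move=> ht hu; apply: dt_add => //; apply: dt_mul => //; apply: dt_add.
Qed.

Lemma dt_ctag k t : DT P t -> DT P (fun x e => ctag k (t x e)).
Proof.
move=> ht; apply: dt_cpair => //.
exact: dt_iter_succ (dt_zero P0).
Qed.

End Substitution.

Ltac dfn_side := solve [exact I | reflexivity | assumption].
Ltac dt_named := fail.
Ltac dt :=
  lazymatch goal with
  | |- DT _ (fun _ e => e _) => apply: dt_var; dfn_side
  | |- _ => first
    [ solve [apply: dt_par; dfn_side]
    | apply: dt_ctag; [dfn_side|dt]
    | apply: dt_cpair; [dt|dt]
    | apply: dt_succ; [dt]
    | apply: dt_add; [dt|dt]
    | apply: dt_mul; [dt|dt]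
    | apply: dt_zero; dfn_side
    | dt_named ]
  end.
(** A hook, redefined each time that further relations are known to be definable, so that [dfn]
    treats these relations as atoms instead of unfolding them. *)
Ltac dfn_named := fail.
Ltac dfn1 := first
  [ dfn_named
  | apply: dfn_not
  | apply: dfn_iff; [ | ]
  | apply: dfn_and4; [ | | | ]
  | apply: dfn_and3; [ | | ]
  | apply: dfn_and; [ | ]
  | apply: dfn_or; [ | ]
  | apply: dfn_imp; [ | ]
  | apply: dfn_ex; cbv beta
  | apply: dfn_all; cbv beta
  | apply: dfn_eq; [dt|dt]
  | apply: dfn_true; dfn_side
  | apply: dfn_false; dfn_side
  | solve [apply: dfn_pred; dt] ].
Ltac dfn := cbv beta; repeat dfn1.

Lemma dfn_lt X (N : X -> arith) C (U : forall x : X, C -> N x -> Prop) P :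
  P (fun=> azero) -> Dfn U P (fun x e => arith_lt (e 0) (e 1)).
Proof. by move=> P0; rewrite /arith_lt; dfn. Qed.

Ltac dfn_lt_tac := refine (dfn_sub2 _ (R := fun x => @arith_lt _) (dfn_lt _ _) _ _);
  [dfn_side|dfn_side|dt|dt].
Ltac dfn_named ::= dfn_lt_tac.

(* The semiring laws in models of PA *)
Declare Scope pa_scope.
Delimit Scope pa_scope with P.

Section Arithmetic.
Variables (N : arith) (hPA : PA N).
Implicit Types x y z a b c d m n : N.
Local Notation "0" := azero : pa_scope.
Local Notation "1" := (asucc azero) : pa_scope.
Local Notation "x + y" := (aadd x y) : pa_scope.
Local Notation "x * y" := (amul x y) : pa_scope.
Local Notation "x < y" := (arith_lt x y) : pa_scope.
Local Notation S := (@asucc N).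
Local Open Scope pa_scope.

(** The trivial expansion: formulas over [void] are the arithmetical formulas. *)
Definition nopred : void -> N -> Prop := fun v _ => match v with end.

Lemma pa_rect (Q : N -> Prop) : PD nopred (fun e => Q (e 0%N)) ->
  Q 0 -> (forall a, Q a -> Q (S a)) -> forall a, Q a.
Proof. exact: IND_PD (PA_IND hPA). Qed.

Ltac pa_ind x := move: (x); apply: pa_rect; [rewrite /PD; dfn| |].

Lemma addx0 x : x + 0 = x. Proof. exact: pa_add0. Qed.
Lemma addxS x y : x + S y = S (x + y). Proof. exact: pa_addS. Qed.
Lemma mulx0 x : x * 0 = 0. Proof. exact: pa_mul0. Qed.
Lemma mulxS x y : x * S y = x * y + x. Proof. exact: pa_mulS. Qed.

Lemma add0x x : 0 + x = x.
Proof. by pa_ind x => [|a IH]; rewrite ?addx0 ?addxS ?IH. Qed.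

Lemma addSx x y : S x + y = S (x + y).
Proof. by pa_ind y => [|a IH]; rewrite ?addx0 ?addxS ?IH. Qed.

Lemma paddC x y : x + y = y + x.
Proof. by pa_ind y => [|a IH]; rewrite ?addx0 ?add0x ?addxS ?addSx ?IH. Qed.

Lemma paddA x y z : x + (y + z) = (x + y) + z.
Proof. by pa_ind z => [|a IH]; rewrite ?addx0 ?addxS ?IH. Qed.

Lemma mul0x x : 0 * x = 0.
Proof. by pa_ind x => [|a IH]; rewrite ?mulx0 ?mulxS ?IH ?addx0. Qed.

Lemma mulSx x y : S x * y = x * y + y.
Proof.
pa_ind y => [|a IH]; first by rewrite !mulx0 addx0.
by rewrite !mulxS IH !addxS -!paddA (paddC a x).
Qed.

Lemma pmulC x y : x * y = y * x.
Proof. by pa_ind y => [|a IH]; rewrite ?mulx0 ?mul0x ?mulxS ?mulSx ?IH. Qed.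

Lemma pmulDr x y z : x * (y + z) = x * y + x * z.
Proof. by pa_ind z => [|a IH]; rewrite ?mulx0 ?addx0 ?addxS ?mulxS ?IH ?paddA. Qed.

Lemma pmulA x y z : x * (y * z) = (x * y) * z.
Proof. by pa_ind z => [|a IH]; rewrite ?mulx0 ?mulxS ?pmulDr ?IH. Qed.

Lemma mul1x x : 1 * x = x.
Proof. by rewrite mulSx mul0x add0x. Qed.

Lemma pmulDl x y z : (x + y) * z = x * z + y * z.
Proof. by rewrite !(pmulC _ z) pmulDr. Qed.

End Arithmetic.

(** Kept folded, so that [rewrite !succP] terminates: a visible [asucc azero] on the right of
    [succP] would be rewritten again. *)
Definition pone (N : arith) : N := asucc azero.

(** * Order, least elements, division with remainder, pairing *)

Section Order.
Variables (N : arith) (hPA : PA N).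
Implicit Types x y z a b c d m n i j k l q r s t u v w : N.
Local Notation "0" := azero : pa_scope.
Local Notation "1" := (pone N) : pa_scope.
Local Notation "x + y" := (aadd x y) : pa_scope.
Local Notation "x * y" := (amul x y) : pa_scope.
Local Notation "x < y" := (arith_lt x y) : pa_scope.
Local Notation S := (@asucc N).
Local Open Scope pa_scope.

Lemma succP x : S x = x + 1.
Proof. by rewrite /pone pa_addS // pa_add0. Qed.

Lemma pa_semiring : semi_ring_theory (0 : N) 1 (@aadd N) (@amul N) eq.
Proof.
split; move=> *; [exact: add0x|exact: paddC|exact: paddA|exact: mul1x|exact: mul0x|exact: pmulC|
  exact: pmulA|exact: pmulDl].
Qed.
Add Ring pa_ring : pa_semiring.

Ltac pa_ind x := move: x; apply: (pa_rect hPA); [rewrite /PD; dfn| |].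

Lemma addIx z x y : x + z = y + z -> x = y.
Proof.
pa_ind z => [|a IH]; rewrite ?(pa_add0 hPA) // !(pa_addS hPA) => /(pa_succI hPA); exact: IH.
Qed.

Lemma addxI z x y : z + x = z + y -> x = y.
Proof. by rewrite !(paddC hPA z) => /addIx. Qed.

Lemma zero_or_succ x : x = 0 \/ exists y, x = S y.
Proof. by pa_ind x => [|a IH]; [left|right; exists a]. Qed.

Lemma add_eq0 x y : x + y = 0 -> x = 0 /\ y = 0.
Proof.
case: (zero_or_succ y) => [->|[z ->]]; first by rewrite pa_add0.
by rewrite pa_addS // => /(pa_succ0 hPA).
Qed.

Lemma ltxx x : ~ x < x.
Proof. by move=> [z]; rewrite -{2}(pa_add0 hPA x) => /addxI /(pa_succ0 hPA). Qed.

Lemma ltx0 x : ~ x < 0.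
Proof. by move=> [z]; rewrite pa_addS // => /(pa_succ0 hPA). Qed.

Lemma lt0S x : 0 < S x.
Proof. by exists x; rewrite add0x. Qed.

Lemma lt0P x : x <> 0 -> 0 < x.
Proof. by case: (zero_or_succ x) => // [[y ->]] _; apply: lt0S. Qed.

Lemma ltxSE x y : x < S y <-> exists z, x + z = y.
Proof.
split=> -[z hz]; exists z; last by rewrite pa_addS // hz.
by move: hz; rewrite pa_addS // => /(pa_succI hPA).
Qed.

Lemma ltxSP x y : x < S y <-> x < y \/ x = y.
Proof.
rewrite ltxSE; split=> [[z <-]|[[z <-]|->]].
- by case: (zero_or_succ z) => [->|[w ->]]; [right; rewrite pa_add0|left; exists w].
- by exists (S z).
- by exists 0; rewrite pa_add0.
Qed.

Lemma ltxS x : x < S x.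
Proof. by apply/ltxSP; right. Qed.

Lemma lt_trans x y z : x < y -> y < z -> x < z.
Proof. move=> [u <-] [v <-]; exists (u + S v); rewrite !succP. ring. Qed.

Lemma ltSx x y : x < y <-> S x < S y.
Proof. by split=> -[z h]; exists z; rewrite ?(addSx hPA) ?h //; move: h; rewrite addSx // => /(pa_succI hPA). Qed.

Lemma lt_total x y : x < y \/ x = y \/ y < x.
Proof.
pa_ind y => [|a].
  by case: (zero_or_succ x) => [->|[z ->]]; [right; left|right; right; apply: lt0S].
case=> [h|[->|[z <-]]]; first by left; apply/ltxSP; left.
  by left; apply: ltxS.
case: (zero_or_succ z) => [->|[w ->]]; first by right; left; rewrite pa_addS // pa_add0.
by right; right; exists w; rewrite !(pa_addS hPA) addSx // pa_addS.
Qed.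

Lemma nlt x y : ~ x < y <-> y < S x.
Proof.
rewrite ltxSP; split=> [h|[h1 h2|-> /ltxx //]].
  by case: (lt_total x y) => // -[->|]; auto.
by apply: (@ltxx x); apply: lt_trans h2 h1.
Qed.

Lemma lt_leS_trans x y z : x < y -> y < S z -> x < z.
Proof. by move=> h /ltxSP [h1|<- //]; apply: lt_trans h1. Qed.

Lemma leS_lt_trans x y z : x < S y -> y < z -> x < z.
Proof. by move=> /ltxSP [h1|-> //] h; apply: lt_trans h. Qed.

Lemma lt_add x y : x < S (x + y).
Proof. by apply/ltxSE; exists y. Qed.

Lemma lt_addr x y : x < S (y + x).
Proof. by apply/ltxSE; exists y; rewrite paddC. Qed.

Lemma lt_add2 z x y : x < y -> z + x < z + y.
Proof. by move=> [w <-]; exists w; rewrite paddA. Qed.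

Lemma lt_add_inv z x y : z + x < z + y -> x < y.
Proof. by move=> [w]; rewrite -paddA // => /addxI <-; exists w. Qed.

Lemma lt_mul z x y : x < y -> x * S z < y * S z.
Proof. by move=> [w <-]; exists (w * z + w + z); rewrite !succP; ring. Qed.

Lemma mulIx z x y : z <> 0 -> x * z = y * z -> x = y.
Proof.
case: (zero_or_succ z) => [//|[w ->]] _ h.
by case: (lt_total x y) => [|[|]] // /(lt_mul w); rewrite h => /ltxx.
Qed.

Lemma least C (U : C -> N -> Prop) (Q : N -> Prop) :
  IND U -> PD U (fun e => Q (e 0%N)) -> (exists a, Q a) ->
  exists a, Q a /\ forall b, b < a -> ~ Q b.
Proof.
move=> hI hQ [a0 ha0]; apply: contrapT => hno.
suff H a : forall b, b < a -> ~ Q b by apply: (H (S a0) a0) => //; apply: ltxS.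
apply: (IND_PD (Q := fun a => forall b, b < a -> ~ Q b) hI) => {a}.
- by rewrite /PD; dfn; exact: hQ.
- by move=> b /ltx0.
- by move=> a IH b /ltxSP [/IH //|->] hQa; apply: hno; exists a.
Qed.

Lemma pa_strong (Q : N -> Prop) : PD (@nopred N) (fun e => Q (e 0%N)) ->
  (forall a, (forall b, b < a -> Q b) -> Q a) -> forall a, Q a.
Proof.
move=> hQ hS a; apply: contrapT => ha.
have [|b [hb]] := least (Q := fun a => ~ Q a) (PA_IND (U := @nopred N) hPA) _ (ex_intro _ a ha).
  by rewrite /PD; dfn; exact: hQ.
by move=> hmin; apply/hb/hS => c hc; apply: contrapT; apply: hmin.
Qed.

Lemma division a m : m <> 0 -> exists q r, a = q * m + r /\ r < m.
Proof.
move=> hm; pa_ind a => [|a [q [r [-> hr]]]].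
  by exists 0, 0; split; [ring|apply: lt0P].
case: (lt_total (S r) m) => [h|[<-|h]].
- by exists q, (S r); split=> //; rewrite succP; rewrite (succP r); ring.
- by exists (S q), 0; split; [rewrite !succP; ring|apply: lt0S].
- by move/ltxSP: h => [h|h]; [case: (@ltxx m); apply: lt_trans h hr|case: (@ltxx m); rewrite {1}h].
Qed.

Lemma division_uniq q q' r r' m : r < m -> r' < m ->
  q * m + r = q' * m + r' -> r = r'.
Proof.
suff H q1 q2 r1 r2 : r1 < m -> q1 < q2 -> q1 * m + r1 <> q2 * m + r2.
  move=> hr hr' h; case: (lt_total q q') => [hq|[hq|hq]].
  - by case: (H _ _ r r' hr hq).
  - by move: h; rewrite hq => /addxI.
  - by case: (H _ _ r' r hr' hq).
move=> [u hu] [w <-] h; apply: (@ltxx (q1 * m + r1)); rewrite {2}h.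
exists (u + w * m + r2).
transitivity (q1 * m + (r1 + S u) + w * m + r2); rewrite !succP; first by ring.
by rewrite -succP hu; ring.
Qed.

(** The code of a pair with sum [s] lies between [s^2] and [s^2 + s], hence below the next square.
    So a code determines first the sum and then the first component. *)
Lemma cpair_lt x y x' y' : x + y < x' + y' -> cpair x y < cpair x' y'.
Proof.
rewrite /cpair => -[w <-].
(* The difference of [(s + w + 1)^2 + x'] and [s^2 + x + 1], where [s = x + y]. *)
exists ((x + y) + y + (1 + 1) * (x + y) * w + w * w + w + w + x').
by rewrite !succP; ring.
Qed.

Lemma cpair_inj x y x' y' : cpair x y = cpair x' y' -> x = x' /\ y = y'.
Proof.
move=> h; case: (lt_total (x + y) (x' + y')) => [/cpair_lt|[hs|/cpair_lt]].
- by rewrite h => /ltxx.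
- move: h; rewrite /cpair hs => /addxI hx; split=> //.
  by move: hs; rewrite hx => /addxI.
- by rewrite h => /ltxx.
Qed.

Lemma cpair_le1 x y : x < S (cpair x y).
Proof. exact: lt_addr. Qed.

Lemma cpair_le2 x y : y < S (cpair x y).
Proof.
apply/ltxSE; rewrite /cpair.
case: (zero_or_succ (x + y)) => [h|[w hw]].
  by have [-> ->] := add_eq0 h; exists 0; ring.
exists (w * w + w + x + x); rewrite hw.
transitivity (y + x + (w * (w + 1) + x)); first by ring.
by rewrite (paddC hPA y) hw !succP; ring.
Qed.

Lemma iter_succ_inj (k k' : nat) : iter k S 0 = iter k' S 0 -> k = k'.
Proof.
elim: k k' => [|k IH] [|k'] //=.
- by move/esym/(pa_succ0 hPA).
- by move/(pa_succ0 hPA).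
- by move/(pa_succI hPA)/IH ->.
Qed.

Lemma ctag_inj (k k' : nat) x x' : ctag k x = ctag k' x' -> k = k' /\ x = x'.
Proof. by move/cpair_inj => [/iter_succ_inj]. Qed.

(** The tag has to be positive: [ctag 0 x] is the square of [x], which does not exceed [x] when [x]
    is zero or one. *)
Lemma ctag_lt (k : nat) x : x < ctag k.+1 x.
Proof.
rewrite /ctag /= /cpair; set n := iter k S 0.
exists (n * n + n + n + x * x + (1 + 1) * n * x + x + n + 1); rewrite !succP; ring.
Qed.

End Order.

(** * Coding of definable sequences by the beta function *)

Definition dv (N : arith) (x y : N) : Prop := exists z, y = amul x z.

(** Coprimality in the shape of Euclid's lemma. It passes to products at once, and [bezout] turns it
    into an equation. *)
Definition cop (N : arith) (x y : N) : Prop := forall z, dv x (amul y z) -> dv x z.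

Definition bmod (N : arith) (b i : N) : N := asucc (amul (asucc i) b).

Section Beta.
Variables (N : arith) (hPA : PA N).
Implicit Types x y z a b c d m n i j k l q r s t u v w : N.
Local Notation "0" := azero : pa_scope.
Local Notation "1" := (pone N) : pa_scope.
Local Notation "x + y" := (aadd x y) : pa_scope.
Local Notation "x * y" := (amul x y) : pa_scope.
Local Notation "x < y" := (arith_lt x y) : pa_scope.
Local Notation S := (@asucc N).
Local Open Scope pa_scope.
Add Ring pa_ring : (pa_semiring hPA).

Ltac pa_ind x := move: x; apply: (pa_rect hPA); [rewrite /PD| |].

Lemma ltS_inv x y : S x < S y -> x < y.
Proof. by move=> h; apply/(ltSx hPA). Qed.

Lemma dv_mulr x y z : dv x y -> dv x (y * z).
Proof. by move=> [w ->]; exists (w * z); ring. Qed.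

Lemma dv_mull x y z : dv x y -> dv x (z * y).
Proof. by move=> [w ->]; exists (z * w); ring. Qed.

Lemma dv_add x y z : dv x (y + z) -> dv x y -> dv x z.
Proof.
move=> [v hv] [u hu]; case: (lt_total hPA v u) => [[w hw]|h].
  exists 0; move: hv; rewrite hu -hw.
  rewrite (_ : _ + z = x * v + (x * S w + z)); last by ring.
  rewrite -{2}(pa_add0 hPA (x * v)) => /(addxI hPA) /(add_eq0 hPA) [_ ->].
  by rewrite pa_mul0.
have [w hw] : exists w, u + w = v.
  by case: h => [->|[w hw]]; [exists 0; rewrite pa_add0|exists (S w)].
exists w; move: hv; rewrite hu -hw pmulDr // => /(addxI hPA); exact.
Qed.

(** Modulo [M] the product [k b] is [-1], so [b] is invertible, and with it its divisor [d]. *)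
Lemma dv_cancel k b d z (M := S (k * b)) : dv d b -> dv M (d * b * z) -> dv M z.
Proof.
move=> [e he] h.
have hM x : dv M (k * b * x) -> dv M x.
  move=> h1; apply: (dv_add (y := k * b * x)) => //.
  by exists x; rewrite /M succP //; ring.
have h2 : dv M (d * z).
  by apply: hM; rewrite (_ : _ * _ = k * (d * b * z)); [apply: dv_mull|ring].
apply: hM; rewrite (_ : _ * z = k * e * (d * z)); first exact: dv_mull.
by rewrite he; ring.
Qed.

Lemma bmod_add b i d : bmod b (i + d) = bmod b i + d * b.
Proof. by rewrite /bmod !succP //; ring. Qed.

Lemma cop_bmod b i d : dv d b ->
  cop (bmod b i) (bmod b (i + d)) /\ cop (bmod b (i + d)) (bmod b i).
Proof.
move=> hd; split=> z h; apply: (dv_cancel (d := d)) (hd) _.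
- apply: (dv_add (y := bmod b i * z)); last by exists z.
  by rewrite -pmulDl // -bmod_add.
- apply: (dv_add (y := bmod b i * z)) => //.
  by exists z; rewrite -pmulDl // -bmod_add.
Qed.

(** The least nonzero [r] of the form [D u - v m] divides both [D] and [m]. With [m = r m1] and
    [D = r D1] one has [D m1 = m D1], so [cop] makes [m] a divisor of [m1], which forces [r = 1]. *)
Lemma bezout m' D (m := S m') : D <> 0 -> cop m D -> exists u v, D * u = v * m + 1.
Proof.
move=> hD hc.
pose Q r := r <> 0 /\ exists u v, D * u = v * m + r.
have [] := least hPA (Q := Q) (PA_IND (U := @nopred N) hPA).
- by rewrite /PD /Q; dfn.
- by exists D; split=> //; exists 1, 0; ring.
move=> r [[hr0 [u0 [v0 h0]]] hmin].
have hr x : (exists u v, D * u = v * m + x) -> dv r x.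
  move=> [u [v h]]; have [q [r' [hx hr']]] := division hPA x hr0.
  case: (pselect (r' = 0)) => [hr'0|hr'0].
    by exists q; rewrite hx hr'0; ring.
  case: (hmin r' hr'); split=> //.
  (* Subtracting [q] times the equation for [r] is replaced by adding [q m'] times it, since [m'] is
     [-1] modulo [m]. *)
  exists (u + q * u0 * m'), (v + q * m' * v0 + q * r).
  transitivity (D * u + q * m' * (D * u0)); first by ring.
  by rewrite h h0 hx /m succP //; ring.
have [D1 hD1] : dv r D by apply: hr; exists 1, 0; ring.
have [m1 hm1] : dv r m.
  apply: hr; case: (zero_or_succ hPA D) => // -[D' hD']; exists m, D'.
  by rewrite hD' succP //; ring.
have [w hw] : dv m m1 by apply: hc; exists D1; rewrite hm1 hD1; ring.
have hm10 : m1 <> 0 by move=> h; move: hm1; rewrite h pa_mul0 // => /(pa_succ0 hPA).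
have hrw : r * w = 1.
  apply: (mulIx hPA hm10); rewrite mul1x // {2}hw hm1; ring.
suff -> : 1 = r by exists u0, v0.
rewrite -hrw; case: (zero_or_succ hPA w) => [hw0|[w' hw']].
  by move: hrw; rewrite hw0 pa_mul0 // => /esym /(pa_succ0 hPA).
move: hrw; case: (zero_or_succ hPA r) => // -[r' hr']; rewrite hw' hr' pa_mulS //.
rewrite pa_addS // => /(pa_succI hPA) /(add_eq0 hPA) [h1 ->].
by move: h1; rewrite mulSx // => /(add_eq0 hPA) [_ ->]; rewrite !succP //; ring.
Qed.

Section Coding.
Variable h : N -> N -> Prop.
Hypothesis hd : PD (@nopred N) (fun e => h (e 0%N) (e 1%N)).
Hypothesis hf : forall i x y, h i x -> h i y -> x = y.

Ltac dfn_h := refine (dfn_sub2 _ (R := fun=> h) hd _ _); [dfn_side|dt|dt].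
Ltac dfn_named ::= first [dfn_lt_tac|dfn_h].

Lemma values_bounded l : (forall i, i < l -> exists x, h i x) ->
  exists B, forall i x, i < l -> h i x -> x < B.
Proof.
pa_ind l => [|_|l IH hl]; first by dfn.
  by exists 0 => i x /(ltx0 hPA).
have [i hi|B hB] := IH; first by apply: hl; apply/(ltxSP hPA); left.
have [x hx] := hl l (ltxS hPA l).
exists (B + S x) => i y /(ltxSP hPA) [hi|->] hy.
  apply: (lt_trans hPA (hB _ _ hi hy)); by exists x.
rewrite (hf hy hx); apply: (leS_lt_trans hPA (y := x + B)); first exact: lt_add.
by rewrite pa_addS // paddC //; apply: ltxS.
Qed.

(** Such a [b] takes the place of a factorial, whose definition would already require coded
    sequences; its existence is proved directly by induction. *)
Lemma common_multiple l B : exists b, [/\ b <> 0, B < S b & forall d, d <> 0 -> d < S l -> dv d b].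
Proof.
pa_ind l; first by rewrite /dv; dfn.
  exists (S B); split=> //; first exact: pa_succ0.
    by apply: (lt_trans hPA (ltxS hPA B)); apply: ltxS.
  by move=> d hd0 /(ltxSP hPA) [/(ltx0 hPA)|].
move=> l [b [hb0 hb h1]]; exists (b * S l); split.
- rewrite -(mul0x hPA (S l)) => hh; apply: hb0; apply: (mulIx hPA _ hh); exact: pa_succ0.
- apply: (lt_leS_trans hPA hb); apply/(ltxSE hPA); exists (b * l).
  by rewrite !succP //; ring.
- move=> d hd0 /(ltxSP hPA) [hdl|->]; first by apply: dv_mulr; apply: h1.
  by apply: dv_mull; exists 1; ring.
Qed.

Lemma beta_exists l : (forall i, i < l -> exists x, h i x) ->
  exists a b, forall i x, i < l -> h i x -> beta a b i x.
Proof.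
move=> hl; have [B hB] := values_bounded hl.
have [b [hb0 hb hdv]] := common_multiple l B.
have hcop i j : i < j -> j < l -> cop (bmod b i) (bmod b j) /\ cop (bmod b j) (bmod b i).
  move=> [d <-] hj; apply: cop_bmod; apply: hdv; first exact: pa_succ0.
  apply: (leS_lt_trans hPA (y := i + S d)); first exact: lt_addr.
  by apply/(ltxSP hPA); left.
(* [D] acts as the product of the moduli below [k]. As with the factorial, only the properties that
   matter are carried through the induction. *)
have hD k : k < S l -> exists D, [/\ D <> 0, forall i, i < k -> dv (bmod b i) D
     & forall j, k < S j -> j < l -> cop (bmod b j) D].
  pa_ind k; first by rewrite /dv /cop /bmod; dfn.
    move=> _; exists 1; split=> [|i /(ltx0 hPA) //|j _ _ z].
      exact: pa_succ0.
    by rewrite mul1x.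
  move=> k IH /ltS_inv hk; have [|D [hD0 hD1 hD2]] := IH.
    by apply/(ltxSP hPA); left.
  exists (D * bmod b k); split.
  - rewrite -(mul0x hPA (bmod b k)) => hh; apply: hD0; apply: (mulIx hPA _ hh); exact: pa_succ0.
  - move=> i /(ltxSP hPA) [hi|->]; first by apply: dv_mulr; apply: hD1.
    by apply: dv_mull; exists 1; ring.
  - move=> j /ltS_inv hkj hj z; rewrite -pmulA // => /(hD2 j _ hj) hz.
    apply: (hcop k j hkj hj).2; apply: hz; exact: (lt_trans hPA hkj (ltxS hPA j)).
suff [a ha] : exists a, forall i x, i < l -> h i x -> beta a b i x by exists a, b.
suff H k : k < S l -> exists a, forall i x, i < k -> h i x -> beta a b i x.
  by apply: (H l); apply: ltxS.
pa_ind k; first by rewrite /beta; dfn.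
  by move=> _; exists 0 => i x /(ltx0 hPA).
move=> k IH /ltS_inv hk; have [|a ha] := IH.
  by apply/(ltxSP hPA); left.
have [|D [hD0 hD1 hD2]] := hD k; first by apply/(ltxSP hPA); left.
have [y hy] := hl k hk.
pose m' := S k * b.
have [u [v huv]] := bezout (m' := m') hD0 (hD2 k (ltxS hPA k) hk).
(* [D] vanishes modulo the earlier moduli, so the earlier remainders stay. Modulo [m' + 1] the
   product [D u] is 1, so the new number is congruent to [y + (m' + 1) a], hence to [y]. *)
exists (a + D * (u * (y + m' * a))) => i x /(ltxSP hPA) [hi|->] hx.
- have [q [hq hxq]] := ha i x hi hx; have [e he] := hD1 i hi.
  exists (q + e * (u * (y + m' * a))); split=> //.
  by rewrite {1}hq he -/(bmod b i); ring.
- rewrite (hf hx hy); exists (a + v * (y + m' * a)); rewrite -/m'; split.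
    transitivity (a + (D * u) * (y + m' * a)); first by ring.
    by rewrite huv succP //; ring.
  apply: (lt_trans hPA (hB k y hk hy)).
  apply: (leS_lt_trans hPA hb); apply: (leS_lt_trans hPA (y := m')); last exact: ltxS.
  by apply/(ltxSE hPA); exists (k * b); rewrite /m' succP //; ring.
Qed.

Lemma seq_exists l : (forall i, i < l -> exists x, h i x) ->
  exists s, seqlen s l /\ forall i x, i < l -> h i x -> entry s i x.
Proof.
move=> hl; have [a [b hab]] := beta_exists hl.
exists (cpair l (cpair a b)); split; first by exists a, b.
by move=> i x hi hx; exists l, a, b; split=> //; apply: hab.
Qed.

End Coding.

Lemma entry_lt s l i x : seqlen s l -> entry s i x -> i < l.
Proof. by move=> [a [b ->]] [l' [a' [b' [/(cpair_inj hPA) [-> _]]]]]. Qed.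

Lemma entry_fun s i x y : entry s i x -> entry s i y -> x = y.
Proof.
move=> [l [a [b [-> hi [q [ha hx]]]]]] [l' [a' [b' [h hi' [q' [ha' hx']]]]]].
have [_ /(cpair_inj hPA) [e1 e2]] := cpair_inj hPA h.
move: ha' hx'; rewrite -e1 -e2 => ha' hx'.
exact: (division_uniq hPA hx hx' (etrans (esym ha) ha')).
Qed.

Lemma entry_total s l i : seqlen s l -> i < l -> exists x, entry s i x.
Proof.
move=> [a [b ->]] hi; have [q [r [h1 h2]]] := division hPA a (@pa_succ0 _ hPA (S i * b)).
by exists r, l, a, b; split=> //; exists q.
Qed.

Lemma entry_seqlen s i x : entry s i x -> exists l, seqlen s l.
Proof. by move=> [l [a [b [-> _ _]]]]; exists l, a, b. Qed.

End Beta.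

(** * Arithmetised syntax *)

(* The logical skeleton: all atomic formulas are replaced by 0. *)
Definition Skel (N : arith) (p k : N) : Prop := derived (fun P w =>
  (exists t u, w = cpair (cEq t u) (cZero N)) \/
  (exists p k, P (cpair p k) /\ w = cpair (cNeg p) (cNeg k)) \/
  (exists p k q l, [/\ P (cpair p k), P (cpair q l) & w = cpair (cAnd p q) (cAnd k l)]) \/
  (exists i p k, P (cpair p k) /\ w = cpair (cEx i p) (cEx i k))) (cpair p k).

(* Equality up to replacing closed terms by closed terms of the same value. *)
Definition Eqv (N : arith) (x y : N) : Prop := derived (fun P w =>
  (exists t u, [/\ ClTerm t, ClTerm u, exists v, Value t v /\ Value u v & w = cpair t u]) \/
  w = cpair (cZero N) (cZero N) \/
  (exists i, w = cpair (cVar i) (cVar i)) \/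
  (exists t t', P (cpair t t') /\ w = cpair (cSucc t) (cSucc t')) \/
  (exists t t' u u', [/\ P (cpair t t'), P (cpair u u') &
                         w = cpair (cAdd t u) (cAdd t' u')]) \/
  (exists t t' u u', [/\ P (cpair t t'), P (cpair u u') &
                         w = cpair (cMul t u) (cMul t' u')]) \/
  (exists t t' u u', [/\ P (cpair t t'), P (cpair u u') &
                         w = cpair (cEq t u) (cEq t' u')]) \/
  (exists p p', P (cpair p p') /\ w = cpair (cNeg p) (cNeg p')) \/
  (exists p p' q q', [/\ P (cpair p p'), P (cpair q q') &
                         w = cpair (cAnd p q) (cAnd p' q')]) \/
  (exists i p p', P (cpair p p') /\ w = cpair (cEx i p) (cEx i p'))) (cpair x y).

(** * Definability of the syntactic relations *)

Section DefinableSyntax.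
Variables (X : Type) (N : X -> arith) (C : Type) (U : forall x : X, C -> N x -> Prop).
Variable P : set (forall x, N x).
Hypothesis P0 : P (fun=> azero).

Lemma dfn_seqlen : Dfn U P (fun x e => seqlen (e 0) (e 1)).
Proof. by rewrite /seqlen; dfn. Qed.

Lemma dfn_entry : Dfn U P (fun x e => entry (e 0) (e 1) (e 2)).
Proof. by rewrite /entry /beta; dfn. Qed.

Ltac dfn_named ::= first
  [ dfn_lt_tac
  | refine (dfn_sub2 _ (R := fun x => @seqlen _) dfn_seqlen _ _); [dfn_side|dt|dt]
  | refine (dfn_sub3 _ (R := fun x => @entry _) dfn_entry _ _ _); [dfn_side|dt|dt|dt] ].
Ltac dt_named ::= first [apply: dt_ctag; [dfn_side|dt] | apply: dt_ctag; [dfn_side|apply: dt_cpair; [dt|dt]]].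

Lemma dfn_Term : Dfn U P (fun x e => Term (e 0)).
Proof. by rewrite /Term /derived; dfn. Qed.

Lemma dfn_Free : Dfn U P (fun x e => Free (e 0) (e 1)).
Proof. by rewrite /Free /derived; dfn. Qed.

Ltac dfn_named ::= first
  [ dfn_lt_tac
  | refine (dfn_sub2 _ (R := fun x => @seqlen _) dfn_seqlen _ _); [dfn_side|dt|dt]
  | refine (dfn_sub3 _ (R := fun x => @entry _) dfn_entry _ _ _); [dfn_side|dt|dt|dt]
  | refine (dfn_sub1 _ (R := fun x => @Term _) dfn_Term _); [dfn_side|dt]
  | refine (dfn_sub2 _ (R := fun x => @Free _) dfn_Free _ _); [dfn_side|dt|dt] ].

Lemma dfn_Form : Dfn U P (fun x e => Form (e 0)).
Proof. by rewrite /Form /derived; dfn. Qed.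

Lemma dfn_ClTerm : Dfn U P (fun x e => ClTerm (e 0)).
Proof. by rewrite /ClTerm; dfn. Qed.

Lemma dfn_Numeral : Dfn U P (fun x e => Numeral (e 0) (e 1)).
Proof. by rewrite /Numeral /derived; dfn. Qed.

Lemma dfn_Value : Dfn U P (fun x e => Value (e 0) (e 1)).
Proof. by rewrite /Value /derived; dfn. Qed.

Lemma dfn_subst_image : Dfn U P (fun x e => subst_image (e 0) (e 1) (e 2)).
Proof. by rewrite /subst_image; dfn. Qed.

Ltac dfn_named ::= first
  [ dfn_lt_tac
  | refine (dfn_sub2 _ (R := fun x => @seqlen _) dfn_seqlen _ _); [dfn_side|dt|dt]
  | refine (dfn_sub3 _ (R := fun x => @entry _) dfn_entry _ _ _); [dfn_side|dt|dt|dt]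
  | refine (dfn_sub3 _ (R := fun x => @subst_image _) dfn_subst_image _ _ _); [dfn_side|dt|dt|dt]
  | refine (dfn_sub1 _ (R := fun x => @Term _) dfn_Term _); [dfn_side|dt]
  | refine (dfn_sub1 _ (R := fun x => @ClTerm _) dfn_ClTerm _); [dfn_side|dt]
  | refine (dfn_sub1 _ (R := fun x => @Form _) dfn_Form _); [dfn_side|dt]
  | refine (dfn_sub2 _ (R := fun x => @Value _) dfn_Value _ _); [dfn_side|dt|dt]
  | refine (dfn_sub2 _ (R := fun x => @Free _) dfn_Free _ _); [dfn_side|dt|dt] ].

Lemma dfn_Sent : Dfn U P (fun x e => Sent (e 0)).
Proof. by rewrite /Sent; dfn. Qed.

Lemma dfn_subst_except : Dfn U P (fun x e => subst_except (e 0) (e 1) (e 2)).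
Proof. by rewrite /subst_except; dfn. Qed.

Lemma dfn_Skel : Dfn U P (fun x e => Skel (e 0) (e 1)).
Proof. by rewrite /Skel /derived; dfn. Qed.

Lemma dfn_Eqv : Dfn U P (fun x e => Eqv (e 0) (e 1)).
Proof. by rewrite /Eqv /derived; dfn. Qed.

Ltac dfn_named ::= first
  [ dfn_lt_tac
  | refine (dfn_sub3 _ (R := fun x => @entry _) dfn_entry _ _ _); [dfn_side|dt|dt|dt]
  | refine (dfn_sub3 _ (R := fun x => @subst_image _) dfn_subst_image _ _ _); [dfn_side|dt|dt|dt]
  | refine (dfn_sub3 _ (R := fun x => @subst_except _) dfn_subst_except _ _ _); [dfn_side|dt|dt|dt] ].

Lemma dfn_Subst : Dfn U P (fun x e => Subst (e 0) (e 1) (e 2)).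
Proof. by rewrite /Subst /derived; dfn. Qed.

Ltac dfn_named ::= first
  [ dfn_lt_tac
  | refine (dfn_sub2 _ (R := fun x => @seqlen _) dfn_seqlen _ _); [dfn_side|dt|dt]
  | refine (dfn_sub3 _ (R := fun x => @entry _) dfn_entry _ _ _); [dfn_side|dt|dt|dt]
  | refine (dfn_sub3 _ (R := fun x => @Subst _) dfn_Subst _ _ _); [dfn_side|dt|dt|dt] ].

Lemma dfn_Subst1 : Dfn U P (fun x e => Subst1 (e 0) (e 1) (e 2) (e 3)).
Proof. by rewrite /Subst1; dfn. Qed.

End DefinableSyntax.

Ltac dfn_sub_1 Q lem := refine (dfn_sub1 _ (R := fun x => Q _) _ _);
  [dfn_side|apply: lem; dfn_side|dt].
Ltac dfn_sub_2 Q lem := refine (dfn_sub2 _ (R := fun x => Q _) _ _ _);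
  [dfn_side|apply: lem; dfn_side|dt|dt].
Ltac dfn_sub_3 Q lem := refine (dfn_sub3 _ (R := fun x => Q _) _ _ _ _);
  [dfn_side|apply: lem; dfn_side|dt|dt|dt].
Ltac dfn_sub_4 Q lem := refine (dfn_sub4 _ (R := fun x => Q _) _ _ _ _ _);
  [dfn_side|apply: lem; dfn_side|dt|dt|dt|dt].

Ltac dfn_syntax := lazymatch goal with
  | |- Dfn _ _ (fun _ _ => arith_lt _ _) => dfn_lt_tac
  | |- Dfn _ _ (fun _ _ => seqlen _ _) => dfn_sub_2 @seqlen dfn_seqlen
  | |- Dfn _ _ (fun _ _ => entry _ _ _) => dfn_sub_3 @entry dfn_entry
  | |- Dfn _ _ (fun _ _ => Term _) => dfn_sub_1 @Term dfn_Term
  | |- Dfn _ _ (fun _ _ => ClTerm _) => dfn_sub_1 @ClTerm dfn_ClTerm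
  | |- Dfn _ _ (fun _ _ => Form _) => dfn_sub_1 @Form dfn_Form
  | |- Dfn _ _ (fun _ _ => Sent _) => dfn_sub_1 @Sent dfn_Sent
  | |- Dfn _ _ (fun _ _ => Free _ _) => dfn_sub_2 @Free dfn_Free
  | |- Dfn _ _ (fun _ _ => Value _ _) => dfn_sub_2 @Value dfn_Value
  | |- Dfn _ _ (fun _ _ => Numeral _ _) => dfn_sub_2 @Numeral dfn_Numeral
  | |- Dfn _ _ (fun _ _ => Skel _ _) => dfn_sub_2 @Skel dfn_Skel
  | |- Dfn _ _ (fun _ _ => Eqv _ _) => dfn_sub_2 @Eqv dfn_Eqv
  | |- Dfn _ _ (fun _ _ => subst_image _ _ _) => dfn_sub_3 @subst_image dfn_subst_image
  | |- Dfn _ _ (fun _ _ => subst_except _ _ _) => dfn_sub_3 @subst_except dfn_subst_except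
  | |- Dfn _ _ (fun _ _ => Subst _ _ _) => dfn_sub_3 @Subst dfn_Subst
  | |- Dfn _ _ (fun _ _ => Subst1 _ _ _ _) => dfn_sub_4 @Subst1 dfn_Subst1
  | H : PD _ (fun e => ?Q (e 0)) |- Dfn _ _ (fun _ _ => ?Q _) =>
      refine (dfn_sub1 _ (R := fun=> Q) H _); [dfn_side|dt]
  end.
Ltac dfn_named ::= dfn_syntax.

(** * Inductive definitions by coded derivations *)

Section Derived.
Variables (N : arith) (hPA : PA N) (step : (N -> Prop) -> N -> Prop).
Local Notation S := (@asucc N).
Hypothesis mono : forall P Q x, (forall z, P z -> Q z) -> step P x -> step Q x.
(* Each rule has at most two premises. *)
Hypothesis fin : forall P x, step P x ->
  step (fun=> False) x \/ exists y z, [/\ P y, P z & step (fun w => w = y \/ w = z) x].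

Lemma derived_inv x : derived step x -> step (derived step) x.
Proof.
move=> [s [[i hi] hs]]; apply: mono (hs i x hi) => z [j [_ hj]].
by exists s; split=> //; exists j.
Qed.

Lemma derived_ind (Q : N -> Prop) x : PD (@nopred N) (fun e => Q (e 0)) ->
  (forall y, step (fun z => derived step z /\ Q z) y -> Q y) -> derived step x -> Q x.
Proof.
move=> hQ hstep [s [[i hi] hs]]; move: x hi; move: i.
refine (pa_strong hPA (Q := fun i => forall x, entry s i x -> Q x) _ _).
  by rewrite /PD; dfn.
move=> i IH x hx; apply/hstep/(mono _ (hs i x hx)) => z [j [hj hz]].
by split; [exists s; split=> //; exists j|apply: IH hz].
Qed.

(** The derivations of the two premises are concatenated and [x] is appended; [g] is the graph of
    the result, and it can be coded because it is definable. Without premises a derivation of length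
    one suffices. *)
Lemma derived_intro x : step (derived step) x -> derived step x.
Proof.
case/fin => [h|[y [z [[s1 [[i1 hy] hs1]] [s2 [[i2 hz] hs2]] h]]]].
  have hd : PD (@nopred N) (fun e => (fun i v => v = x) (e 0) (e 1)) by rewrite /PD; dfn.
  have hf i u v : (fun i v : N => v = x) i u -> (fun i v : N => v = x) i v -> u = v.
    by move=> -> ->.
  have ht i : arith_lt i (asucc azero) -> exists v, (fun i v : N => v = x) i v by exists x.
  have [s [hs he]] := seq_exists hPA hd hf ht.
  exists s; split; first by exists azero; apply: he => //; apply: ltxS.
  move=> i v hv; have -> : v = x.
    by apply: (entry_fun hPA hv); apply: he => //; apply: (entry_lt hPA hs hv).
  exact: mono h.
have [l1 hl1] := entry_seqlen hy; have [l2 hl2] := entry_seqlen hz.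
pose g i v := (arith_lt i l1 /\ entry s1 i v) \/
  (exists k, [/\ i = aadd l1 k, arith_lt k l2 & entry s2 k v]) \/ (i = aadd l1 l2 /\ v = x).
have nlt1 k : ~ arith_lt (aadd l1 k) l1.
  by move=> hlt; apply: (ltxx hPA (x := aadd l1 k)); apply: (lt_leS_trans hPA hlt); apply: lt_add.
have gt i : arith_lt i (S (aadd l1 l2)) -> exists v, g i v.
  move=> /(ltxSP hPA) [hi|->]; last by exists x; right; right.
  have [h1|[e|[k hk]]] := lt_total hPA i l1.
  + by have [u hu] := entry_total hPA hl1 h1; exists u; left.
  + have h2 : arith_lt azero l2 by apply: (lt_add_inv hPA (z := l1)); rewrite pa_add0 // -{1}e.
    have [u hu] := entry_total hPA hl2 h2; exists u; right; left; exists azero.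
    by rewrite pa_add0.
  + have h2 : arith_lt (S k) l2 by apply: (lt_add_inv hPA (z := l1)); rewrite hk.
    have [u hu] := entry_total hPA hl2 h2; exists u; right; left; exists (S k).
    by rewrite hk.
have hd : PD (@nopred N) (fun e => g (e 0) (e 1)) by rewrite /PD /g; dfn.
have hf i u v : g i u -> g i v -> u = v.
  move=> [[hi hu]|[[k [-> hk hu]]|[-> ->]]] [[hi' hv]|[[k' [e hk' hv]]|[e ?]]] //.
  + exact: (entry_fun hPA hu hv).
  + by move: hi; rewrite e => /nlt1.
  + by move: hi; rewrite e => /nlt1.
  + by case: (nlt1 _ hi').
  + by move: hv; rewrite -(addxI hPA e) => hv; apply: (entry_fun hPA hu hv).
  + by move: hk; rewrite (addxI hPA e) => /(ltxx hPA).
  + by case: (nlt1 _ hi').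
  + by move: hk'; rewrite -(addxI hPA e) => /(ltxx hPA).
have [s [hs he]] := seq_exists hPA hd hf gt.
have gf i v : g i v -> arith_lt i (S (aadd l1 l2)).
  move=> [[h1 _]|[[k [-> h1 _]]|[-> _]]]; last exact: ltxS.
  - by apply: (lt_trans hPA h1); apply: lt_add.
  - by apply/(ltxSP hPA); left; apply: lt_add2.
have hg i v : g i v -> entry s i v by move=> hh; apply: he => //; apply: gf hh.
have hg' i v : entry s i v -> g i v.
  move=> hv; have [u hu] := gt _ (entry_lt hPA hs hv).
  by rewrite (entry_fun hPA hv (hg _ _ hu)).
exists s; split; first by exists (aadd l1 l2); apply: hg; right; right.
move=> i v /hg' [[hi hv]|[[k [-> hk hv]]|[-> ->]]].
- apply: mono (hs1 i v hv) => w [j [hj hw]]; exists j; split=> //; apply: hg; left; split=> //.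
  exact: (lt_trans hPA hj hi).
- apply: mono (hs2 k v hv) => w [j [hj hw]]; exists (aadd l1 j); split; first exact: lt_add2.
  by apply: hg; right; left; exists j; split=> //; apply: (lt_trans hPA hj hk).
- apply: mono h => w [->|->].
    exists i1; have h1 := entry_lt hPA hl1 hy; split; last by apply: hg; left.
    by apply: (lt_leS_trans hPA h1); apply: lt_add.
  exists (aadd l1 i2); have h2 := entry_lt hPA hl2 hz; split; first exact: lt_add2.
  by apply: hg; right; left; exists i2.
Qed.

End Derived.

Ltac dfn_named ::= dfn_syntax.
Record rule (N : arith) (step : (N -> Prop) -> N -> Prop) : Prop := {
  rule_mono : forall P Q x, (forall z, P z -> Q z) -> step P x -> step Q x;
  rule_fin : forall P x, step P x -> step (fun=> False) x \/
    exists y z, [/\ P y, P z & step (fun w => w = y \/ w = z) x] }.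

Lemma derived_fix (N : arith) (hPA : PA N) step : rule step ->
  forall x : N, derived step x <-> step (derived step) x.
Proof.
move=> [h1 h2] x; split; first exact: derived_inv.
exact: derived_intro.
Qed.

Ltac decomp := repeat match goal with
  | H : _ \/ _ |- _ => destruct H as [H|H]
  | H : exists _, _ |- _ => let x := fresh in destruct H as [x H]
  | H : _ /\ _ |- _ => let H' := fresh in destruct H as [H' H]
  | H : and3 _ _ _ |- _ => let H1 := fresh in let H2 := fresh in destruct H as [H1 H2 H]
  | H : and4 _ _ _ _ |- _ => let H1 := fresh in let H2 := fresh in let H3 := fresh in
      destruct H as [H1 H2 H3 H]
  end.

Ltac intros_ex := repeat match goal with
  | |- exists _, _ => eexists
  | |- _ /\ _ => split
  | |- and3 _ _ _ => split
  | |- and4 _ _ _ _ => split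
  end; try reflexivity; eauto.

Ltac branch := solve
  [ repeat first [left; solve [intros_ex] | right | solve [intros_ex]] ].

Ltac rule_tac := split;
  [ intros ? ? ? ? ?; decomp; subst; branch
  | intros P ? ?; decomp; subst; match goal with
    | _ => solve [left; branch]
    | H : P ?y |- _ => solve [right; exists y, y; split; [exact H|exact H|branch]]
    | H : P ?y, H' : P ?z |- _ =>
        solve [right; exists y, z; split; [exact H|exact H'|branch]]
    end ].

Section Steps.
Variable N : arith.

(** The rules are extracted from the definitions, so that each predicate is convertible with
    [derived] of its rule. *)
Definition Term_step : (N -> Prop) -> N -> Prop :=
  ltac:(let t := eval unfold Term in (@Term N) in match t with derived ?st => exact st end).
Definition Form_step : (N -> Prop) -> N -> Prop :=
  ltac:(let t := eval unfold Form in (@Form N) in match t with derived ?st => exact st end).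
Definition Free_step (i : N) : (N -> Prop) -> N -> Prop :=
  ltac:(let t := eval unfold Free in (@Free N i) in match t with derived ?st => exact st end).
Definition Numeral_step : (N -> Prop) -> N -> Prop :=
  ltac:(let t := eval unfold Numeral in (Numeral (azero : N) azero) in
        match t with derived ?st _ => exact st end).
Definition Value_step : (N -> Prop) -> N -> Prop :=
  ltac:(let t := eval unfold Value in (Value (azero : N) azero) in
        match t with derived ?st _ => exact st end).
Definition Skel_step : (N -> Prop) -> N -> Prop :=
  ltac:(let t := eval unfold Skel in (Skel (azero : N) azero) in
        match t with derived ?st _ => exact st end).
Definition Eqv_step : (N -> Prop) -> N -> Prop :=
  ltac:(let t := eval unfold Eqv in (Eqv (azero : N) azero) in
        match t with derived ?st _ => exact st end).
Definition Subst_step : (N -> Prop) -> N -> Prop :=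
  ltac:(let t := eval cbv beta zeta delta [Subst] in (Subst (azero : N) azero azero) in
        match t with derived ?st _ => exact st end).

#[local] Opaque cpair ctag.

Lemma Term_rule : rule Term_step. Proof. rewrite /Term_step; rule_tac. Qed.
Lemma Form_rule : rule Form_step. Proof. rewrite /Form_step; rule_tac. Qed.
Lemma Free_rule i : rule (Free_step i). Proof. rewrite /Free_step; rule_tac. Qed.
Lemma Numeral_rule : rule Numeral_step. Proof. rewrite /Numeral_step; rule_tac. Qed.
Lemma Value_rule : rule Value_step. Proof. rewrite /Value_step; rule_tac. Qed.
Lemma Skel_rule : rule Skel_step. Proof. rewrite /Skel_step; rule_tac. Qed.
Lemma Eqv_rule : rule Eqv_step. Proof. rewrite /Eqv_step; rule_tac. Qed.
Lemma Subst_rule : rule Subst_step. Proof. rewrite /Subst_step; rule_tac. Qed.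

#[local] Transparent cpair ctag.

End Steps.

Ltac is_code a := lazymatch a with
  | cZero _ => idtac | cVar _ => idtac | cSucc _ => idtac | cAdd _ _ => idtac
  | cMul _ _ => idtac | cEq _ _ => idtac | cNeg _ => idtac | cAnd _ _ => idtac
  | cEx _ _ => idtac end.

(* Unique readability: decomposes all equations between codes. *)
Ltac codes hPA := repeat match goal with
  | H : cpair _ _ = cpair _ _ |- _ =>
      let h := fresh in pose proof (cpair_inj hPA H) as [h ?]; clear H
  | H : ?a = ?b |- _ => is_code a; is_code b;
      let h := fresh in let h' := fresh in
      pose proof (ctag_inj hPA (H : ctag _ _ = ctag _ _)) as [h h']; clear H;
      first [discriminate h | clear h]
  | H : ?a = ?a |- _ => clear H
  | _ => progress subst
  end.

Section SyntaxInductions.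
Variables (N : arith) (hPA : PA N).
Implicit Types x y z i j l a b c s t u v w p q r k : N.

Lemma TermE x : Term x <-> Term_step (@Term N) x.
Proof. exact: (derived_fix hPA (Term_rule N) x). Qed.

Lemma FormE x : Form x <-> Form_step (@Form N) x.
Proof. exact: (derived_fix hPA (Form_rule N) x). Qed.

Lemma FreeE i x : Free i x <-> Free_step i (Free i) x.
Proof. exact: (derived_fix hPA (Free_rule i) x). Qed.

Lemma ValueE t x : Value t x <-> Value_step (derived (@Value_step N)) (cpair t x).
Proof. exact: (derived_fix hPA (Value_rule N) _). Qed.

Lemma SkelE p k : Skel p k <-> Skel_step (derived (@Skel_step N)) (cpair p k).
Proof. exact: (derived_fix hPA (Skel_rule N) _). Qed.

Lemma EqvE x y : Eqv x y <-> Eqv_step (derived (@Eqv_step N)) (cpair x y).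
Proof. exact: (derived_fix hPA (Eqv_rule N) _). Qed.

Lemma SubstE s x y :
  Subst s x y <-> Subst_step (derived (@Subst_step N)) (cpair s (cpair x y)).
Proof. exact: (derived_fix hPA (Subst_rule N) _). Qed.

(** A code [z] is given the property that [Q a b] holds for all [a], [b] with [z = cpair a b]. This
    is definable without projections, and loses nothing since pairing is injective. *)
Lemma derived_ind2 step (Q : N -> N -> Prop) : rule step ->
  PD (@nopred N) (fun e => Q (e 0) (e 1)) ->
  (forall x y, step (fun z => derived step z /\ forall a b, z = cpair a b -> Q a b) (cpair x y) -> Q x y) ->
  forall x y, derived step (cpair x y) -> Q x y.
Proof.
move=> hr hQ hstep x y h.
refine (derived_ind hPA (rule_mono hr) (Q := fun w => forall a b, w = cpair a b -> Q a b)
  _ _ h _ _ erefl).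
  rewrite /PD; dfn; exact: (dfn_sub2 I (R := fun=> Q) hQ (dt_var I _) (dt_var I _)).
by move=> w hw a b e; apply: hstep; rewrite -e.
Qed.

Lemma derived_ind3 step (Q : N -> N -> N -> Prop) : rule step ->
  PD (@nopred N) (fun e => Q (e 0) (e 1) (e 2)) ->
  (forall x y z, step (fun w => derived step w /\ forall a b c, w = cpair a (cpair b c) -> Q a b c)
     (cpair x (cpair y z)) -> Q x y z) ->
  forall x y z, derived step (cpair x (cpair y z)) -> Q x y z.
Proof.
move=> hr hQ hstep x y z h.
refine (derived_ind hPA (rule_mono hr)
  (Q := fun w => forall a b c, w = cpair a (cpair b c) -> Q a b c) _ _ h _ _ _ erefl).
  rewrite /PD; dfn.
  exact: (dfn_sub3 I (R := fun=> Q) hQ (dt_var I _) (dt_var I _) (dt_var I _)).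
by move=> w hw a b c e; apply: hstep; rewrite -e.
Qed.

Lemma Term_ind' (Q : N -> Prop) : PD (@nopred N) (fun e => Q (e 0)) ->
  (forall y, Term_step (fun z => Term z /\ Q z) y -> Q y) -> forall x, Term x -> Q x.
Proof. by move=> hQ h x; exact: (derived_ind hPA (rule_mono (Term_rule N)) hQ h). Qed.

Lemma Form_ind' (Q : N -> Prop) : PD (@nopred N) (fun e => Q (e 0)) ->
  (forall y, Form_step (fun z => Form z /\ Q z) y -> Q y) -> forall x, Form x -> Q x.
Proof. by move=> hQ h x; exact: (derived_ind hPA (rule_mono (Form_rule N)) hQ h). Qed.

End SyntaxInductions.

#[local] Opaque cpair ctag.

Ltac ihs := repeat match goal with
  | H : forall a b, cpair ?x ?y = cpair a b -> _ |- _ => specialize (H _ _ erefl)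
  | H : forall a b c, cpair ?x (cpair ?y ?z) = cpair a (cpair b c) -> _ |- _ =>
      specialize (H _ _ _ erefl)
  | H : _ /\ _ |- _ => let H' := fresh in destruct H as [H' H]
  end.

Ltac fold_derived := repeat match goal with
  | H : derived (@Value_step ?N) (cpair ?x ?y) |- _ => change (Value x y) in H
  | H : derived (@Numeral_step ?N) (cpair ?x ?y) |- _ => change (Numeral x y) in H
  | H : derived (@Skel_step ?N) (cpair ?x ?y) |- _ => change (Skel x y) in H
  | H : derived (@Eqv_step ?N) (cpair ?x ?y) |- _ => change (Eqv x y) in H
  | H : derived (@Subst_step ?N) (cpair ?x (cpair ?y ?z)) |- _ => change (Subst x y z) in H
  end.

(** * Inversion of terms, formulas, values and skeletons *)

Section Syntax.
Variables (N : arith) (hPA : PA N).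
Implicit Types x y z i j l a b c s t u v w p q r k : N.

Ltac inv E H := apply (E N hPA) in H; red in H; decomp; codes hPA; fold_derived.
Ltac intro_by E := apply/(E N hPA); red; branch.

Lemma Free_zero i : ~ Free i (cZero N).
Proof. by move=> h; inv FreeE h. Qed.

Lemma Free_var i j : Free i (cVar j) <-> i = j.
Proof. by split=> h; [inv FreeE h|subst; intro_by FreeE]. Qed.

Lemma Free_succ i t : Free i (cSucc t) <-> Free i t.
Proof. by split=> h; [inv FreeE h|intro_by FreeE]. Qed.

Lemma Free_add i t u : Free i (cAdd t u) <-> Free i t \/ Free i u.
Proof. by split=> h; [inv FreeE h; auto|intro_by FreeE]. Qed.

Lemma Free_mul i t u : Free i (cMul t u) <-> Free i t \/ Free i u.
Proof. by split=> h; [inv FreeE h; auto|intro_by FreeE]. Qed.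

Lemma Free_eq i t u : Free i (cEq t u) <-> Free i t \/ Free i u.
Proof. by split=> h; [inv FreeE h; auto|intro_by FreeE]. Qed.

Lemma Free_neg i p : Free i (cNeg p) <-> Free i p.
Proof. by split=> h; [inv FreeE h|intro_by FreeE]. Qed.

Lemma Free_and i p q : Free i (cAnd p q) <-> Free i p \/ Free i q.
Proof. by split=> h; [inv FreeE h; auto|intro_by FreeE]. Qed.

Lemma Free_ex i j p : Free i (cEx j p) <-> Free i p /\ j <> i.
Proof. by split=> h; [inv FreeE h|case: h => ? ?; intro_by FreeE]. Qed.

Lemma Term_succ t : Term (cSucc t) <-> Term t.
Proof. by split=> h; [inv TermE h|intro_by TermE]. Qed.

Lemma Term_add t u : Term (cAdd t u) <-> Term t /\ Term u.
Proof. by split=> h; [inv TermE h|case: h => ? ?; intro_by TermE]. Qed.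

Lemma Term_mul t u : Term (cMul t u) <-> Term t /\ Term u.
Proof. by split=> h; [inv TermE h|case: h => ? ?; intro_by TermE]. Qed.

Lemma Term_zero : Term (cZero N).
Proof. by intro_by TermE. Qed.

Lemma Term_var i : Term (cVar i).
Proof. by intro_by TermE. Qed.

Lemma Form_eq t u : Form (cEq t u) <-> Term t /\ Term u.
Proof. by split=> h; [inv FormE h|case: h => ? ?; intro_by FormE]. Qed.

Lemma Form_neg p : Form (cNeg p) <-> Form p.
Proof. by split=> h; [inv FormE h|intro_by FormE]. Qed.

Lemma Form_and p q : Form (cAnd p q) <-> Form p /\ Form q.
Proof. by split=> h; [inv FormE h|case: h => ? ?; intro_by FormE]. Qed.

Lemma Form_ex i p : Form (cEx i p) <-> Form p.
Proof. by split=> h; [inv FormE h|intro_by FormE]. Qed.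

Lemma Term_Form x : Term x -> ~ Form x.
Proof. by move=> h1 h2; inv TermE h1; inv FormE h2. Qed.

Lemma ClTerm_zero : ClTerm (cZero N).
Proof. by split=> [|i]; [exact: Term_zero|exact: Free_zero]. Qed.

Lemma Value_zero x : Value (cZero N) x <-> x = azero.
Proof. by split=> h; [inv ValueE h|subst; intro_by ValueE]. Qed.

Lemma Value_succ t x : Value (cSucc t) x <-> exists y, Value t y /\ x = asucc y.
Proof.
by split=> h; [inv ValueE h; eexists; split; eauto|case: h => y [h ->]; intro_by ValueE].
Qed.

Lemma Value_add t u x :
  Value (cAdd t u) x <-> exists y z, [/\ Value t y, Value u z & x = aadd y z].
Proof.
by split=> h; [inv ValueE h; do 2 eexists; split; eauto|case: h => y [z [h h' ->]]; intro_by ValueE].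
Qed.

Lemma Value_mul t u x :
  Value (cMul t u) x <-> exists y z, [/\ Value t y, Value u z & x = amul y z].
Proof.
by split=> h; [inv ValueE h; do 2 eexists; split; eauto|case: h => y [z [h h' ->]]; intro_by ValueE].
Qed.

Lemma Value_fun t x y : Value t x -> Value t y -> x = y.
Proof.
move=> h; move: t x h y; refine (derived_ind2 hPA (Value_rule N)
  (Q := fun t x => forall y, Value t y -> x = y) _ _); first by rewrite /PD; dfn.
move=> t x h y hy; red in h; decomp; codes hPA; ihs; inv ValueE hy => //; f_equal; auto.
Qed.

Lemma Skel_eq t u k : Skel (cEq t u) k <-> k = cZero N.
Proof. by split=> h; [inv SkelE h|subst; intro_by SkelE]. Qed.

Lemma Skel_neg p k : Skel (cNeg p) k <-> exists l, k = cNeg l /\ Skel p l.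
Proof. by split=> h; [inv SkelE h; eexists; eauto|case: h => ? [-> ?]; intro_by SkelE]. Qed.

Lemma Skel_and p q k :
  Skel (cAnd p q) k <-> exists l m, [/\ k = cAnd l m, Skel p l & Skel q m].
Proof.
by split=> h; [inv SkelE h; do 2 eexists; split; eauto|case: h => ? [? [-> ? ?]]; intro_by SkelE].
Qed.

Lemma Skel_ex i p k : Skel (cEx i p) k <-> exists l, k = cEx i l /\ Skel p l.
Proof. by split=> h; [inv SkelE h; eexists; eauto|case: h => ? [-> ?]; intro_by SkelE]. Qed.

Lemma Skel_fun p k k' : Skel p k -> Skel p k' -> k = k'.
Proof.
move=> h; move: p k h k'; refine (derived_ind2 hPA (Skel_rule N)
  (Q := fun p k => forall k', Skel p k' -> k = k') _ _); first by rewrite /PD; dfn.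
move=> p k h k' hk; red in h; decomp; codes hPA; ihs; inv SkelE hk => //; f_equal; auto.
Qed.

Lemma Form_Skel p : Form p -> exists k, Skel p k.
Proof.
move: p; refine (Form_ind' hPA (Q := fun p => exists k, Skel p k) _ _).
  by rewrite /PD; dfn.
move=> x h; red in h; decomp; codes hPA.
- by eexists; apply/Skel_eq.
- by eexists; apply/Skel_neg; eexists; eauto.
- by eexists; apply/Skel_and; do 2 eexists; split; eauto.
- by eexists; apply/Skel_ex; eexists; eauto.
Qed.

End Syntax.

(** * Equality up to the values of closed terms *)

Section Equivalence.
Variables (N : arith) (hPA : PA N).
Implicit Types x y z i j l a b c s t u v w p q r k : N.

Ltac inv E H := apply (E N hPA) in H; red in H; decomp; codes hPA; fold_derived.
Ltac intro_by E := apply/(E N hPA); red; branch.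
Ltac noterm := match goal with H : ClTerm ?x |- _ => is_code x;
  solve [exfalso; clear - H hPA; destruct H as [H _]; inv TermE H] end.

Lemma Eqv_cl t u v : ClTerm t -> ClTerm u -> Value t v -> Value u v -> Eqv t u.
Proof. by move=> ? ? ? ?; intro_by EqvE. Qed.

Lemma Eqv_eq t u y : Eqv (cEq t u) y <-> exists t' u', [/\ y = cEq t' u', Eqv t t' & Eqv u u'].
Proof.
split=> h; last by case: h => t' [u' [-> ? ?]]; intro_by EqvE.
by inv EqvE h; [noterm|do 2 eexists].
Qed.

Lemma Eqv_neg p y : Eqv (cNeg p) y <-> exists p', y = cNeg p' /\ Eqv p p'.
Proof.
split=> h; last by case: h => p' [-> ?]; intro_by EqvE.
by inv EqvE h; [noterm|eexists].
Qed.

Lemma Eqv_and p q y :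
  Eqv (cAnd p q) y <-> exists p' q', [/\ y = cAnd p' q', Eqv p p' & Eqv q q'].
Proof.
split=> h; last by case: h => t' [u' [-> ? ?]]; intro_by EqvE.
by inv EqvE h; [noterm|do 2 eexists].
Qed.

Lemma Eqv_ex i p y : Eqv (cEx i p) y <-> exists p', y = cEx i p' /\ Eqv p p'.
Proof.
split=> h; last by case: h => p' [-> ?]; intro_by EqvE.
by inv EqvE h; [noterm|eexists].
Qed.

Lemma Eqv_var i : Eqv (cVar i) (cVar i).
Proof. by intro_by EqvE. Qed.

Lemma Eqv_zero : Eqv (cZero N) (cZero N).
Proof. by intro_by EqvE. Qed.

Lemma Eqv_ind (Q : N -> N -> Prop) : PD (@nopred N) (fun e => Q (e 0) (e 1)) ->
  (forall x y, Eqv_step (fun z => derived (@Eqv_step N) z /\ forall a b, z = cpair a b -> Q a b)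
     (cpair x y) -> Q x y) ->
  forall x y, Eqv x y -> Q x y.
Proof. exact: (derived_ind2 hPA (Eqv_rule N)). Qed.

Lemma Subst_ind (Q : N -> N -> N -> Prop) : PD (@nopred N) (fun e => Q (e 0) (e 1) (e 2)) ->
  (forall x y z, Subst_step (fun w => derived (@Subst_step N) w /\
      forall a b c, w = cpair a (cpair b c) -> Q a b c) (cpair x (cpair y z)) -> Q x y z) ->
  forall x y z, Subst x y z -> Q x y z.
Proof. exact: (derived_ind3 hPA (Subst_rule N)). Qed.

Lemma Eqv_Value t x t' : Value t x -> Eqv t t' -> Value t' x.
Proof.
move=> h; move: t x h t'; refine (derived_ind2 hPA (Value_rule N)
  (Q := fun t x => forall t', Eqv t t' -> Value t' x) _ _); first by rewrite /PD; dfn.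
move=> t x h t' ht; have hv : Value t x.
  by apply/ValueE => //; apply: (rule_mono (Value_rule N)) h => z [].
red in h; decomp; codes hPA; ihs; fold_derived; inv EqvE ht;
  try by match goal with H : Value ?a ?v, H' : Value ?b ?v, hv : Value ?a ?x |- Value ?b ?x =>
    rewrite (Value_fun hPA hv H) end.
- by apply/Value_zero.
- by apply/Value_succ => //; eexists; eauto.
- by apply/Value_add => //; do 2 eexists; split; eauto.
- by apply/Value_mul => //; do 2 eexists; split; eauto.
Qed.

Lemma Eqv_sym x y : Eqv x y -> Eqv y x.
Proof.
move: x y; refine (Eqv_ind (Q := fun x y => Eqv y x) _ _); first by rewrite /PD; dfn.
move=> x y h; red in h; decomp; codes hPA; ihs; fold_derived; try intro_by EqvE.
Qed.

Lemma Eqv_Free i x y : Eqv x y -> Free i x -> Free i y.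
Proof.
move: x y; refine (Eqv_ind (Q := fun x y => Free i x -> Free i y) _ _); first by rewrite /PD; dfn.
move=> x y h hf; red in h; decomp; codes hPA; ihs; fold_derived; try done.
- by match goal with H : ClTerm ?x, h : Free _ ?x |- _ => case: H => _ /(_ _ h) end.
- by move: hf; rewrite !Free_succ.
- by move: hf; rewrite !Free_add //; tauto.
- by move: hf; rewrite !Free_mul //; tauto.
- by move: hf; rewrite !Free_eq //; tauto.
- by move: hf; rewrite !Free_neg.
- by move: hf; rewrite !Free_and //; tauto.
- by move: hf; rewrite !Free_ex //; tauto.
Qed.

Lemma Eqv_Term x y : Eqv x y -> Term x -> Term y.
Proof.
move: x y; refine (Eqv_ind (Q := fun x y => Term x -> Term y) _ _); first by rewrite /PD; dfn.
move=> x y h hf; red in h; decomp; codes hPA; ihs; fold_derived; try done.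
- by match goal with H : ClTerm ?y |- Term ?y => case: H end.
- by move: hf; rewrite !Term_succ.
- by move: hf; rewrite !Term_add //; tauto.
- by move: hf; rewrite !Term_mul //; tauto.
- by inv TermE hf.
- by inv TermE hf.
- by inv TermE hf.
- by inv TermE hf.
Qed.

Lemma Eqv_Form x y : Eqv x y -> Form x -> Form y.
Proof.
move: x y; refine (Eqv_ind (Q := fun x y => Form x -> Form y) _ _); first by rewrite /PD; dfn.
move=> x y h hf; red in h; decomp; codes hPA; ihs; fold_derived; try done; try by inv FormE hf.
- by match goal with H : ClTerm ?x, h : Form ?x |- _ => case: H => /(Term_Form hPA) /(_ h) end.
- by move: hf; rewrite !Form_eq // => -[h1 h2]; split; apply: Eqv_Term; eassumption.
- by move: hf; rewrite !Form_neg.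
- by move: hf; rewrite !Form_and //; tauto.
- by move: hf; rewrite !Form_ex.
Qed.

Lemma Eqv_Sent x y : Eqv x y -> Sent x -> Sent y.
Proof.
move=> h [h1 h2]; split; first exact: Eqv_Form h1.
by move=> i hi; apply: (h2 i); apply: Eqv_Free hi; apply: Eqv_sym.
Qed.

Lemma Eqv_refl_Term t : Term t -> Eqv t t.
Proof.
move: t; refine (Term_ind' hPA (Q := fun t => Eqv t t) _ _); first by rewrite /PD; dfn.
move=> x h; red in h; decomp; codes hPA; ihs; fold_derived; try intro_by EqvE.
Qed.

Lemma Eqv_refl_Form p : Form p -> Eqv p p.
Proof.
move: p; refine (Form_ind' hPA (Q := fun t => Eqv t t) _ _); first by rewrite /PD; dfn.
move=> x h; red in h; decomp; codes hPA; ihs; fold_derived; try intro_by EqvE.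
by apply/Eqv_eq; do 2 eexists; split; eauto; apply: Eqv_refl_Term.
Qed.

(** [Eqv] changes terms only, and [Skel] forgets the atomic formulas containing them. *)
Lemma Eqv_Skel p q k : Eqv p q -> Skel p k -> Skel q k.
Proof.
move=> hE h; move: p k h q hE; refine (derived_ind2 hPA (Skel_rule N)
  (Q := fun p k => forall q, Eqv p q -> Skel q k) _ _); first by rewrite /PD; dfn.
move=> p k h q; red in h; decomp; codes hPA; ihs; fold_derived.
- by move/Eqv_eq => [? [? [-> _ _]]]; apply/Skel_eq.
- by move/Eqv_neg => [? [-> ?]]; apply/Skel_neg => //; eexists; eauto.
- by move/Eqv_and => [? [? [-> ? ?]]]; apply/Skel_and => //; do 2 eexists; split; eauto.
- by move/Eqv_ex => [? [-> ?]]; apply/Skel_ex => //; eexists; eauto.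
Qed.

(** The [i]-th entry of [s] is overwritten by the code of [v_i]. If [s] has no such entry, [s]
    itself serves. *)
Lemma subst_except_exists s i : exists r, subst_except s i r.
Proof.
have [[u hu]|h] := EM (exists u, entry s i u); last first.
  exists s => j t; split=> [|[[-> ->]|[]] //]; last by right.
  by have [->|hj] := EM (j = i); [left; split=> //; case: H => [hh|[]] //; case: h; exists t|right].
have [l hl] := entry_seqlen hu.
pose g j v := (j = i /\ v = cVar i) \/ (j <> i /\ entry s j v).
have hd : PD (@nopred N) (fun e => g (e 0) (e 1)) by rewrite /PD /g; dfn.
have hf j v w : g j v -> g j w -> v = w.
  by case=> [[-> ->]|[h1 h2]] [[? ?]|[? h3]] //; subst => //; apply: (entry_fun hPA h2 h3).
have ht j : arith_lt j l -> exists v, g j v.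
  move=> hj; have [->|hji] := EM (j = i); first by exists (cVar i); left.
  by have [v hv] := entry_total hPA hl hj; exists v; right.
have [r [hr he]] := seq_exists hPA hd hf ht.
have hg j v : entry r j v <-> arith_lt j l /\ g j v.
  split=> [hv|[]]; last exact: he.
  have hj := entry_lt hPA hr hv; split=> //; have [w hw] := ht j hj.
  by rewrite (entry_fun hPA hv (he _ _ hj hw)).
have hi : arith_lt i l by apply: entry_lt hl hu.
exists r => j t; rewrite /subst_image; split.
- case=> [/hg [hj [[-> ->]|[hji ht']]]|[hn ->]]; [by left|by right; split=> //; left|].
  right; split; first by move=> e; apply: hn; exists (cVar i); apply/hg; subst; split=> //; left.
  right; split=> // -[v hv]; apply: hn.
  have hj := entry_lt hPA hl hv; have [w hw] := ht j hj; exists w; exact: he.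
- case=> [[-> ->]|[hji [hv|[hn ->]]]].
  + by left; apply/hg; split=> //; left.
  + by left; apply/hg; split; [apply: entry_lt hl hv|right].
  + right; split=> // -[v /hg [_ [[e _]|[_ hv]]]] //; by apply: hn; exists v.
Qed.

End Equivalence.

Definition subst_eqv (N : arith) (s s' : N) : Prop :=
  forall i u, subst_image s i u -> exists u', subst_image s' i u' /\ Eqv u u'.

(** * Substitution of closed terms *)

Section Substitutions.
Variables (N : arith) (hPA : PA N).
Implicit Types x y z i j l a b c s t u v w p q r k : N.

Ltac inv E H := apply (E N hPA) in H; red in H; decomp; codes hPA; fold_derived.
Ltac intro_by E := apply/(E N hPA); red; branch.

Ltac cong1 := match goal with
  | hS : Subst ?s (?c ?t) _, hs : subst_eqv ?s _,
    H : forall s' x', subst_eqv ?s s' -> Eqv ?t x' -> _, H1 : Eqv ?t _ |- _ =>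
      let y1 := fresh in destruct (H _ _ hs H1) as [y1 [? ?]]; exists (c y1);
      solve [split; [intro_by SubstE|intro_by EqvE]] end.
Ltac cong2 := match goal with
  | hS : Subst ?s (?c ?t ?u) _, hs : subst_eqv ?s _,
    H : forall s' x', subst_eqv ?s s' -> Eqv ?t x' -> _, H1 : Eqv ?t _,
    H' : forall s' x', subst_eqv ?s s' -> Eqv ?u x' -> _, H1' : Eqv ?u _ |- _ =>
      let y1 := fresh "y" in let y2 := fresh "z" in
      destruct (H _ _ hs H1) as [y1 [? ?]]; destruct (H' _ _ hs H1') as [y2 [? ?]];
      exists (c y1 y2); solve [split; [intro_by SubstE|intro_by EqvE]] end.

Ltac premise E := match goal with H : Free _ ?t -> _, h : Free _ ?t |- _ =>
  let i := fresh "i" in let u := fresh "u" in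
  destruct (H h) as [i [u [? ? ?]]]; exists i, u; split=> //; apply/(E N hPA); tauto end.

Lemma ClTerm_var i : ~ ClTerm (cVar i).
Proof. by move=> [_ /(_ i)]; rewrite Free_var. Qed.

Lemma ClTerm_succ t : ClTerm (cSucc t) <-> ClTerm t.
Proof.
rewrite /ClTerm Term_succ //; split=> -[h1 h2]; split=> // i hi;
  by apply: (h2 i); move: hi; rewrite Free_succ.
Qed.

Lemma ClTerm_add t u : ClTerm (cAdd t u) <-> ClTerm t /\ ClTerm u.
Proof.
rewrite /ClTerm Term_add //; split=> [[[h1 h2] h3]|[[h1 h2] [h3 h4]]].
  by split; split=> // i hi; apply: (h3 i); rewrite Free_add //; tauto.
by split=> // i; rewrite Free_add // => -[/h2|/h4].
Qed.

Lemma ClTerm_mul t u : ClTerm (cMul t u) <-> ClTerm t /\ ClTerm u.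
Proof.
rewrite /ClTerm Term_mul //; split=> [[[h1 h2] h3]|[[h1 h2] [h3 h4]]].
  by split; split=> // i hi; apply: (h3 i); rewrite Free_mul //; tauto.
by split=> // i; rewrite Free_mul // => -[/h2|/h4].
Qed.

Lemma Subst_closed s x y : Subst s x y -> ClTerm x -> y = x.
Proof.
move: s x y; refine (Subst_ind hPA (Q := fun s x y => ClTerm x -> y = x) _ _).
  by rewrite /PD; dfn.
move=> s x y h hx; red in h; decomp; codes hPA; ihs; fold_derived; try done;
  try by case: hx => hx _; inv TermE hx.
- by case: (ClTerm_var hx).
- by move/ClTerm_succ: hx => hx; f_equal; auto.
- by move/ClTerm_add: hx => [? ?]; f_equal; auto.
- by move/ClTerm_mul: hx => [? ?]; f_equal; auto.
Qed.

Lemma closed_Subst s u : ClTerm u -> Subst s u u.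
Proof.
move=> h; move: (h) => [+ _]; move: u h; suff H u : Term u -> ClTerm u -> Subst s u u.
  by move=> u h1 h2; apply: H.
move: u; refine (Term_ind' hPA (Q := fun u => ClTerm u -> Subst s u u) _ _).
  by rewrite /PD; dfn.
move=> x h hx; red in h; decomp; codes hPA; ihs.
- by intro_by SubstE.
- by case: (ClTerm_var hx).
- move/ClTerm_succ: hx => hx.
  match goal with H : ClTerm ?t -> Subst s ?t ?t |- _ => have h1 := H hx end.
  by intro_by SubstE.
- move/ClTerm_add: hx => [hx hy].
  match goal with H : ClTerm ?t -> Subst s ?t ?t, H' : ClTerm ?u -> Subst s ?u ?u |-
    Subst s (cAdd ?t ?u) _ => have h1 := H hx; have h2 := H' hy end.
  by intro_by SubstE.
- move/ClTerm_mul: hx => [hx hy].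
  match goal with H : ClTerm ?t -> Subst s ?t ?t, H' : ClTerm ?u -> Subst s ?u ?u |-
    Subst s (cMul ?t ?u) _ => have h1 := H hx; have h2 := H' hy end.
  by intro_by SubstE.
Qed.

Lemma subst_eqv_except s s' i r : subst_eqv s s' -> subst_except s i r ->
  exists r', subst_except s' i r' /\ subst_eqv r r'.
Proof.
move=> h hr; have [r' hr'] := subst_except_exists hPA s' i.
exists r'; split=> // j u /hr [[-> ->]|[hj /h [u' [hu' he]]]].
  by exists (cVar i); split; [apply/hr'; left|apply: Eqv_var].
by exists u'; split=> //; apply/hr'; right.
Qed.

(** The source of the regularity axiom: sequences of closed terms with the same values yield [Eqv]
    results, and every truth predicate constructed below respects [Eqv]. For the induction to pass
    through subterms, the expression must be allowed to vary along with the sequence. *)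
Lemma Eqv_Subst s x y s' x' : Subst s x y -> subst_eqv s s' -> Eqv x x' ->
  exists y', Subst s' x' y' /\ Eqv y y'.
Proof.
move=> h; move: s x y h s' x'; refine (Subst_ind hPA (Q := fun s x y => forall s' x',
  subst_eqv s s' -> Eqv x x' -> exists y', Subst s' x' y' /\ Eqv y y') _ _).
  by rewrite /PD /subst_eqv; dfn.
move=> s x y h s' x' hs hx.
have hS : Subst s x y.
  by apply/SubstE => //; apply: (rule_mono (Subst_rule N)) h => z [].
(* The rule of [Eqv] for closed terms of equal value may apply whichever rule of [Subst] was used
   last. Then neither side is changed by substitution. *)
have hcl : ClTerm x -> ClTerm x' -> exists y', Subst s' x' y' /\ Eqv y y'.
  by move=> h1 h2; exists x'; rewrite (Subst_closed hS h1); split=> //; apply: closed_Subst.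
red in h; decomp; codes hPA; ihs; fold_derived;
  inv EqvE hx; try by apply: hcl.
- exists (cZero N); split; [by intro_by SubstE|exact: Eqv_zero].
- match goal with hs : subst_eqv ?s _, H : subst_image ?s _ _ |- _ =>
    have [t' [ht' he]] := hs _ _ H end.
  by exists t'; split=> //; intro_by SubstE.
- by cong1.
- by cong2.
- by cong2.
- by cong2.
- by cong1.
- by cong2.
- match goal with hs : subst_eqv ?s _, H : subst_except ?s _ _ |- _ =>
    have [r' [hr' he']] := subst_eqv_except hs H end.
  match goal with he : subst_eqv ?r _, H : forall s' x', subst_eqv ?r s' -> Eqv ?p x' -> _,
    H1 : Eqv ?p _, h : subst_except _ ?i r' |- _ =>
    have [y1 [? ?]] := H _ _ he H1; exists (cEx i y1) end.
  by split; [intro_by SubstE|intro_by EqvE].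
Qed.

Lemma Subst_Skel s x y k : Subst s x y -> Skel x k -> Skel y k.
Proof.
move=> h; move: s x y h k; refine (Subst_ind hPA
  (Q := fun s x y => forall k, Skel x k -> Skel y k) _ _).
  by rewrite /PD; dfn.
move=> s x y h k hk; red in h; decomp; codes hPA; ihs; fold_derived; inv SkelE hk.
- by apply/Skel_eq.
- by apply/Skel_neg => //; eexists; eauto.
- by apply/Skel_and => //; do 2 eexists; split; eauto.
- by apply/Skel_ex => //; eexists; eauto.
Qed.

Lemma Subst_Free s x y j : Subst s x y -> Free j y ->
  exists i u, [/\ Free i x, subst_image s i u & Free j u].
Proof.
move: s x y; refine (Subst_ind hPA (Q := fun s x y => Free j y ->
  exists i u, [/\ Free i x, subst_image s i u & Free j u]) _ _).
  by rewrite /PD; dfn.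
move=> s x y h hk; red in h; decomp; codes hPA; ihs; fold_derived.
- by case: (Free_zero hPA hk).
- by do 2 eexists; split; eauto; apply/Free_var.
- by move/(Free_succ hPA): hk => hk; premise Free_succ.
- by move/(Free_add hPA): hk => [hk|hk]; premise Free_add.
- by move/(Free_mul hPA): hk => [hk|hk]; premise Free_mul.
- by move/(Free_eq hPA): hk => [hk|hk]; premise Free_eq.
- by move/(Free_neg hPA): hk => hk; premise Free_neg.
- by move/(Free_and hPA): hk => [hk|hk]; premise Free_and.
- move/(Free_ex hPA): hk => [hk hne].
  match goal with H : Free _ ?t -> _, h : Free _ ?t |- _ =>
    destruct (H h) as [i0 [u0 [h1 h2 h3]]] end.
  match goal with H : subst_except _ _ _ |- _ =>
    case/H: h2 => [[e1 e2]|[h2 h4]] end.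
    by subst; move/(Free_var hPA): h3 => h3; case: hne.
  by exists i0, u0; split=> //; apply/Free_ex => //; split=> // e; apply: h2.
Qed.

Lemma Subst_Term s x y : Subst s x y -> (forall i u, subst_image s i u -> Term u) ->
  Term x -> Term y.
Proof.
move: s x y; refine (Subst_ind hPA
  (Q := fun s x y => (forall i u, subst_image s i u -> Term u) -> Term x -> Term y) _ _).
  by rewrite /PD; dfn.
move=> s x y h hs hx; red in h; decomp; codes hPA; ihs; fold_derived;
  try done; try by (inv TermE hx).
- by apply: hs; eassumption.
- by move: hx; rewrite !Term_succ //; auto.
- by move: hx; rewrite !Term_add // => -[? ?]; auto.
- by move: hx; rewrite !Term_mul // => -[? ?]; auto.
Qed.

Lemma Subst_Form s x y : Subst s x y -> (forall i u, subst_image s i u -> Term u) ->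
  Form x -> Form y.
Proof.
move: s x y; refine (Subst_ind hPA
  (Q := fun s x y => (forall i u, subst_image s i u -> Term u) -> Form x -> Form y) _ _).
  by rewrite /PD; dfn.
move=> s x y h hs hx; red in h; decomp; codes hPA; ihs; fold_derived;
  try by (inv FormE hx).
- by move: hx; rewrite !Form_eq // => -[h1 h2]; split; apply: Subst_Term hs _; eassumption.
- by move: hx; rewrite !Form_neg //; auto.
- by move: hx; rewrite !Form_and // => -[? ?]; auto.
- move: hx; rewrite !Form_ex // => hx.
  match goal with H : _ -> Form ?p -> Form ?q |- Form ?q => refine (H _ hx) end.
  match goal with hr : subst_except _ _ _ |- _ => move=> i u /(hr i u) end.
  by case=> [[_ ->]|[_ /hs]] //; apply: Term_var.
Qed.

Lemma Numeral_ClTerm x t : Numeral x t -> ClTerm t.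
Proof.
move: x t; refine (derived_ind2 hPA (Numeral_rule N) (Q := fun x t => ClTerm t) _ _).
  by rewrite /PD; dfn.
move=> x t h; red in h; decomp; codes hPA; ihs; first exact: ClTerm_zero.
by apply/ClTerm_succ.
Qed.

(** ** Instances of existential sentences *)

Lemma Subst1_image s i t j u : seqlen s (asucc i) -> entry s i t ->
  (forall j, arith_lt j i -> entry s j (cVar j)) -> subst_image s j u ->
  (j = i /\ u = t) \/ (j <> i /\ u = cVar j).
Proof.
move=> hl ht hv [hu|[hn ->]]; last by right; split=> // e; apply: hn; exists t; rewrite e.
have /(ltxSP hPA) [hj|e] := entry_lt hPA hl hu.
  right; split; last by apply: (entry_fun hPA hu); apply: hv.
  by move=> e; apply: (ltxx hPA (x := i)); rewrite -{1}e.
by subst j; left; split=> //; apply: (entry_fun hPA hu).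
Qed.

Lemma Subst1_Sent i t p q : ClTerm t -> Sent (cEx i p) -> Subst1 i t p q -> Sent q.
Proof.
move=> [ht1 ht2] [hp1 hp2] [s [hl ht hv hS]].
have him := Subst1_image hl ht hv.
have hT j u : subst_image s j u -> Term u by case/him => [[_ ->]|[_ ->]] //; apply: Term_var.
split; first by apply: Subst_Form hS hT _; apply/(Form_ex hPA i).
move=> j /(Subst_Free hS) [k [u [hk /him hu hj]]].
case: hu => [[_ e']|[e e']]; first by apply: (ht2 j); rewrite -e'.
by apply: (hp2 k); apply/Free_ex => //; split=> //; exact: nesym.
Qed.

Lemma Subst1_Skel i t p q k : Subst1 i t p q -> Skel p k -> Skel q k.
Proof. by move=> [s [_ _ _ hS]]; exact: (Subst_Skel hS). Qed.

Lemma Eqv_Subst1 i t p q p' : ClTerm t -> Subst1 i t p q -> Eqv p p' ->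
  exists q', Subst1 i t p' q' /\ Eqv q q'.
Proof.
move=> [ht1 ht2] [s [hl ht hv hS]] he; have him := Subst1_image hl ht hv.
have hs : subst_eqv s s.
  move=> j u hu; exists u; split=> //; apply: Eqv_refl_Term => //.
  by case: (him _ _ hu) => [[_ ->]|[_ ->]] //; apply: Term_var.
by have [q' [h1 h2]] := Eqv_Subst hS hs he; exists q'; split=> //; exists s.
Qed.

Lemma ClTermSeq_subst_eqv s t : ClTermSeq s -> ClTermSeq t -> SameValues s t -> subst_eqv s t.
Proof.
move=> [_ hs] [_ ht] [[l [ls lt]] hv] i u [hu|[hn ->]].
  have hi := entry_lt hPA ls hu; have [v hiv] := entry_total hPA lt hi.
  have [x [h1 h2]] := hv _ _ _ hu hiv.
  by exists v; split; [left|exact: (Eqv_cl hPA (hs _ _ hu) (ht _ _ hiv) h1 h2)].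
exists (cVar i); split; last exact: Eqv_var.
right; split=> // -[v hiv]; apply: hn.
exact: (entry_total hPA ls (entry_lt hPA lt hiv)).
Qed.

Lemma Sent_neg p : Sent (cNeg p) <-> Sent p.
Proof.
by rewrite /Sent Form_neg //; split=> -[h1 h2]; split=> // i; have := h2 i; rewrite Free_neg.
Qed.

Lemma Sent_and p q : Sent (cAnd p q) <-> Sent p /\ Sent q.
Proof.
rewrite /Sent Form_and //; split=> [[[h1 h2] h3]|[[h1 h2] [h3 h4]]].
  by split; split=> // i; have := h3 i; rewrite Free_and //; tauto.
by split=> // i; rewrite Free_and // => -[/h2|/h4].
Qed.

Lemma Sent_eq s t : ClTerm s -> ClTerm t -> Sent (cEq s t).
Proof.
move=> [h1 h2] [h3 h4]; split; first by apply/Form_eq.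
by move=> i; rewrite Free_eq // => -[/h2|/h4].
Qed.

Lemma Sent_ex i p : Form1 i p <-> Sent (cEx i p).
Proof.
rewrite /Sent /Form1 Form_ex //; split=> -[h1 h2]; split=> // j.
  by rewrite Free_ex // => -[/h2 e]; apply; exact: esym.
by move=> hj; apply: contrapT => hne; apply: (h2 j); rewrite Free_ex //; split=> //; exact: nesym.
Qed.

End Substitutions.

(** * One step of the truth definition and its locality *)

Definition child (N : arith) (k l : N) : Prop :=
  k = cNeg l \/ (exists m, k = cAnd l m) \/ (exists m, k = cAnd m l) \/ (exists i, k = cEx i l).

(** This covers all sentences whose truth is involved in the truth clause of a sentence with
    skeleton [c]. *)
Definition nearby (N : arith) (c p : N) : Prop := exists k, Skel p k /\ (k = c \/ child c k).

(* One step of the compositional truth definition. *)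
Definition Phi (N : arith) (T : N -> Prop) (p : N) : Prop := Sent p /\
  ((exists s t x, [/\ p = cEq s t, Value s x & Value t x]) \/
   (exists q, p = cNeg q /\ ~ T q) \/
   (exists q r, [/\ p = cAnd q r, T q & T r]) \/
   (exists i q, p = cEx i q /\ exists x t q', [/\ Numeral x t, Subst1 i t q q' & T q'])).

Section TruthStep.
Variables (N : arith) (hPA : PA N).
Implicit Types x y z i j l a b c s t u v w p q r k : N.
Implicit Types T : N -> Prop.

Lemma child_lt k l : child k l -> arith_lt l k.
Proof.
case=> [->|[[m ->]|[[m ->]|[i ->]]]].
- exact: ctag_lt.
- by apply: (leS_lt_trans hPA (cpair_le1 hPA l m)); apply: ctag_lt.
- by apply: (leS_lt_trans hPA (cpair_le2 hPA m l)); apply: ctag_lt.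
- by apply: (leS_lt_trans hPA (cpair_le2 hPA i l)); apply: ctag_lt.
Qed.

(** At most two children: one step of the recursion on skeletons thus combines only finitely many
    predicates, which keeps it definable. *)
Lemma child_finite k : exists l m, forall n, child k n -> n = l \/ n = m.
Proof.
have [[l ->]|h1] := EM (exists l, k = cNeg l).
  by exists l, l => n h; red in h; decomp; codes hPA; left.
have [[l [m ->]]|h2] := EM (exists l m, k = cAnd l m).
  by exists l, m => n h; red in h; decomp; codes hPA; auto.
have [[i [l ->]]|h3] := EM (exists i l, k = cEx i l).
  by exists l, l => n h; red in h; decomp; codes hPA; auto.
exists k, k => n [e|[[m e]|[[m e]|[i e]]]].
- by case: h1; exists n.
- by case: h2; exists n, m.
- by case: h2; exists m, n.
- by case: h3; exists i, n.
Qed.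

Lemma Phi_eq T s t : ClTerm s -> ClTerm t ->
  (Phi T (cEq s t) <-> exists x, Value s x /\ Value t x).
Proof.
move=> hs ht; split=> [[_ h]|[x [h1 h2]]].
  by decomp; codes hPA; eexists; eauto.
by split; [exact: Sent_eq|left; exists s, t, x].
Qed.

Lemma Phi_neg T p : Sent p -> (Phi T (cNeg p) <-> ~ T p).
Proof.
move=> hp; split=> [[_ h]|h]; first by decomp; codes hPA.
by split; [apply/Sent_neg|right; left; exists p].
Qed.

Lemma Phi_and T p q : Sent p -> Sent q -> (Phi T (cAnd p q) <-> T p /\ T q).
Proof.
move=> hp hq; split=> [[_ h]|[h1 h2]]; first by decomp; codes hPA.
by split; [apply/Sent_and|right; right; left; exists p, q].
Qed.

Lemma Phi_ex T i p : Form1 i p -> (Phi T (cEx i p) <->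
  exists x t q, [/\ Numeral x t, Subst1 i t p q & T q]).
Proof.
move=> hp; split=> [[_ h]|h].
  by decomp; codes hPA; do 3 eexists; split; eauto.
by split; [apply/Sent_ex|right; right; right; exists i, p].
Qed.

(** All instances of [cEx i q] have the skeleton of [q], whatever the numeral, so that one child of
    [c] accounts for all of them. This is the purpose of erasing the atomic parts. *)
Lemma Phi_near T T' p c : Skel p c ->
  (forall q l, Sent q -> child c l -> Skel q l -> (T q <-> T' q)) -> Phi T p -> Phi T' p.
Proof.
move=> hk hT [hp h]; split=> //; decomp; subst.
- by left; do 3 eexists; split; eauto.
- move/(Sent_neg hPA): hp => hp; move/(Skel_neg hPA): hk => [l [ec hl]].
  right; left; eexists; split; eauto; rewrite -(hT _ l) //.
  by subst c; left.
- move/(Sent_and hPA): hp => [hp hq]; move/(Skel_and hPA): hk => [l [m [ec hl hm]]].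
  right; right; left; do 2 eexists; split; eauto.
    by rewrite -(hT _ l) //; subst c; right; left; exists m.
  by rewrite -(hT _ m) //; subst c; right; right; left; exists l.
- move/(Skel_ex hPA): hk => [l [ec hl]].
  right; right; right; do 2 eexists; split; eauto.
  match goal with H : Numeral ?x ?t, H' : Subst1 _ _ _ ?q |- _ =>
    exists x, t, q; split=> //; have hq := Subst1_Sent hPA (Numeral_ClTerm hPA H) hp H';
    have hl' := Subst1_Skel hPA H' hl end.
  by rewrite -(hT _ l) //; subst c; right; right; right; eexists.
Qed.

(** The clause for negation uses the hypothesis on [T] in the opposite direction, available because
    [Eqv] is symmetric. *)
Lemma Phi_Eqv T p q : (forall p q, Eqv p q -> T p -> T q) -> Eqv p q -> Phi T p -> Phi T q.
Proof.
move=> hT he [hp h]; split; first exact: Eqv_Sent hp.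
decomp; subst.
- move/(Eqv_eq hPA): he => [s' [t' [-> h1 h2]]]; left.
  match goal with H1 : Value ?s ?x, H2 : Value ?t ?x, h1 : Eqv ?s _, h2 : Eqv ?t _ |- _ =>
    exists s', t', x; split=> //; [exact: (Eqv_Value hPA H1 h1)|exact: (Eqv_Value hPA H2 h2)] end.
- move/(Eqv_neg hPA): he => [p' [-> h1]]; right; left; exists p'; split=> // h2.
  match goal with H : ~ T _ |- _ => refine (H _) end.
  by apply: hT h2; apply: Eqv_sym.
- move/(Eqv_and hPA): he => [p' [q' [-> h1 h2]]]; right; right; left; exists p', q'.
  by split=> //; apply: hT; eassumption.
- move/(Eqv_ex hPA): he => [p' [-> h1]]; right; right; right.
  match goal with H : Numeral ?x ?t, H' : Subst1 ?i _ _ ?q |- _ =>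
    exists i, p'; split=> //;
    have [q' [h2 h3]] := Eqv_Subst1 hPA (Numeral_ClTerm hPA H) H' h1; exists x, t, q' end.
  by split=> //; apply: hT; eassumption.
Qed.

End TruthStep.

#[local] Transparent cpair ctag.

(** * Restricted reduced products *)

Definition fall C (phi : fm C) : fm C := FNeg (FEx (FNeg phi)).
Definition fimp C (phi psi : fm C) : fm C := FNeg (FAnd phi (FNeg psi)).

(** An induction axiom written as one formula, so that induction passes to reduced products by [los]
    ([RP_IND]). *)
Definition ind_fm C (phi : fm C) : fm C :=
  fimp (finst (scons TZero TVar) TPar phi)
    (fimp (fall (fimp phi (finst (scons (TSucc (TVar 0)) (fun n => TVar n.+1)) TPar phi)))
      (fall phi)).

Lemma ev_fall (N : arith) C (U : C -> N -> Prop) r e phi :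
  ev U r e (fall phi) <-> forall a, ev U r (scons a e) phi.
Proof.
split=> /= [h a|h [a]]; last by case.
by apply: contrapT => ha; apply: h; exists a.
Qed.

Lemma ev_fimp (N : arith) C (U : C -> N -> Prop) r e phi psi :
  ev U r e (fimp phi psi) <-> (ev U r e phi -> ev U r e psi).
Proof.
split=> /= [h h1|h [h1]]; last by apply; apply: h.
by apply: contrapT => h2; apply: h.
Qed.

Lemma ind_fmP (N : arith) C (U : C -> N -> Prop) r e phi :
  ev U r e (ind_fm phi) <-> (ev U r (scons azero e) phi ->
    (forall a, ev U r (scons a e) phi -> ev U r (scons (asucc a) e) phi) ->
    forall a, ev U r (scons a e) phi).
Proof.
rewrite /ind_fm !ev_fimp ev_inst !ev_fall.
have -> : tev r e \o scons TZero TVar = scons azero e by apply/funext; case.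
have E a : ev U r (scons a e) (fimp phi (finst (scons (TSucc (TVar 0)) (fun n => TVar n.+1)) TPar phi))
  <-> (ev U r (scons a e) phi -> ev U r (scons (asucc a) e) phi).
  rewrite ev_fimp ev_inst.
  by have -> : tev r (scons a e) \o scons (TSucc (TVar 0)) (fun n => TVar n.+1) =
    scons (asucc a) e by apply/funext; case.
by split=> h h0 hS; apply: h => // a; apply/E; apply: hS.
Qed.

Section RestrictedProduct.
Variables (X : Type) (N : X -> arith) (Q : set_system X) (FQ : ProperFilter Q).
Variable F : set (forall x, N x).
Hypothesis F0 : F (fun x => azero).
Hypothesis FS : forall f, F f -> F (fun x => asucc (f x)).
Hypothesis FA : forall f g, F f -> F g -> F (fun x => aadd (f x) (g x)).
Hypothesis FM : forall f g, F f -> F g -> F (fun x => amul (f x) (g x)).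

Definition fam : Type := {f : forall x, N x | F f}.

Definition rp_eq (f g : fam) : Prop := Q [set x | sval f x = sval g x].

Definition rp_dom : Type := {S : fam -> Prop | exists f, S = rp_eq f}.

Definition cls (f : fam) : rp_dom := exist _ (rp_eq f) (ex_intro _ f erefl).

Lemma rp_surj (z : rp_dom) : exists f, z = cls f.
Proof. by case: z => S [f e]; exists f; apply: eq_exist. Qed.

Definition rep (z : rp_dom) : fam := sval (cid (rp_surj z)).

Lemma repK z : cls (rep z) = z.
Proof. by rewrite /rep; case: cid => f /= ->. Qed.

Lemma clsP f g : cls f = cls g <-> Q [set x | sval f x = sval g x].
Proof.
split=> [/(congr1 sval) /= e|h].
  have : rp_eq g g by apply: filterS filterT.
  by rewrite -e.
apply: eq_exist; apply/funext => k; apply/propext; split=> hk.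
  by apply: filterS (filterI h hk) => x [/= <-].
by apply: filterS (filterI h hk) => x [/= ->].
Qed.

Lemma cls_rep f : Q [set x | sval (rep (cls f)) x = sval f x].
Proof. by apply/clsP; rewrite repK. Qed.

Definition fam0 : fam := exist _ _ F0.
Definition famS (f : fam) : fam := exist _ _ (FS (svalP f)).
Definition famA (f g : fam) : fam := exist _ _ (FA (svalP f) (svalP g)).
Definition famM (f g : fam) : fam := exist _ _ (FM (svalP f) (svalP g)).

Definition RP : arith := @Arith rp_dom (cls fam0) (fun z => cls (famS (rep z)))
  (fun z w => cls (famA (rep z) (rep w))) (fun z w => cls (famM (rep z) (rep w))).

Lemma clsS f : @asucc RP (cls f) = cls (famS f).
Proof. by apply/clsP; apply: filterS (cls_rep f) => x /= ->. Qed.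

Lemma clsA f g : @aadd RP (cls f) (cls g) = cls (famA f g).
Proof. by apply/clsP; apply: filterS (filterI (cls_rep f) (cls_rep g)) => x /= [-> ->]. Qed.

Lemma clsM f g : @amul RP (cls f) (cls g) = cls (famM f g).
Proof. by apply/clsP; apply: filterS (filterI (cls_rep f) (cls_rep g)) => x /= [-> ->]. Qed.

Lemma RP_PAax : (forall x, PAax (N x)) -> PAax RP.
Proof.
move=> h; split.
- move=> x; rewrite -(repK x) clsS => /clsP /= hx; apply: (@filter_not_empty _ Q).
  by apply: filterS hx => y /= /(ax_succ0 (h y)).
- move=> x y; rewrite -(repK x) -(repK y) !clsS => /clsP hx; apply/clsP.
  by apply: filterS hx => z /= /(ax_succI (h z)).
- move=> x; rewrite -(repK x) clsA; apply/clsP.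
  by apply: filterS filterT => z _ /=; apply: ax_add0.
- move=> x y; rewrite -(repK x) -(repK y) !(clsS, clsA); apply/clsP.
  by apply: filterS filterT => z _ /=; apply: ax_addS.
- move=> x; rewrite -(repK x) clsM; apply/clsP.
  by apply: filterS filterT => z _ /=; apply: ax_mul0.
- move=> x y; rewrite -(repK x) -(repK y) !(clsS, clsA, clsM); apply/clsP.
  by apply: filterS filterT => z _ /=; apply: ax_mulS.
Qed.

Definition fenv (e : nat -> fam) (x : X) : nat -> N x := fun n => sval (e n) x.

Fixpoint tfam (r e : nat -> fam) (t : tm) : fam :=
  match t with
  | TVar n => e n
  | TPar n => r n
  | TZero => fam0
  | TSucc t => famS (tfam r e t)
  | TAdd t u => famA (tfam r e t) (tfam r e u)
  | TMul t u => famM (tfam r e t) (tfam r e u)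
  end.

Lemma tfamE r e t x : sval (tfam r e t) x = tev (fenv r x) (fenv e x) t.
Proof. by elim: t => //= [t ->|t -> u ->|t -> u ->]. Qed.

Lemma tev_cls r e t : @tev RP (cls \o r) (cls \o e) t = cls (tfam r e t).
Proof.
elim: t => //= [t ->|t -> u ->|t -> u ->]; [exact: clsS|exact: clsA|exact: clsM].
Qed.

Section Los.
Variables (C : Type) (V : forall x : X, C -> N x -> Prop) (U : C -> RP -> Prop).
Hypothesis decided : forall phi r e,
  Q [set x | ev (@V x) (fenv r x) (fenv e x) phi] \/
  Q [set x | ~ ev (@V x) (fenv r x) (fenv e x) phi].
Hypothesis witness : forall phi r e, exists f : fam, Q [set x |
  (exists y, ev (@V x) (fenv r x) (scons y (fenv e x)) phi) ->
  ev (@V x) (fenv r x) (scons (sval f x) (fenv e x)) phi].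
Hypothesis atoms : forall c f, U c (cls f) <-> Q [set x | @V x c (sval f x)].

(** The filter has to decide only the sets defined from families in [F], and witnesses have to be
    found in [F]. This covers an ultrafilter with symmetric families, the filter [ae] with definable
    families, and the cofinite filter with eventually coherent ones. *)
Lemma los phi : forall r e,
  @ev RP C U (cls \o r) (cls \o e) phi <-> Q [set x | ev (@V x) (fenv r x) (fenv e x) phi].
Proof.
have scE f e : scons (cls f) (cls \o e) = cls \o scons f e by apply/funext; case.
have fcE f e x : fenv (scons f e) x = scons (sval f x) (fenv e x) by apply/funext; case.
elim: phi => [t u|c t|phi IH|phi IHp psi IHq|phi IH] r e.
- rewrite /= !tev_cls; split=> [/clsP h|h]; last apply/clsP;
    by apply: filterS h => x /=; rewrite !tfamE.
- rewrite /= tev_cls atoms; split=> h; apply: filterS h => x /=; by rewrite tfamE.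
- rewrite /= IH; split=> h; first by case: (decided phi r e).
  move=> h'; apply: (@filter_not_empty _ Q).
  by apply: filterS (filterI h h') => x [].
- rewrite /= IHp IHq; split=> [[h1 h2]|h].
    by apply: filterS (filterI h1 h2) => x.
  by split; apply: filterS h => x [].
- split=> /= [[a]|h].
    rewrite -(repK a) scE IH => h; apply: filterS h => x /=; rewrite fcE => h.
    by exists (sval (rep a) x).
  have [f hf] := witness phi r e; exists (cls f); rewrite scE; apply/IH.
  by apply: filterS (filterI h hf) => x /= [h1 h2]; rewrite fcE; apply: h2.
Qed.

Lemma los_ud (R : forall N : arith, (C -> N -> Prop) -> (nat -> N) -> Prop) e :
  UD R -> (R RP U (cls \o e) <-> Q [set x | R (N x) (@V x) (fenv e x)]).
Proof.
move=> [phi h]; rewrite (h RP U (cls \o (fun=> fam0)) (cls \o e)) los.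
by split=> hx; apply: filterS hx => x /=; rewrite -h.
Qed.

Lemma RP_IND : (forall x, IND (@V x)) -> IND U.
Proof.
move=> hI phi r e; apply/ind_fmP.
have -> : r = cls \o (rep \o r) by apply/funext => n /=; rewrite repK.
have -> : e = cls \o (rep \o e) by apply/funext => n /=; rewrite repK.
apply/los; apply: filterS filterT => x _ /=; apply/ind_fmP; exact: hI.
Qed.

End Los.
End RestrictedProduct.

(** * Homogeneous linear orders *)

Section Orders.
Variables (I : eqType) (lt : rel I).
Hypothesis lt_irr : irreflexive lt.
Hypothesis lt_tr : transitive lt.
Hypothesis lt_tot : forall x y, x != y -> lt x y || lt y x.
Hypothesis lt_dense : forall x y, lt x y -> exists z, lt x z /\ lt z y.
Hypothesis lt_min : forall x, exists y, lt y x.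
Hypothesis lt_max : forall x, exists y, lt x y.
Hypothesis lt_count : forall x, countable [set y | lt y x].

Definition ile x y := (x == y) || lt x y.

Lemma lt_asym x y : lt x y -> ~ lt y x.
Proof. by move=> h1 h2; have := lt_tr h1 h2; rewrite lt_irr. Qed.

Lemma ile_lt_trans x y z : ile x y -> lt y z -> lt x z.
Proof. by case/orP => [/eqP ->|h] //; apply: lt_tr. Qed.

Lemma lt_ile_trans x y z : lt x y -> ile y z -> lt x z.
Proof. by move=> h /orP [/eqP <-|] //; apply: lt_tr. Qed.

Lemma ltNile x y : lt x y = ~~ ile y x.
Proof.
apply/idP/idP => [h|].
  by apply/negP => /orP [/eqP e|/(lt_asym h) //]; move: h; rewrite e lt_irr.
by rewrite negb_or => /andP [h1 h2]; move: (lt_tot h1); rewrite (negbTE h2).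
Qed.

Lemma ile_total x y : ile x y || lt y x.
Proof. by rewrite ltNile orbN. Qed.

Record Aut := MkAut {
  aut :> I -> I;
  autV : I -> I;
  autK : cancel aut autV;
  autVK : cancel autV aut;
  autM : {mono aut : x y / lt x y} }.

Definition aut1 : Aut := @MkAut id id (fun _ => erefl) (fun _ => erefl) (fun _ _ => erefl).

Lemma autVM (g : Aut) : {mono autV g : x y / lt x y}.
Proof. by move=> x y; rewrite -(autM g) !autVK. Qed.

Definition autI (g : Aut) : Aut := MkAut (autVK g) (autK g) (autVM g).

Lemma aut_compM (g h : Aut) : {mono g \o h : x y / lt x y}.
Proof. by move=> x y /=; rewrite !autM. Qed.

Definition autC (g h : Aut) : Aut :=
  MkAut (can_comp (autK g) (autK h)) (can_comp (autVK h) (autVK g)) (aut_compM g h).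

Definition fixes (g : Aut) (J : seq I) : Prop := forall x, x \in J -> g x = x.

Lemma above (J : seq I) c : exists r, lt c r /\ forall x, x \in J -> lt c x -> ile r x.
Proof.
elim: J => [|y J [r [hr h]]]; first by have [r hr] := lt_max c; exists r.
case hc : (lt c y); last first.
  by exists r; split=> // x; rewrite inE => /orP [/eqP ->|/h //]; rewrite hc.
case/orP: (ile_total r y) => hry.
  by exists r; split=> // x; rewrite inE => /orP [/eqP ->|/h //].
exists y; split=> // x; rewrite inE => /orP [/eqP -> _|hx hcx]; first by rewrite /ile eqxx.
by rewrite /ile (lt_ile_trans hry (h _ hx hcx)) orbT.
Qed.

Lemma below (J : seq I) c : exists l, lt l c /\ forall x, x \in J -> lt x c -> ile x l.
Proof.
elim: J => [|y J [r [hr h]]]; first by have [r hr] := lt_min c; exists r.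
case hc : (lt y c); last first.
  by exists r; split=> // x; rewrite inE => /orP [/eqP ->|/h //]; rewrite hc.
case/orP: (ile_total y r) => hry.
  by exists r; split=> // x; rewrite inE => /orP [/eqP ->|/h //].
exists y; split=> // x; rewrite inE => /orP [/eqP -> _|hx hcx]; first by rewrite /ile eqxx.
by rewrite /ile (ile_lt_trans (h _ hx hcx) hry) orbT.
Qed.

(** * Automorphisms moving one point inside an interval *)

Section BackAndForth.
Variables (l r : I).

Definition piso (p : seq (I * I)) : Prop :=
  [/\ (l, l) \in p, (r, r) \in p &
      forall u v, u \in p -> v \in p -> lt u.1 v.1 = lt u.2 v.2].

Lemma between (L R : seq I) : l \in L -> r \in R ->
  (forall x y, x \in L -> y \in R -> lt x y) ->
  exists z, (forall x, x \in L -> lt x z) /\ (forall y, y \in R -> lt z y).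
Proof.
move=> hl hr h.
have [m [hm hmL]] : exists m, m \in L /\ forall x, x \in L -> ile x m.
  elim: L hl h => [//|a L IH] _ _; elim: L a {IH} => [|b L IH] a.
    by exists a; rewrite inE eqxx; split=> // x; rewrite inE => /eqP ->; rewrite /ile eqxx.
  have [m [hm hmL]] := IH b; case/orP: (ile_total a m) => ham.
    exists m; rewrite inE hm orbT; split=> // x; rewrite inE => /orP [/eqP -> //|]; exact: hmL.
  exists a; rewrite inE eqxx; split=> // x; rewrite inE => /orP [/eqP ->|/hmL hx].
    by rewrite /ile eqxx.
  by rewrite /ile (ile_lt_trans hx ham) orbT.
have [m' [hm' hmR]] := above R m; have [z [hz1 hz2]] := lt_dense hm'.
exists z; split=> [x /hmL hx|y hy]; first exact: ile_lt_trans hx hz1.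
by apply: (lt_ile_trans hz2); apply: hmR => //; apply: h.
Qed.

Lemma piso_extend p x : piso p -> lt l x -> lt x r -> exists y, piso ((x, y) :: p).
Proof.
move=> [hl hr hp] hlx hxr.
have [/mapP [u hu ux]|hx] := boolP (x \in map fst p).
  have -> : x = u.1 by []; exists u.2; rewrite -surjective_pairing.
  split; rewrite ?inE ?hl ?hr ?orbT // => v w; rewrite !inE.
  by move=> /orP [/eqP ->|hv] /orP [/eqP ->|hw]; apply: hp.
have hpx u : u \in p -> u.1 != x.
  by move=> hu; apply/negP => /eqP e; move/negP: hx; apply; apply/mapP; exists u.
have [||a b|z [hzL hzR]] := @between [seq u.2 | u <- p & lt u.1 x] [seq u.2 | u <- p & lt x u.1].
- by apply/mapP; exists (l, l) => //; rewrite mem_filter /= hlx.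
- by apply/mapP; exists (r, r) => //; rewrite mem_filter /= hxr.
- move=> /mapP [u]; rewrite mem_filter => /andP [hu1 hu2] ->.
  move=> /mapP [v]; rewrite mem_filter => /andP [hv1 hv2] ->.
  by rewrite -hp //; apply: lt_tr hu1 hv1.
exists z; split; rewrite ?inE ?hl ?hr ?orbT // => v w; rewrite !inE.
have K u : u \in p -> (lt x u.1 = lt z u.2) /\ (lt u.1 x = lt u.2 z).
  move=> hu; case/orP: (lt_tot (hpx u hu)) => hlt.
    have h1 : lt u.2 z by apply: hzL; apply/mapP; exists u; rewrite ?mem_filter ?hlt.
    by split; [rewrite !ltNile /ile hlt h1 !orbT|rewrite hlt h1].
  have h1 : lt z u.2 by apply: hzR; apply/mapP; exists u; rewrite ?mem_filter ?hlt.
  by split; [rewrite hlt h1|rewrite !ltNile /ile hlt h1 !orbT].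
move=> /orP [/eqP ->|hv] /orP [/eqP ->|hw] /=; rewrite ?lt_irr //.
- by have [-> _] := K _ hw.
- by have [_ ->] := K _ hv.
- exact: hp.
Qed.

Lemma piso_swap p : piso p -> piso [seq (u.2, u.1) | u <- p].
Proof.
move=> [hl hr hp]; split.
- by apply/mapP; exists (l, l).
- by apply/mapP; exists (r, r).
- by move=> u v /mapP [u' hu ->] /mapP [v' hv ->] /=; rewrite hp.
Qed.

Lemma piso_extend2 p x : piso p -> lt l x -> lt x r ->
  exists p', [/\ piso p', {subset p <= p'}, exists y, (x, y) \in p' & exists y, (y, x) \in p'].
Proof.
move=> hp hlx hxr; have [y hy] := piso_extend hp hlx hxr.
have [z hz] := piso_extend (piso_swap hy) hlx hxr.
exists [seq (u.2, u.1) | u <- (x, z) :: [seq (u.2, u.1) | u <- (x, y) :: p]].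
have E (s : seq (I * I)) : [seq (u.2, u.1) | u <- [seq (u.2, u.1) | u <- s]] = s.
  by rewrite -map_comp -[RHS]map_id; apply: eq_map => -[].
rewrite map_cons E /=; split.
- by have := piso_swap hz; rewrite map_cons E.
- by move=> u hu; rewrite !inE hu !orbT.
- by exists y; rewrite !inE eqxx orbT.
- by exists z; rewrite !inE eqxx.
Qed.

(** Cantor's back-and-forth inside the interval from [l] to [r], which is dense and countable
    because it lies below [r]. Outside the interval the automorphism is the identity. *)
Lemma homogeneous a b : lt l a -> lt a r -> lt l b -> lt b r ->
  exists g : Aut, g a = b /\ forall x, ile x l || ile r x -> g x = x.
Proof.
move=> hla har hlb hbr; have hlr := lt_tr hla har.
have hD : countable [set x | lt l x && lt x r].
  by apply: sub_countable (lt_count r); apply: subset_card_le => x /= /andP [].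
have [e [he1 he2]] : exists e : nat -> I, (forall n, lt l (e n) /\ lt (e n) r) /\
    forall x, lt l x -> lt x r -> exists n, e n = x.
  have [f hf] : exists f : I -> nat, {in [set x | lt l x && lt x r] &, injective f}.
    by move/countable_injP: hD.
  have H n : exists x, (lt l x /\ lt x r) /\
      forall y, lt l y -> lt y r -> f y = n -> x = y.
    have [[y [h1 [h2 h3]]]|hn] := EM (exists y, lt l y /\ lt y r /\ f y = n).
      exists y; split=> // z h4 h5 h6; apply: hf; rewrite ?inE /= ?h1 ?h4 //.
      by rewrite h3.
    by exists a; split=> // y h1 h2 h3; case: hn; exists y.
  have [e he] := choice H; exists e; split=> [n|x h1 h2]; first by case: (he n).
  by exists (f x); apply: (he _).2.
have p0 : piso [:: (a, b); (l, l); (r, r)].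
  have N x y : lt x y -> lt y x = false by move=> h; rewrite ltNile /ile h orbT.
  split; rewrite ?inE ?eqxx ?orbT // => u v; rewrite !inE.
  by move=> /or3P [] /eqP -> /or3P [] /eqP -> /=; rewrite ?lt_irr ?hla ?hlb ?har ?hbr ?hlr
    ?(N _ _ hla) ?(N _ _ hlb) ?(N _ _ har) ?(N _ _ hbr) ?(N _ _ hlr).
(* The state carries a counter, naming the element to be put next into both the domain and the
   range. *)
have step (np : nat * {p | piso p}) : exists q : nat * {p | piso p}, q.1 = np.1.+1 /\
    [/\ {subset sval np.2 <= sval q.2}, exists y, (e np.1, y) \in sval q.2 &
        exists y, (y, e np.1) \in sval q.2].
  case: np => n [p hp] /=; have [h1 h2] := he1 n.
  have [p' [hp' h3 h4 h5]] := piso_extend2 hp h1 h2.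
  by exists (n.+1, exist _ p' hp').
have [st hst] := choice step.
pose c n := iter n st (0, exist _ _ p0).
have c1 n : (c n).1 = n by elim: n => //= n IH; rewrite (hst _).1 IH.
have cS n m : n <= m -> {subset sval (c n).2 <= sval (c m).2}.
  elim: m => [|m IH]; first by rewrite leqn0 => /eqP ->.
  rewrite leq_eqVlt => /orP [/eqP -> //|]; rewrite ltnS => /IH h x /h hx.
  by case: (hst (c m)) => _ [h' _ _]; apply: h'.
(* The graph of the automorphism: the identity outside the interval, the union of the finite partial
   isomorphisms inside. *)
pose P x y := (x = y /\ (ile x l || ile r x)) \/
  (lt l x /\ lt x r /\ exists n, (x, y) \in sval (c n).2).
have Pin x y : lt l x -> lt x r -> (exists n, (x, y) \in sval (c n).2) -> lt l y /\ lt y r.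
  move=> h1 h2 [n hn]; case: (svalP (c n).2) => hl hr hp.
  by rewrite -(hp (l, l) (x, y)) // -(hp (x, y) (r, r)).
have Pm x y x' y' : P x y -> P x' y' -> lt x x' = lt y y'.
  move=> [[<- hx]|[h1 [h2 [n hn]]]] [[<- hx']|[h1' [h2' [n' hn']]]] //.
  - have [h3 h4] := Pin _ _ h1' h2' (ex_intro _ n' hn').
    case/orP: hx => hx; first by rewrite (ile_lt_trans hx h1') (ile_lt_trans hx h3).
    rewrite !ltNile /ile (lt_ile_trans h2' hx) (lt_ile_trans h4 hx) !orbT //.
  - have [h3 h4] := Pin _ _ h1 h2 (ex_intro _ n hn).
    case/orP: hx' => hx; last by rewrite (lt_ile_trans h2 hx) (lt_ile_trans h4 hx).
    rewrite !ltNile /ile (ile_lt_trans hx h1) (ile_lt_trans hx h3) !orbT //.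
  - case: (svalP (c (maxn n n')).2) => _ _ hp.
    by apply: (hp (x, y) (x', y')); [apply: cS hn|apply: cS hn']; rewrite ?leq_maxl ?leq_maxr.
have dom x : (ile x l || ile r x) \/ (lt l x /\ lt x r).
  case/orP: (ile_total x l) => h1; first by left; rewrite h1.
  by case/orP: (ile_total r x) => h2; [left; rewrite h2 orbT|right].
have Pt x : exists y, P x y.
  have [hx|[h1 h2]] := dom x; first by exists x; left.
  have [n hn] := he2 x h1 h2; case: (hst (c n)) => _ [_ [y hy] _].
  by exists y; right; do 2 split=> //; exists n.+1; move: hy; rewrite c1 hn.
have Ps y : exists x, P x y.
  have [hx|[h1 h2]] := dom y; first by exists y; left.
  have [n hn] := he2 y h1 h2; case: (hst (c n)) => _ [_ _ [x]].
  rewrite c1 hn -/(c n.+1) => hx; exists x; right.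
  case: (svalP (c n.+1).2) => hl hr hp.
  by rewrite -[lt l x]/(lt (l, l).1 (x, y).1) -[lt x r]/(lt (x, y).1 (r, r).1) !hp //; do 2 split=> //; exists n.+1.
have [g hg] := choice Pt; have [g' hg'] := choice Ps.
have uni x y x' y' : P x y -> P x' y' -> (x == x') = (y == y').
  move=> h1 h2; apply/eqP/eqP => exy; apply/eqP; rewrite -[_ == _]negbK; apply/negP => /lt_tot.
    by rewrite -(Pm _ _ _ _ h1 h2) -(Pm _ _ _ _ h2 h1) exy lt_irr.
  by rewrite (Pm _ _ _ _ h1 h2) (Pm _ _ _ _ h2 h1) exy lt_irr.
have gK : cancel g g' by move=> x; apply/eqP; rewrite (uni _ _ _ _ (hg' (g x)) (hg x)).
have gK' : cancel g' g by move=> x; apply/eqP; rewrite -(uni _ _ _ _ (hg (g' x)) (hg' x)).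
have gM : {mono g : x y / lt x y} by move=> x y; rewrite -(Pm _ _ _ _ (hg x) (hg y)).
exists (MkAut gK gK' gM); split=> [|x hx] /=.
  apply/eqP; rewrite -(uni _ _ _ _ (hg a) (_ : P a b)) //; right; do 2 split=> //.
  by exists 0; rewrite inE eqxx.
by apply/eqP; rewrite -(uni _ _ _ _ (hg x) (_ : P x x)) //; left.
Qed.

End BackAndForth.

(** * Finite supports *)

Section Supports.
Variable H : Aut -> Prop.
Hypothesis HC : forall g h, H g -> H h -> H (autC g h).
Hypothesis HV : forall g, H g -> H (autI g).
Hypothesis HE : forall g h : Aut, g =1 h -> H g -> H h.

Definition supports (J : seq I) : Prop := forall g : Aut, fixes g J -> H g.

(** Let [g] fix [J] except for [a], which it moves up. A small move [h] of [a] that fixes [J']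
    belongs to [H]. Conjugating it by some [u] that fixes [J] gives an element [k] of [H] with
    [k a = g a] that also fixes the rest of [J]. Then the inverse of [k] after [g] fixes [J], so it
    is in [H], and hence so is [g]. *)
Lemma supports_remove J J' a : supports J -> supports J' -> a \notin J' ->
  supports [seq x <- J | x != a].
Proof.
move=> hJ hJ' ha.
have up (g : Aut) : fixes g [seq x <- J | x != a] -> lt a (g a) -> H g.
  move=> hg hlt.
  have hgJ x : x \in J -> x != a -> g x = x by move=> h1 h2; apply: hg; rewrite mem_filter h2.
  have [r [har hr]] := above (J ++ J') a; have [l [hla hl]] := below (J ++ J') a.
  have [a' [haa' ha'r]] := lt_dense har.
  have [h [hha hh]] := homogeneous hla har (lt_tr hla haa') ha'r.
  have hS x : x \in J ++ J' -> x != a -> h x = x.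
    move=> hx hne; apply: hh; case/orP: (lt_tot hne) => hlt'; first by rewrite hl.
    by rewrite hr // orbT.
  have Hh : H h.
    apply: hJ' => x hx; apply: hS; first by rewrite mem_cat hx orbT.
    by apply: contraNneq ha => <-.
  (* Room for [u] to move [a'] to [g a]: [r2] is above both, and no element of [J] lies strictly
     between [a] and [r2]. *)
  have [r2 [h1 [h2 h3]]] : exists r2, lt a' r2 /\ lt (g a) r2 /\
      forall x, x \in J -> lt a x -> ile r2 x.
    have [c [hc1 [hc2 hc3]]] : exists c, ile a' c /\ ile (g a) c /\
        forall x, x \in J -> lt a x -> lt c x.
      have k1 x : x \in J -> lt a x -> lt (g a) x.
        move=> hx hax; rewrite -(hgJ x hx) ?autM //.
        by apply: contraTneq hax => ->; rewrite lt_irr.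
      have k2 x : x \in J -> lt a x -> lt a' x.
        by move=> hx hax; apply: (lt_ile_trans ha'r); apply: hr; rewrite ?mem_cat ?hx.
      case/orP: (ile_total a' (g a)) => hc; [exists (g a)|exists a'];
        by rewrite /ile ?eqxx //; move: hc; rewrite /ile => ->; rewrite ?orbT.
    have [r2 [hr2 hr3]] := above J c; exists r2.
    split; [exact: ile_lt_trans hc1 hr2|split; [exact: ile_lt_trans hc2 hr2|]].
    by move=> x hx hax; apply: hr3 => //; apply: hc3.
  have [u [hu hu']] := homogeneous haa' h1 hlt h2.
  have uJ x : x \in J -> u x = x.
    move=> hx; apply: hu'; case/orP: (ile_total x a) => hxa; first by rewrite hxa.
    by rewrite h3 ?orbT.
  have Hu : H u by apply: hJ.
  have ua : u a = a by apply: hu'; rewrite /ile eqxx.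
  pose k := autC u (autC h (autI u)).
  have Hk : H k by apply: HC => //; apply: HC => //; apply: HV.
  have ka : k a = g a by rewrite /= -{1}ua autK hha hu.
  have kJ x : x \in J -> x != a -> k x = x.
    by move=> hx hne; rewrite /= -{1}(uJ x hx) autK hS ?uJ // mem_cat hx.
  suff : H (autC k (autC (autI k) g)) by apply: HE => x /=; rewrite -[RHS](autVK k).
  apply: HC => //; apply: hJ => x hx.
  have [->|hne] := eqVneq x a; first by rewrite [LHS]/= -ka; exact: (autK k).
  have e1 : g x = x := hgJ x hx hne; have e2 := kJ x hx hne.
  by change (autV k (g x) = x); rewrite e1 -{1}e2; exact: (autK k).
move=> g hg; have [e|hne] := eqVneq (g a) a.
  apply: hJ => x hx; have [-> //|hx'] := eqVneq x a; apply: hg; by rewrite mem_filter hx'.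
case/orP: (lt_tot hne) => hlt; last exact: up.
suff : H (autI (autI g)) by apply: HE.
apply: HV; apply: up; last by rewrite -(autM g) /= autVK.
by move=> x hx; rewrite -{1}(hg x hx); exact: (autK g).
Qed.

(* If H is contained in its conjugate by g, then a minimal support of H is mapped
   into itself by g, hence fixed pointwise. *)
Lemma conj_stable (g : Aut) J : supports J ->
  (forall h, H h -> H (autC (autI g) (autC h g))) -> H g.
Proof.
move=> hJ hg.
have [K [hK hmin]] : exists K, supports K /\ forall K', supports K' -> {subset K <= K'}.
  move: J hJ; suff main n J : size J <= n -> supports J ->
      exists K, supports K /\ forall K', supports K' -> {subset K <= K'}.
    by move=> J; apply: main (leqnn _).
  elim: n J => [|n IH] J hn hJ.
    by exists J; split=> // K' _ x; move: hn; rewrite leqn0 size_eq0 => /eqP ->.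
  have [h|] := EM (forall K', supports K' -> {subset J <= K'}); first by exists J.
  move/existsNP => [K' /not_implyP [hK' hsub]].
  have [a ha1 ha2] : exists2 a, a \in J & a \notin K'.
    apply: contrapT => hno; apply: hsub => x hx; apply: contrapT => hx'.
    by apply: hno; exists x => //; apply/negP.
  apply: (IH [seq x <- J | x != a]); last exact: supports_remove hJ hK' ha2.
  rewrite -ltnS; apply: leq_trans hn; rewrite size_filter -[X in _ < X](count_predC (fun x => x != a)).
  by rewrite -[X in X < _]addn0 ltn_add2l -has_count; apply/hasP; exists a => //=; rewrite eqxx.
(* The preimage of [K] under [g] supports [H] as well: if [h] fixes it, the conjugate of [h] by [g]
   fixes [K], so is in [H], and the hypothesis brings it back to [h]. Minimality puts [K] inside
   this preimage. *)
have gK x : x \in K -> g x \in K.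
  have h : supports [seq autV g x | x <- K].
    move=> h hh; have : H (autC g (autC h (autI g))).
      apply: hK => y hy /=; rewrite hh ?autVK //; by apply: map_f.
    move/hg; apply: HE => y /=; by rewrite !autK.
  by move=> hx; have /mapP [y hy ->] := hmin _ h _ hx; rewrite autVK.
apply: hK => a ha; apply: contrapT => /eqP hne.
(* A point of [K] moved by [g] would have strictly monotone, hence infinitely many, iterates in the
   finite set [K]. *)
have iK n : iter n g a \in K by elim: n => //= n; apply: gK.
have mono (n m : nat) : n < m -> if lt a (g a) then lt (iter n g a) (iter m g a)
    else lt (iter m g a) (iter n g a).
  have S1 k : if lt a (g a) then lt (iter k g a) (iter k.+1 g a)
      else lt (iter k.+1 g a) (iter k g a).
    elim: k => [|k] /=; last by rewrite !autM.
    by case hh : (lt a (g a)) => //; move: (lt_tot hne); rewrite hh orbF.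
  elim: m => // m IHm; rewrite ltnS leq_eqVlt => /orP [/eqP ->|/IHm]; first exact: S1.
  by have := S1 m; case: (lt a (g a)) => h1 h2; [apply: lt_tr h2 h1|apply: lt_tr h1 h2].
have inj : injective (fun n => iter n g a).
  move=> n m e; have [hnm|hmn|//] := ltngtP n m.
    by have := mono _ _ hnm; rewrite e lt_irr; case: ifP.
  by have := mono _ _ hmn; rewrite e lt_irr; case: ifP.
have := @uniq_leq_size _ [seq iter n g a | n <- iota 0 (size K).+1] K.
rewrite (map_inj_uniq inj) iota_uniq size_map size_iota ltnn => h.
by have := h isT (fun x hx => let: ex_intro2 _ _ e := mapP hx in eq_ind_r (fun y => y \in K) (iK _) e).
Qed.

End Supports.
End Orders.

Lemma set_nat_uncountable : ~ countable [set: set nat].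
Proof.
move/countable_injP => [f fI].
pose D : set nat := [set n | exists S, f S = n /\ ~ S n].
have h S : f S = f D -> S = D by apply: fI; rewrite in_setT.
have [hD|hD] := EM (D (f D)); last by apply: (hD); exists D.
by case: (hD) => S [/h ->].
Qed.

(** * Well-orders and the first uncountable ordinal *)

Section WellOrders.
Variables (W : eqType) (R : rel W) (hR : well_order R).

Lemma wo_min3 (A : {pred W}) x : x \in A -> exists2 m, m \in A & forall y, y \in A -> R m y.
Proof. by move=> hx; have [m [[h1 h2] _]] := hR (ex_intro _ x hx); exists m. Qed.

Lemma wo_uniq (A : {pred W}) x y : x \in A -> y \in A ->
  (forall z, z \in A -> R x z) -> (forall z, z \in A -> R y z) -> x = y.
Proof.
move=> hx hy h1 h2; have [m [_ h]] := hR (ex_intro _ x hx).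
by rewrite -(h x) // (h y).
Qed.

Lemma wo_total x y : R x y || R y x.
Proof.
have [|m] := @wo_min3 [pred z | z \in [:: x; y]] x; first by rewrite !inE eqxx.
by rewrite !inE => /orP [] /eqP -> h; rewrite h ?orbT // !inE eqxx ?orbT.
Qed.

Lemma wo_refl x : R x x.
Proof. by have := wo_total x x; rewrite orbb. Qed.

Lemma wo_anti x y : R x y -> R y x -> x = y.
Proof.
move=> h1 h2; apply: (@wo_uniq [pred z | z \in [:: x; y]]); rewrite ?inE ?eqxx ?orbT //.
  by move=> z; rewrite !inE => /orP [] /eqP -> //; apply: wo_refl.
by move=> z; rewrite !inE => /orP [] /eqP -> //; apply: wo_refl.
Qed.

Lemma wo_trans x y z : R x y -> R y z -> R x z.
Proof.
move=> h1 h2; have [|m] := @wo_min3 [pred z' | z' \in [:: x; y; z]] x.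
  by rewrite !inE eqxx.
have Z : z \in [pred z' | z' \in [:: x; y; z]] by rewrite !inE eqxx !orbT.
have Y : y \in [pred z' | z' \in [:: x; y; z]] by rewrite !inE eqxx !orbT.
have X : x \in [pred z' | z' \in [:: x; y; z]] by rewrite !inE eqxx.
rewrite !inE => /or3P [] /eqP -> h; first exact: h.
  by rewrite (wo_anti h1 (h _ X)).
by rewrite (wo_anti h2 (h _ Y)) in h1 *.
Qed.

End WellOrders.

(** A well-order of the power set of [nat] is cut off at the first point with uncountably many
    predecessors. If there is no such point, the whole order serves. *)
Lemma omega1_exists : exists (W : Type) (R : rel W),
  [/\ well_order R, ~ countable [set: W] & forall w, countable [set v | R v w]].
Proof.
have [R0 h0] := well_ordering_principle (set nat : eqType).
have [hall|/existsNP [x1 hx1]] := EM (forall x, countable [set y | R0 y x]).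
  by exists (nat -> Prop), R0; split=> //; exact: set_nat_uncountable.
have [|x0 hx0 hmin] := @wo_min3 _ _ h0 [pred x | ~~ countable [set y | R0 y x]] x1.
  by rewrite inE; apply/negP.
move: hx0; rewrite inE => /negP hx0.
pose p y := R0 y x0 && (y != x0).
exists {y : nat -> Prop | p y}, (fun u v => R0 (sval u) (sval v)); split.
- apply: antisymmetric_well_order => [u v /andP [h1 h2]|A [u hu]].
    by apply: val_inj; exact: (wo_anti h0 h1 h2).
  have [|m] := @wo_min3 _ _ h0 [pred y | `[< exists2 v, v \in A & val v = y >]] (val u).
    by rewrite inE; exists u.
  rewrite inE => -[v hv <-] h; exists v; split=> // w hw.
  by apply: h; rewrite inE; exists w.
- move/countable_injP => [f hf]; apply: hx0; apply/countable_injP.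
  (* The point [x0] is the only element of the closed segment outside the subtype; it gets the code
     0, and all other codes are shifted. *)
  exists (fun y => if insub y is Some u then (f (u : {y | p y})).+1 else 0) => y z.
  have N v : R0 v x0 -> insub v = None :> option {y | p y} -> v = x0.
    move=> hv; case: insubP => // /negP h _; apply/eqP; apply: contrapT => /negP hne.
    by apply: h; rewrite /p hv hne.
  rewrite !inE => hy hz; case ey : insub => [u|]; case ez : insub => [v|] //; last first.
    by rewrite (N _ hy ey) (N _ hz ez).
  move=> [/hf]; rewrite !in_setT => /(_ isT isT) e.
  by move: ey ez; rewrite e; do 2 case: insubP => // ? _ <- [->].
- move=> [w hw] /=.
  have hc : countable [set y | R0 y w].
    apply: contrapT => hn; case/andP: (hw) => h1 /eqP; apply; apply: (wo_anti h0 h1).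
    by apply: hmin; rewrite inE; apply/negP.
  move/countable_injP: hc => [f hf]; apply/countable_injP; exists (f \o val) => u v.
  rewrite !inE /= => hu hv /hf e; apply: val_inj; apply: e; by rewrite inE.
Qed.

Record good_order (I : eqType) (lt : rel I) : Prop := {
  lt_irr : irreflexive lt;
  lt_tr : transitive lt;
  lt_tot : forall x y, x != y -> lt x y || lt y x;
  lt_dense : forall x y, lt x y -> exists z, lt x z /\ lt z y;
  lt_min : forall x, exists y, lt y x;
  lt_max : forall x, exists y, lt x y;
  lt_count : forall x, countable [set y | lt y x] }.

Lemma countable_img T U (f : T -> U) (A : set T) : countable A -> countable (f @` A).
Proof. exact: sub_countable (card_image_le f A). Qed.

Lemma countable_sub T (A B : set T) : A `<=` B -> countable B -> countable A.
Proof. by move=> h; apply: sub_countable; apply: subset_card_le. Qed.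

(** * The lexicographic product of a well-order and the rationals *)

Section LexicographicRationals.
Import Order.TTheory GRing.Theory Num.Theory.
Variables (W : eqType) (R : rel W) (hR : well_order R).
Hypothesis hc : forall w, countable [set v | R v w].

(** Each point of the well-order is replaced by a copy of the rationals. This gives density and
    removes end points, while initial segments remain countable. *)
Definition lexlt (u v : W * rat) : bool :=
  (R u.1 v.1 && (u.1 != v.1)) || ((u.1 == v.1) && (u.2 < v.2)%R).

Lemma lexlt_good : good_order lexlt.
Proof.
have lt_step (x : rat) : (x - 1 < x)%R /\ (x < x + 1)%R.
  by rewrite ltrBlDr ltrDl.
split.
- by move=> [w q]; rewrite /lexlt /= !eqxx ltxx !andbF.
- move=> [v y] [u x] [w z]; rewrite /lexlt /=.
  move=> /orP [/andP [h1 h2]|/andP [/eqP -> h1]] /orP [/andP [h3 h4]|/andP [/eqP <- h3]].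
  + rewrite (wo_trans hR h1 h3) /= orbC; apply/orP; right; apply: contraNneq h2 => e.
    by rewrite e in h1 *; rewrite (wo_anti hR h1 h3) eqxx.
  + by rewrite h1 h2.
  + by rewrite h3 h4.
  + by rewrite eqxx (lt_trans h1 h3) orbT.
- move=> [u x] [v y]; rewrite /lexlt /= xpair_eqE.
  have [->|hne] := eqVneq u v; rewrite ?eqxx /= ?andbF /=.
    by move=> hne; rewrite -neq_lt.
  by move=> _; rewrite ?andbT ?orbF; apply: wo_total.
- move=> [u x] [v y]; rewrite /lexlt /= => /orP [/andP [h1 h2]|/andP [/eqP -> h]].
    by exists (u, (x + 1)%R); rewrite /= !eqxx h1 h2 /= andbF /= (lt_step x).2; split.
  exists (v, ((x + y) / 2)%R); rewrite /= !eqxx /=.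
  by rewrite midf_lt // midf_lt // !orbT.
- by move=> [u x]; exists (u, (x - 1)%R); rewrite /lexlt /= eqxx (lt_step x).1 orbT.
- by move=> [u x]; exists (u, (x + 1)%R); rewrite /lexlt /= eqxx (lt_step x).2 orbT.
- move=> [w x]; move/countable_injP: (hc w) => [f hf]; apply/countable_injP.
  exists (fun u => pickle (f u.1, u.2)) => -[u y] [v z]; rewrite !inE /lexlt /= => hu hv.
  move/(pcan_inj pickleK) => [e ->]; congr pair; apply: hf => //; rewrite inE /=.
    by case/orP: hu => [/andP []|/andP [/eqP -> _]] //; apply: wo_refl.
  by case/orP: hv => [/andP []|/andP [/eqP -> _]] //; apply: wo_refl.
Qed.

End LexicographicRationals.

(* The index set is a bare type, since eqType would force it into a universe
   above that of the models. *)
Lemma index_exists : exists (I : Type) (lt : rel {classic I}) (W : Type) (R : rel W) (c : W -> I),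
  [/\ good_order lt, well_order R /\ (forall w, countable [set v | R v w]),
      ~ countable [set: W], injective c & forall i, exists w, lt i (c w)].
Proof.
have [W [R [h1 h2 h3]]] := omega1_exists.
pose lt : rel (W * rat) := @lexlt {classic W} R.
have [g1 g2 g3 g4 g5 g6 g7] := @lexlt_good {classic W} R h1 h3.
exists (W * rat)%type, lt, W, R, (fun w => (w, 0%R)); split=> //.
- split=> // x y /eqP hxy; apply: g3; apply/eqP => e; exact: hxy e.
- by move=> u v [].
move=> [w x]; have : exists v, ~~ R v w.
  apply: contrapT => hn; apply: h2; apply: countable_sub (h3 w) => v _ /=.
  by apply: contrapT => hv; apply: hn; exists v; apply/negP.
move=> [v hv]; exists v; rewrite /lt /lexlt /=.
have := @wo_total {classic W} R h1 w v; rewrite (negbTE hv) orbF => -> /=.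
rewrite (_ : (w : {classic W}) != v) //; apply: contraNneq hv => ->.
exact: (@wo_refl {classic W} R h1).
Qed.

Ltac dfn_named ::= dfn_syntax.

(** * Invariance of definable relations under isomorphisms *)

Section Isomorphisms.
Variables (N N' : arith) (f : N -> N').
Hypothesis f0 : f azero = azero.
Hypothesis fS : forall x, f (asucc x) = asucc (f x).
Hypothesis fA : forall x y, f (aadd x y) = aadd (f x) (f y).
Hypothesis fM : forall x y, f (amul x y) = amul (f x) (f y).
Hypothesis f_inj : injective f.
Hypothesis f_surj : forall y, exists x, f x = y.

Lemma tev_iso r e t : f (tev r e t) = tev (f \o r) (f \o e) t.
Proof. by elim: t => //= [t <-|t <- u <-|t <- u <-]. Qed.

Lemma ev_iso C (U : C -> N -> Prop) (U' : C -> N' -> Prop) phi :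
  (forall c, occurs c phi -> forall x, U c x <-> U' c (f x)) ->
  forall r e, ev U r e phi <-> ev U' (f \o r) (f \o e) phi.
Proof.
elim: phi => [t u|c t|phi IH|phi IHp psi IHq|phi IH] /= hU r e.
- rewrite -!tev_iso; split=> [->//|]; exact: f_inj.
- by rewrite -tev_iso; apply: hU.
- by rewrite (IH hU).
- by rewrite IHp ?IHq // => c hc; apply: hU; auto.
- have E a : f \o scons a e = scons (f a) (f \o e) by apply/funext; case.
  split=> [[a ha]|[b]]; first by exists (f a); rewrite -E -IH.
  have [a <-] := f_surj b; rewrite -E -IH // => ha; by exists a.
Qed.

Lemma ud_iso C (U : C -> N -> Prop) (U' : C -> N' -> Prop)
    (R : forall N : arith, (C -> N -> Prop) -> (nat -> N) -> Prop) e :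
  UD R -> (forall c x, U c x <-> U' c (f x)) -> R N U e <-> R N' U' (f \o e).
Proof.
move=> [phi h] hU; rewrite (h N U e e) (h N' U' (f \o e) (f \o e)).
by apply: ev_iso.
Qed.

End Isomorphisms.

Lemma ud_Skel C : @UD C (fun N _ e => Skel (e 0) (e 1)).
Proof. by apply: ud_dfn; dfn. Qed.

Lemma ud_Sent C : @UD C (fun N _ e => Sent (e 0)).
Proof. by apply: ud_dfn; dfn. Qed.

Lemma ud_Eqv C : @UD C (fun N _ e => Eqv (e 0) (e 1)).
Proof. by apply: ud_dfn; dfn. Qed.

Lemma ud_near C : @UD C (fun N _ e => nearby (e 0) (e 1)).
Proof. by apply: ud_dfn; rewrite /nearby /child; dfn. Qed.

Lemma ud_child C : @UD C (fun N _ e => child (e 0) (e 1)).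
Proof. by apply: ud_dfn; rewrite /nearby /child; dfn. Qed.

Lemma ud_lt C : @UD C (fun N _ e => arith_lt (e 0) (e 1)).
Proof. by apply: ud_dfn; dfn. Qed.

Lemma ud_Phi : @UD unit (fun N U e => Phi (U tt) (e 0)).
Proof. by apply: ud_dfn; rewrite /Phi; dfn. Qed.

Definition env2 (D : Type) (x y : D) : nat -> D := scons x (fun=> y).

(* The truth predicate T split into pieces, each of which concerns sentences of
   only finitely many skeletons. *)
Definition pieces (N : arith) (T : N -> Prop) : N -> N -> Prop := fun c p => nearby c p /\ T p.

Lemma pd_near (N : arith) C (U : C -> N -> Prop) c : PD U (fun e => nearby c (e 0)).
Proof. by rewrite /PD /nearby /child; dfn. Qed.

Ltac dfn_pieces := lazymatch goal with
  | |- Dfn _ _ (fun _ _ => pieces _ _ _) => apply: dfn_pred; dt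
  end.
Ltac dfn_named ::= first [dfn_pieces | dfn_syntax].

(** * Models with symmetries and a partial truth predicate *)

Section Stages.
Variables (I : eqType) (lt : rel I) (hI : good_order lt).
Local Notation G := (Aut lt).

(* A model of PA with an increasing cofinal sequence d indexed by I, on which
   the automorphisms of I act.  T is a compositional truth predicate for the
   sentences with skeleton in A, and each piece of T satisfies induction. *)
Record stage := Stage {
  st_N :> arith;
  act : G -> st_N -> st_N;
  st_d : I -> st_N;
  st_T : st_N -> Prop;
  st_A : st_N -> Prop;
  st_ax : PAax st_N;
  st_ind : IND (pieces st_T);
  act0 : forall g, act g azero = azero;
  actS : forall g x, act g (asucc x) = asucc (act g x);
  actA : forall g x y, act g (aadd x y) = aadd (act g x) (act g y);
  actM : forall g x y, act g (amul x y) = amul (act g x) (act g y);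
  act1 : forall x, act (aut1 lt) x = x;
  actC : forall g h x, act (autC g h) x = act g (act h x);
  actd : forall g i, act g (st_d i) = st_d (g i);
  st_lt : forall i j, lt i j -> arith_lt (st_d i) (st_d j);
  st_cof : forall x, exists i, arith_lt x (st_d i);
  st_fix : forall (g : G) i x, arith_lt x (st_d i) -> (forall j, ile lt j i -> g j = j) -> act g x = x;
  st_supp : forall x, exists J : seq I, forall g, fixes g J -> act g x = x;
  actT : forall g p, st_T p -> st_T (act g p);
  actAA : forall g k, st_A k -> st_A (act g k);
  st_TA : forall p, st_T p -> exists k, Skel p k /\ st_A k;
  st_child : forall k l, st_A k -> child k l -> st_A l;
  st_Phi : forall p k, Skel p k -> st_A k -> (st_T p <-> Phi st_T p);
  st_reg : forall p q, Eqv p q -> st_T p -> st_T q }.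

Lemma aut_ext (g h : G) : g =1 h -> g = h.
Proof.
case: g h => [g g' h1 h2 h3] [h h' k1 k2 k3] /= /funext e; subst h.
have e : g' = h' by apply/funext => x; rewrite -{1}(k2 x) h1.
by subst h'; congr MkAut; apply: Prop_irrelevance.
Qed.

Section Stage.
Variable S : stage.
Implicit Types (x y p q k l : S) (g h : G).

Lemma st_PA : PA S.
Proof. exact: IND_PA (st_ax S) (@st_ind S). Qed.

Lemma actK g x : act (autI g) (act g x) = x.
Proof.
rewrite -actC (_ : autC _ _ = aut1 lt) ?act1 //.
by apply: aut_ext => i /=; rewrite autK.
Qed.

Lemma actVK g x : act g (act (autI g) x) = x.
Proof.
rewrite -actC (_ : autC _ _ = aut1 lt) ?act1 //.
by apply: aut_ext => i /=; rewrite autVK.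
Qed.

Lemma act_inj g : injective (act (s := S) g).
Proof. exact: can_inj (actK g). Qed.

Lemma act_ud C g (U U' : C -> S -> Prop)
    (R : forall N : arith, (C -> N -> Prop) -> (nat -> N) -> Prop) e :
  UD R -> (forall c x, U c x <-> U' c (act g x)) -> R S U e <-> R S U' (act g \o e).
Proof.
apply: ud_iso; [exact: act0|exact: actS|exact: actA|exact: actM|exact: act_inj|].
by move=> y; exists (act (autI g) y); rewrite actVK.
Qed.

Lemma act_Skel g p k : Skel p k <-> Skel (act g p) (act g k).
Proof. exact: (act_ud (C := void) (U := @nopred S) (U' := @nopred S) (env2 p k) (@ud_Skel _)). Qed.

Lemma act_near g k l : nearby k l <-> nearby (act g k) (act g l).
Proof. exact: (act_ud (C := void) (U := @nopred S) (U' := @nopred S) (env2 k l) (@ud_near _)). Qed.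

Lemma act_lt g x y : arith_lt x y <-> arith_lt (act g x) (act g y).
Proof. exact: (act_ud (C := void) (U := @nopred S) (U' := @nopred S) (env2 x y) (@ud_lt _)). Qed.

Lemma act_Phi g (T T' : S -> Prop) p : (forall q, T q <-> T' (act g q)) ->
  Phi T p <-> Phi T' (act g p).
Proof.
move=> h; exact: (act_ud (U := fun=> T) (U' := fun=> T') (fun=> p) ud_Phi (fun=> h)).
Qed.

(** ** Skeletons are never isomorphic to their proper constituents *)

Inductive desc : S -> S -> Prop :=
| desc1 k l : child k l -> desc k l
| descS k l m : child k l -> desc l m -> desc k m.

Lemma desc_lt k l : desc k l -> arith_lt l k.
Proof.
elim=> [{}k {}l h|{}k {}l m h _ IH]; first exact: child_lt st_PA _ _ h.
exact: (lt_trans st_PA IH (child_lt st_PA h)).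
Qed.

Lemma act_cpair g x y : act g (cpair x y) = cpair (act g x) (act g y).
Proof. by rewrite /cpair !(actA, actM). Qed.

Lemma act_ctag g n x : act g (ctag n x) = ctag n (act g x).
Proof. by rewrite /ctag act_cpair; congr cpair; elim: n => [|n IH] /=; rewrite ?act0 ?actS ?IH. Qed.

Lemma child_stable g k l : child k l -> act g k = k -> act g l = l.
Proof.
have inj := ctag_inj st_PA; have pinj := cpair_inj st_PA.
case=> [->|[[m ->]|[[m ->]|[i ->]]]]; rewrite act_ctag ?act_cpair => /inj [_] //.
- by case/pinj.
- by case/pinj.
- by case/pinj.
Qed.

Lemma desc_stable g k l : desc k l -> act g k = k -> act g l = l.
Proof.
by elim=> [{}k {}l h|{}k {}l m h _ IH] hk; [exact: child_stable h hk|exact: IH (child_stable h hk)].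
Qed.

(** The constituents of [k] are read off from [k], so everything that fixes [k] fixes its
    constituent [act g k]. Thus the stabiliser of [k] lies in its conjugate, [conj_stable] gives
    [act g k = k], and [k] would be smaller than itself. *)
Lemma desc_irr g k : ~ desc k (act g k).
Proof.
move=> h; suff e : act g k = k by have := desc_lt h; rewrite e => /(ltxx st_PA).
have [J hJ] := st_supp k.
apply: (conj_stable (lt_irr hI) (lt_tr hI) (lt_tot hI) (lt_dense hI) (lt_min hI) (lt_max hI)
  (lt_count hI) (H := fun g => act g k = k) _ _ _ hJ).
- by move=> g1 g2 h1 h2; rewrite actC h2.
- by move=> g1 h1; rewrite -{1}h1 actK.
- by move=> g1 g2 /aut_ext ->.
- by move=> g1 /(desc_stable h) h1; rewrite !actC h1 actK.
Qed.

(** ** Truth for finitely many further orbits of skeletons *)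

Definition orbit (F : seq S) k : Prop := exists g k0, List.In k0 F /\ k = act g k0.

Section Approximation.
Variable F : seq S.

(* Truth for the skeletons in A or in an orbit of F, provided that at most n steps
   lead from the skeleton to A or out of the orbits. *)
Fixpoint approx (n : nat) (p : S) : Prop :=
  if n is n'.+1 then
    (exists k, [/\ Skel p k, st_A k & st_T p]) \/
    (exists k, [/\ Skel p k, ~ st_A k, orbit F k & Phi (approx n') p])
  else st_T p.

Lemma approx_old n p k : Skel p k -> st_A k -> (approx n p <-> st_T p).
Proof.
move=> hk hA; case: n => [//|n] /=; split=> [[[? []//]|[k' [hk' hn]]]|h]; last by left; exists k.
by case: hn; rewrite (Skel_fun st_PA hk' hk).
Qed.

Lemma approx_new n p k : Skel p k -> ~ st_A k -> orbit F k ->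
  (approx n.+1 p <-> Phi (approx n) p).
Proof.
move=> hk hA hF /=; split=> [[[k' [hk' hA' _]]|[? []//]]|h]; last by right; exists k.
by case: hA; rewrite (Skel_fun st_PA hk hk').
Qed.

Lemma approx_out n p k : Skel p k -> ~ st_A k -> ~ orbit F k -> ~ approx n p.
Proof.
move=> hk hA hO; have hf := Skel_fun st_PA hk; case: n => [/st_TA [k' [/hf <- //]]|n].
by case=> [[k' [/hf <- //]]|[k' [/hf <- //]]].
Qed.

Lemma orbit_act g k : orbit F k -> orbit F (act g k).
Proof. by move=> [h [k0 [h1 ->]]]; exists (autC g h), k0; rewrite actC. Qed.

Lemma actT_iff g p : st_T p <-> st_T (act g p).
Proof. by split=> [|/(actT (autI g))]; [exact: actT|rewrite actK]. Qed.

Lemma actA_iff g p : st_A p <-> st_A (act g p).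
Proof. by split=> [|/(actAA (autI g))]; [exact: actAA|rewrite actK]. Qed.

Lemma approx_act n g p : approx n p -> approx n (act g p).
Proof.
elim: n g p => [|n IH] g p /=; first exact: actT.
have IH' q : approx n q <-> approx n (act g q).
  by split=> [|/(IH (autI g))]; [exact: IH|rewrite actK].
case=> [[k [h1 h2 h3]]|[k [h1 h2 h3 h4]]].
  by left; exists (act g k); split; [exact: (iffLR (act_Skel g p k))|exact: actAA|exact: actT].
right; exists (act g k); split; [exact: (iffLR (act_Skel g p k))| |exact: orbit_act|
  exact: (iffLR (act_Phi p IH'))].
by rewrite -actA_iff.
Qed.

Lemma approx_reg n p q : Eqv p q -> approx n p -> approx n q.
Proof.
elim: n p q => [|n IH] p q he; first exact: st_reg he.
case=> [[k [h1 h2 h3]]|[k [h1 h2 h3 h4]]].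
  by left; exists k; split=> //; [exact: Eqv_Skel st_PA _ _ _ he h1|exact: st_reg he h3].
right; exists k; split=> //; first exact: Eqv_Skel st_PA _ _ _ he h1.
exact: (Phi_Eqv st_PA IH he h4).
Qed.

Fixpoint bounded_depth (n : nat) (k : S) : Prop :=
  st_A k \/ ~ orbit F k \/ if n is n'.+1 then forall l, child k l -> bounded_depth n' l else False.

(** The truth clause at [k] consults only children of [k], for which a smaller depth suffices. *)
Lemma approx_stable n k p m : bounded_depth n k -> Skel p k -> n <= m ->
  approx m.+1 p <-> approx n.+1 p.
Proof.
elim: n k p m => [|n IH] k p m hb hk hm;
  (have [hA|hA] := EM (st_A k); first by rewrite !(approx_old _ hk hA));
  (have [hO|hO] := EM (orbit F k); last by split=> h; case: (approx_out hk hA hO h)).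
  by case: hb => [//|[//|]].
case: hb => [//|[//|hb]]; rewrite !(approx_new _ hk hA hO).
case: m hm => // m hm.
have H q l : Sent q -> child k l -> Skel q l -> (approx m.+1 q <-> approx n.+1 q).
  by move=> _ hl hq; apply: (IH l q m) => //; exact: hb.
by split; apply: (Phi_near st_PA hk) => q l h1 h2 h3; rewrite (H q l).
Qed.

(* An orbit meets a branch of constituents at most once, by desc_irr. *)
Lemma bounded_depth_exists : exists n, forall k, bounded_depth n k.
Proof.
suff H n (F' : list S) : size F' <= n -> forall k,
    (forall l, l = k \/ desc k l -> orbit F l -> exists g k0, List.In k0 F' /\ l = act g k0) ->
    bounded_depth n k.
  by exists (size F) => k; apply: (H _ F) => // l _ [g [k0 h]]; exists g, k0.
elim: n F' => [|n IH] F' hF' k hk /=.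
  right; left => hO; have [g [k0 [h _]]] := hk k (or_introl erefl) hO.
  by case: F' hF' h {hk}.
have [hO|hO] := EM (orbit F k); last by right; left.
right; right => l hl; have [g [k0 [h ek]]] := hk k (or_introl erefl) hO.
have [l1 [l2 eF]] := List.in_split _ _ h.
apply: (IH (l1 ++ l2)).
  by move: hF'; rewrite eF !size_cat /= addnS ltnS.
move=> l' hl' hOl.
have hd : desc k l' by case: hl' => [->|hd]; [exact: desc1|exact: descS hl hd].
have [g' [k1 [h1 el]]] := hk l' (or_intror hd) hOl.
rewrite eF in h1; have h2 := List.in_app_or _ _ _ h1.
exists g', k1; split=> //; case: h2 => [h2|[e|h2]].
- by apply: List.in_or_app; left.
- exfalso; apply: (@desc_irr (autC g' (autI g)) k).
  by rewrite {2}ek actC actK e -el.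
- by apply: List.in_or_app; right.
Qed.

Definition truthF : S -> Prop := approx (sval (cid bounded_depth_exists)).+1.

Lemma truthF_old p k : Skel p k -> st_A k -> (truthF p <-> st_T p).
Proof. exact: approx_old. Qed.

Lemma truthF_Phi p k : Skel p k -> st_A k \/ orbit F k -> (truthF p <-> Phi truthF p).
Proof.
move=> hk hO; have [hA|hA] := EM (st_A k).
  rewrite (truthF_old hk hA) (st_Phi hk hA).
  have H q l : Sent q -> child k l -> Skel q l -> (st_T q <-> truthF q).
    by move=> _ hl hq; rewrite (truthF_old hq (st_child hA hl)).
  by split; apply: (Phi_near st_PA hk) => q l h1 h2 h3; rewrite (H q l).
case: hO => [//|hO]; rewrite /truthF; case: cid => n hn; change (approx n.+1 p <-> Phi (approx n.+1) p).
by rewrite -(approx_new _ hk hA hO) (approx_stable (hn k) hk (leqnSn n)).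
Qed.

Lemma truthF_act g p : truthF p <-> truthF (act g p).
Proof. by split=> [|/(approx_act (autI g))]; [exact: approx_act|rewrite actK]. Qed.

Lemma truthF_reg p q : Eqv p q -> truthF p -> truthF q.
Proof. exact: approx_reg. Qed.

(** Only the restriction to a single skeleton is definable. Whether [k] is in [st_A] or in an orbit
    is decided outside the formula, so neither set has to be definable, and the remaining clause
    involves just two children. *)
Lemma pd_approx n k : PD (pieces (@st_T S)) (fun e => Skel (e 0) k /\ approx n (e 0)).
Proof.
elim: n k => [|n IH] k.
  apply: (dfn_ext (R := fun _ e => Skel (e 0) k /\ pieces (@st_T S) k (e 0))).
    move=> _ e; split=> -[h1 h2]; split=> //; first by case: h2.
    by split=> //; exists k; split=> //; left.
  by dfn.
have [hA|hA] := EM (st_A k).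
  apply: (dfn_ext (R := fun _ e => Skel (e 0) k /\ pieces (@st_T S) k (e 0))).
    move=> _ e; split=> -[h1 h2]; split=> //.
      by case: h2 => _; exact: (iffRL (approx_old n.+1 h1 hA)).
    split; first by exists k; split=> //; left.
    exact: (iffLR (approx_old n.+1 h1 hA)).
  by dfn.
have [hO|hO] := EM (orbit F k); last first.
  apply: (dfn_ext (R := fun _ e => False)); last by dfn.
  move=> _ e; split=> // -[h1 [[k' [h2 h3 _]]|[k' [h2 _ h3 _]]]].
    by apply: hA; rewrite (Skel_fun st_PA h1 h2).
  by apply: hO; rewrite (Skel_fun st_PA h1 h2).
have [l [m hlm]] := child_finite st_PA k.
(* [approx n] cut down to the children of [k], where it is definable by the induction hypothesis. By
   [Phi_near] this does not alter the clause at [k]. *)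
pose Y q := (child k l /\ Skel q l /\ approx n q) \/ (child k m /\ Skel q m /\ approx n q).
have hl := IH l; have hm := IH m.
pose L q := Skel q l /\ approx n q; pose M q := Skel q m /\ approx n q.
have hL : PD (pieces (@st_T S)) (fun e => L (e 0)) by [].
have hM : PD (pieces (@st_T S)) (fun e => M (e 0)) by [].
have hY : PD (pieces (@st_T S)) (fun e => Y (e 0)).
  apply: (dfn_ext (R := fun _ e => (child k l /\ L (e 0)) \/ (child k m /\ M (e 0)))) => //.
  by rewrite /child; dfn.
apply: (dfn_ext (R := fun _ e => Skel (e 0) k /\ Phi Y (e 0))); last by rewrite /Phi; dfn.
have H q l' : Sent q -> child k l' -> Skel q l' -> (Y q <-> approx n q).
  move=> _ hc hq; split=> [[[_ []]|[_ []]]|h] //.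
  by case: (hlm l' hc) => e; subst l'; [left|right].
move=> _ e; split=> -[h1 h2]; split=> //.
  apply: (iffRL (approx_new n h1 hA hO)); apply: (Phi_near st_PA h1 _ h2) => q l' k1 k2 k3.
  exact: (H q l').
apply: (Phi_near st_PA h1 _ (iffLR (approx_new n h1 hA hO) h2)) => q l' k1 k2 k3.
by rewrite (H q l').
Qed.

Lemma truthF_IND : IND (pieces truthF).
Proof.
apply: IND_subst (@st_ind S) _ => k; have [l [m hlm]] := child_finite st_PA k.
set n := (sval (cid bounded_depth_exists)).+1.
pose K j q := Skel q j /\ approx n q.
have hK j : PD (pieces (@st_T S)) (fun e => K j (e 0)) by apply: pd_approx.
have hk := hK k; have hl := hK l; have hm := hK m.
apply: (dfn_ext (R := fun _ e => nearby k (e 0) /\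
  (K k (e 0) \/ K l (e 0) \/ K m (e 0)))); last by rewrite /nearby /child; dfn.
move=> _ e; split=> -[h1 h2]; split=> //; first by case: h2 => [[]|[[]|[]]].
case: h1 => j [hj [ej|hc]]; first by left; rewrite -ej.
by case: (hlm j hc) => ej; subst j; right; [left|right].
Qed.

End Approximation.
End Stage.
End Stages.

Ltac dfn_named ::= first [dfn_pieces | dfn_syntax].

(** * One extension step: an ultraproduct of symmetric families *)

Section Extension.
Variables (I : eqType) (lt : rel I) (hI : good_order lt).
Local Notation G := (Aut lt).
Variable S : stage lt.
Local Notation X := (seq S).
Let hPA : PA S := st_PA S.

Lemma ile_tot (x y : I) : ile lt x y || lt y x.
Proof. exact: (ile_total (lt_irr hI) (lt_tr hI) (lt_tot hI)). Qed.

Lemma sorted_exists (J : seq I) : exists J', sorted lt J' /\ J' =i J.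
Proof.
exists (sort (ile lt) (undup J)); split; last by move=> j; rewrite mem_sort mem_undup.
have tr : transitive (ile lt).
  move=> y x z h; rewrite {2}/ile => /orP [/eqP <- //|h2].
  by rewrite /ile (ile_lt_trans (lt_tr hI) h h2) orbT.
have tot : total (ile lt).
  by move=> x y; case/orP: (ile_tot x y) => h; apply/orP; [left|right; rewrite /ile h orbT].
have h1 := sort_sorted tot (undup J); have h2 : uniq (sort (ile lt) (undup J)).
  by rewrite sort_uniq undup_uniq.
move: h1 h2; rewrite (sorted_pairwise tr) (sorted_pairwise (lt_tr hI)) uniq_pairwise => h1 h2.
apply: (sub_pairwise (r := [rel x y | ile lt x y && (x != y)])).
  by move=> x y /= /andP [/orP [/eqP ->|//]]; rewrite eqxx.
by rewrite pairwise_relI h1.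
Qed.

Lemma homog (l r a b : I) : lt l a -> lt a r -> lt l b -> lt b r ->
  exists g : G, g a = b /\ forall x, ile lt x l || ile lt r x -> g x = x.
Proof.
exact: (homogeneous (lt_irr hI) (lt_tr hI) (lt_tot hI) (lt_dense hI) (lt_max hI) (lt_count hI)).
Qed.

Lemma move_above (i j j' : I) : lt i j -> lt i j' ->
  exists g : G, g j = j' /\ forall x, ile lt x i -> g x = x.
Proof.
move=> h h'; have [r hr] := lt_max hI j; have [r' hr'] := lt_max hI j'.
have [r0 [h1 h2]] : exists r0, lt j r0 /\ lt j' r0.
  case/orP: (ile_tot r r') => hrr.
    by exists r'; split=> //; case/orP: hrr => [/eqP <- //|]; apply: (lt_tr hI hr).
  by exists r; split=> //; apply: (lt_tr hI hr').
have [g [hg hfix]] := homog h h1 h' h2.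
by exists g; split=> // x hx; apply: hfix; rewrite hx.
Qed.

Lemma upper_bound_seq (i0 : I) (J : seq I) : exists i, forall x, x \in J -> ile lt x i.
Proof.
elim: J => [|y J [i hi]]; first by exists i0.
case/orP: (ile_tot y i) => h.
  by exists i => x; rewrite inE => /orP [/eqP ->|/hi].
exists y => x; rewrite inE => /orP [/eqP ->|/hi hx]; first by rewrite /ile eqxx.
by rewrite /ile (ile_lt_trans (lt_tr hI) hx h) orbT.
Qed.

(* The uniformly symmetric families; they are uniformly bounded by some d j
   because all d j, for j above the support, are conjugate. *)
Definition symfam : set (X -> S) :=
  [set f | exists J : seq I, forall g : G, fixes g J -> forall F, act g (f F) = f F].

Lemma symfam_bounded f : symfam f -> exists j, forall F, arith_lt (f F) (st_d S j).
Proof.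
move=> [J hJ]; have [i0 _] := st_cof (azero : S); have [i hi] := upper_bound_seq i0 J.
have [j hj] := lt_max hI i; exists j => F.
have [j' hj'] := st_cof (f F).
case/orP: (ile_tot j' j) => h.
  case/orP: h => [/eqP <- //|h]; exact: (lt_trans hPA hj' (st_lt S h)).
have [g [gj gi]] := move_above (lt_tr hI hj h) hj.
have := iffLR (act_lt g _ _) hj'; rewrite actd gj hJ // => x hx; apply: gi; exact: hi.
Qed.

Lemma symfam_const x : symfam (fun=> x).
Proof. by have [J hJ] := st_supp x; exists J => g hg _; apply: hJ. Qed.

Lemma fixes_cat (g : G) J J' : fixes g (J ++ J') -> fixes g J /\ fixes g J'.
Proof. by move=> h; split=> x hx; apply: h; rewrite mem_cat hx ?orbT. Qed.

Lemma symfamS f : symfam f -> symfam (fun F => asucc (f F)).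
Proof. by move=> [J hJ]; exists J => g hg F; rewrite actS hJ. Qed.

Lemma symfamA f f' : symfam f -> symfam f' -> symfam (fun F => aadd (f F) (f' F)).
Proof.
move=> [J hJ] [J' hJ']; exists (J ++ J') => g /fixes_cat [h1 h2] F.
by rewrite actA hJ ?hJ'.
Qed.

Lemma symfamM f f' : symfam f -> symfam f' -> symfam (fun F => amul (f F) (f' F)).
Proof.
move=> [J hJ] [J' hJ']; exists (J ++ J') => g /fixes_cat [h1 h2] F.
by rewrite actM hJ ?hJ'.
Qed.

Lemma symfam_act g f : symfam f -> symfam (fun F => act g (f F)).
Proof.
move=> [J hJ]; exists [seq g x | x <- J] => h hh F.
have e : act (autC (autI g) (autC h g)) (f F) = f F.
  by apply: hJ => x hx /=; rewrite hh ?map_f // autK.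
by rewrite -{2}e !actC actVK.
Qed.

(** Each given skeleton belongs to almost all lists, so that its truth clause holds in almost all
    factors ([ext_Phi]). *)
Definition cone : set_system X :=
  [set Y | exists F0 : X, forall F : X, (forall k, List.In k F0 -> List.In k F) -> Y F].

Lemma cone_proper : ProperFilter cone.
Proof.
split; first by move=> [F0 /(_ F0)]; apply.
split; first by exists [::].
- move=> P Q [F hF] [F' hF']; exists (F ++ F') => F2 h; split.
    by apply: hF => k hk; apply: h; apply: List.in_or_app; left.
  by apply: hF' => k hk; apply: h; apply: List.in_or_app; right.
- by move=> P Q hPQ [F hF]; exists F => F' h; apply/hPQ/hF.
Qed.

Definition ultra : set_system X := sval (cid (ultraFilterLemma cone_proper)).

Lemma ultra_ultra : UltraFilter ultra.
Proof. by rewrite /ultra; case: cid => Q []. Qed.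

#[local] Instance ultra_properF : ProperFilter ultra := @ultra_proper _ _ ultra_ultra.

Lemma ultra_cone Y : cone Y -> ultra Y.
Proof. by rewrite /ultra; case: cid => Q [] /= _; apply. Qed.

Lemma ultra_decided (Y : set X) : ultra Y \/ ultra (~` Y).
Proof. exact: (in_ultra_setVsetC Y ultra_ultra). Qed.

Local Notation fam := (fam (N := fun _ : X => S :> arith) symfam).
Local Notation SS := (RP ultra (symfam_const azero) symfamS symfamA symfamM).
Definition cl (f : fam) : SS := cls ultra f.

Lemma clP (f g : fam) : cl f = cl g <-> ultra [set F | sval f F = sval g F].
Proof. exact: clsP. Qed.

Lemma cl_surj (z : SS) : exists f, z = cl f.
Proof. exact: rp_surj. Qed.


Lemma finite_support (Q : nat -> G -> Prop) m :
  (forall n, exists J : seq I, forall g : G, fixes g J -> Q n g) ->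
  exists J : seq I, forall g : G, fixes g J -> forall n, n < m -> Q n g.
Proof.
move=> h; elim: m => [|m [J hJ]]; first by exists [::].
have [J' hJ'] := h m; exists (J ++ J') => g /fixes_cat [h1 h2] n.
by rewrite ltnS leq_eqVlt => /orP [/eqP ->|]; [exact: hJ'|exact: hJ].
Qed.

Section SymmetricLos.
Variables (C : Type) (V : X -> C -> S -> Prop) (U : C -> SS -> Prop).
Hypothesis V_sym : forall c, exists J : seq I, forall g : G, fixes g J ->
  forall F x, V F c x <-> V F c (act g x).
Hypothesis V_ind : forall F, IND (V F).
Hypothesis atoms : forall c f, U c (cl f) <-> ultra [set F | V F c (sval f F)].

Lemma preds_support (phi : fm C) : exists J : seq I, forall g : G, fixes g J ->
  forall c, occurs c phi -> forall F x, V F c x <-> V F c (act g x).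
Proof.
elim: phi => [t u|c t|phi IH|phi [J hJ] psi [J' hJ']|phi IH] //=; first by exists [::].
  by have [J hJ] := V_sym c; exists J => g hg _ ->; apply: hJ.
by exists (J ++ J') => g /fixes_cat [h1 h2] c [hc|hc]; [apply: hJ|apply: hJ'].
Qed.

(** The least witness is chosen in each factor. An automorphism that fixes the supports of the
    finitely many parameters and predicates involved preserves both the formula and the order, hence
    the least witness. So the restriction to symmetric families loses no witnesses. *)
Lemma sym_witness (phi : fm C) (r e : nat -> fam) : exists f : fam, ultra [set F |
  (exists y, ev (V F) (fenv r F) (scons y (fenv e F)) phi) ->
  ev (V F) (fenv r F) (scons (sval f F) (fenv e F)) phi].
Proof.
pose m := fbound phi; pose Y F y := ev (V F) (fenv r F) (scons y (fenv e F)) phi.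
have [J1 h1] := finite_support m (fun n => svalP (r n)).
have [J2 h2] := finite_support m (fun n => svalP (e n)).
have [J3 h3] := preds_support phi.
have hY g F y : fixes g (J1 ++ (J2 ++ J3)) -> Y F y <-> Y F (act g y).
  move=> /fixes_cat [k1 /fixes_cat [k2 k3]]; rewrite /Y.
  rewrite (ev_iso (act0 S g) (@actS _ _ S g) (@actA _ _ S g) (@actM _ _ S g) (@act_inj _ _ S g)
    (fun z => ex_intro _ _ (actVK g z)) (fun c hc x => h3 g k3 c hc F x)).
  apply: ev_agree => // n hn /=; first exact: h1.
  by case: n hn => [|n] //= hn; apply: h2 => //; apply: ltnW.
have H F : exists y, ((exists y, Y F y) -> Y F y /\ forall z, arith_lt z y -> ~ Y F z) /\
    (~ (exists y, Y F y) -> y = azero).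
  have [hex|hex] := EM (exists y, Y F y); last by exists azero.
  have [|y hy] := least hPA (Q := Y F) (@V_ind F) _ hex; last by exists y.
  exact: (@dfn_inst unit (fun=> S : arith) C (fun=> V F) setT phi (fun n _ => fenv r F n)
    (fun n _ => fenv e F n)).
have [f0 hf0] := choice H.
have hf : symfam f0.
  exists (J1 ++ (J2 ++ J3)) => g hg F; have [k1 k2] := hf0 F.
  have [hex|hex] := EM (exists y, Y F y); last by rewrite k2 // act0.
  have [k3 k4] := k1 hex.
  have hgV : fixes (autI g) (J1 ++ (J2 ++ J3)).
    by move=> x hx; rewrite -{1}(hg x hx) /= autK.
  case: (lt_total hPA (act g (f0 F)) (f0 F)) => [h|[//|h]].
    by case: (k4 _ h); exact: (iffLR (hY g F _ hg) k3).
  have h' := iffLR (act_lt (autI g) _ _) h; rewrite actK in h'.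
  by case: (k4 _ h'); exact: (iffLR (hY _ F _ hgV) k3).
exists (exist _ f0 hf); apply: filterS filterT => F _ /= hex.
exact: ((hf0 F).1 hex).1.
Qed.

Lemma sym_los phi (r e : nat -> fam) : @ev SS C U (cl \o r) (cl \o e) phi <->
  ultra [set F | ev (V F) (fenv r F) (fenv e F) phi].
Proof.
apply: (@los X (fun=> S) ultra _ symfam _ _ _ _ C V U); [|exact: sym_witness|exact: atoms].
by move=> *; apply: ultra_decided.
Qed.

Lemma sym_los_ud (R : forall N : arith, (C -> N -> Prop) -> (nat -> N) -> Prop) (e : nat -> fam) :
  UD R -> (R SS U (cl \o e) <-> ultra [set F | R S (V F) (fenv e F)]).
Proof.
apply: (@los_ud X (fun=> S) ultra _ symfam _ _ _ _ C V U); [|exact: sym_witness|exact: atoms].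
by move=> *; apply: ultra_decided.
Qed.

Lemma sym_IND : IND U.
Proof.
apply: (@RP_IND X (fun=> S) ultra _ symfam _ _ _ _ C V U _ sym_witness atoms V_ind).
by move=> *; apply: ultra_decided.
Qed.

End SymmetricLos.

Lemma pure_los_ud (R : forall N : arith, (void -> N -> Prop) -> (nat -> N) -> Prop) (e : nat -> fam) :
  UD R -> (R SS (@nopred SS) (cl \o e) <-> ultra [set F | R S (@nopred S) (fenv e F)]).
Proof.
apply: (@sym_los_ud void (fun=> @nopred S) (@nopred SS)); try by case.
by move=> _; exact: PA_IND hPA.
Qed.

Lemma los_Skel (p k : fam) :
  Skel (cl p) (cl k) <-> ultra [set F | Skel (sval p F) (sval k F)].
Proof. exact: (pure_los_ud (env2 p k) (@ud_Skel void)). Qed.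

Lemma los_Eqv (p k : fam) : Eqv (cl p) (cl k) <-> ultra [set F | Eqv (sval p F) (sval k F)].
Proof. exact: (pure_los_ud (env2 p k) (@ud_Eqv void)). Qed.

Lemma los_child (p k : fam) :
  child (cl p) (cl k) <-> ultra [set F | child (sval p F) (sval k F)].
Proof. exact: (pure_los_ud (env2 p k) (@ud_child void)). Qed.

Lemma los_near (p k : fam) :
  nearby (cl p) (cl k) <-> ultra [set F | nearby (sval p F) (sval k F)].
Proof. exact: (pure_los_ud (env2 p k) (@ud_near void)). Qed.

Lemma los_lt (p k : fam) :
  arith_lt (cl p) (cl k) <-> ultra [set F | arith_lt (sval p F) (sval k F)].
Proof. exact: (pure_los_ud (env2 p k) (@ud_lt void)). Qed.

Lemma ultra_all (Y : set X) : (forall F, Y F) -> ultra Y.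
Proof. by move=> h; apply: filterS filterT => F _; apply: h. Qed.

Lemma ultra_ex (Y : set X) : ultra Y -> exists F, Y F.
Proof.
move=> h; apply: contrapT => hn; apply: (@filter_not_empty _ ultra).
by apply: filterS h => F hF; apply: hn; exists F.
Qed.

Lemma ultra_const (Q : Prop) : ultra [set F | Q] <-> Q.
Proof. by split=> [/ultra_ex [_]|h] //; apply: ultra_all. Qed.

Definition cst (x : S) : fam := exist _ _ (symfam_const x).
Definition constant_class (x : S) : SS := cl (cst x).

(** A skeleton has at most two children, and the ultrafilter selects one of them. Hence the old
    skeletons are closed under constituents in the new model, as a stage requires of [st_A]. *)
Lemma child_incl k z : child (constant_class k) z -> exists l, z = constant_class l /\ child k l.
Proof.
have [f ->] := cl_surj z; move=> /los_child hf.
have [l [m hlm]] := child_finite hPA k.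
have [h|h] := ultra_decided [set F | sval f F = l].
  have hl : child k l by have [F /= [h1 h2]] := ultra_ex (filterI hf h); rewrite -h2.
  by exists l; split=> //; apply/clP.
have h' : ultra [set F | sval f F = m].
  by apply: filterS (filterI hf h) => F /= [/hlm []].
have hm : child k m by have [F /= [h1 h2]] := ultra_ex (filterI hf h'); rewrite -h2.
by exists m; split=> //; apply/clP.
Qed.

(** Cut down to sentences with an old skeleton, since only there do the truth clauses hold in almost
    all factors. As the clause at a skeleton consults only its children, the restriction does not
    disturb it. *)
Definition ext_T (z : SS) : Prop := exists f k, [/\ z = cl f, Skel z (constant_class k) &
  ultra [set F | truthF hI F (sval f F)]].

Lemma ext_TE f k : Skel (cl f) (constant_class k) ->
  (ext_T (cl f) <-> ultra [set F | truthF hI F (sval f F)]).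
Proof.
move=> hk; split=> [[f' [k' [/clP e _ h]]]|h]; last by exists f, k.
by apply: filterS (filterI e h) => F /= [->].
Qed.

Lemma ext_atoms k f : pieces ext_T (constant_class k) (cl f) <->
  ultra [set F | pieces (truthF hI F) k (sval f F)].
Proof.
split=> [[/los_near h1 h2]|h].
  have [f' [k' [_ hk' _]]] := h2.
  by apply: filterS (filterI h1 (iffLR (ext_TE hk') h2)) => F [].
have h1 : nearby (constant_class k) (cl f) by apply/los_near; apply: filterS h => F [].
split=> //; have [c [hc hkc]] := h1.
have [l e] : exists l, c = constant_class l.
  by case: hkc => [->|/child_incl [l [-> _]]]; [exists k|exists l].
rewrite e in hc; apply/(ext_TE hc).
by apply: filterS h => F [].
Qed.

Lemma pieces_sym k : exists J : seq I, forall g : G, fixes g J ->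
  forall (F : X) x, pieces (truthF hI F) k x <-> pieces (truthF hI F) k (act g x).
Proof.
have [J hJ] := st_supp k; exists J => g hg F x.
by rewrite /pieces -truthF_act -{2}(hJ g hg) -act_near.
Qed.

Lemma ext_IND0 : IND (fun k => pieces ext_T (constant_class k)).
Proof.
exact: (@sym_IND S (fun F => pieces (truthF hI F)) (fun k => pieces ext_T (constant_class k)) pieces_sym
  (fun F => @truthF_IND _ _ hI S F) ext_atoms).
Qed.

Lemma SS_ax : PAax SS.
Proof. by apply: RP_PAax => _; exact: st_ax. Qed.

Lemma SS_PA : PA SS.
Proof. exact: IND_PA SS_ax ext_IND0. Qed.

Lemma ext_T_Skel z : ext_T z -> exists k, Skel z (constant_class k).
Proof. by move=> [f [k [_ h _]]]; exists k. Qed.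

(** A piece at a new index [c] still contains only sentences with an old skeleton, which is [c] or
    one of its at most two children. So it is a union of at most three parts of pieces at old
    indices. *)
Lemma ext_IND : IND (pieces ext_T).
Proof.
apply: IND_subst ext_IND0 _ => c; have [l [m hlm]] := child_finite SS_PA c.
pose K z q := exists k, [/\ z = constant_class k, Skel q z & pieces ext_T z q].
have hK z : PD (fun k => pieces ext_T (constant_class k)) (fun e => K z (e 0)).
  have [[k ek]|hn] := EM (exists k, z = constant_class k); last first.
    apply: (dfn_ext (R := fun _ e => False)); last by dfn.
    by move=> _ e; split=> // -[k [h _ _]]; apply: hn; exists k.
  apply: (dfn_ext (R := fun _ e => Skel (e 0) z /\
    (fun k => pieces ext_T (constant_class k)) k (e 0))); last first.
    by apply: dfn_and; [dfn|exact: (@dfn_pred unit (fun=> SS : arith) S (fun=> fun k => pieces ext_T (constant_class k)) setT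
      k (fun _ e => e 0) (@dt_var unit (fun=> SS : arith) setT Logic.I 0))].
  move=> _ e; split=> [[h1 h2]|[k' [h0 h1 h2]]].
    by exists k; split=> //; rewrite ek.
  by split=> //=; rewrite -ek.
have h1 := hK c; have h2 := hK l; have h3 := hK m.
apply: (dfn_ext (R := fun _ e => nearby c (e 0) /\ (K c (e 0) \/ K l (e 0) \/ K m (e 0))));
  last first.
  apply: dfn_and; first exact: pd_near.
  by apply: dfn_or; [exact: h1|apply: dfn_or; [exact: h2|exact: h3]].
move=> _ e; split=> [[hc hT]|[hc hT]]; split=> //.
  by case: hT => [[k [_ _ []]]|[[k [_ _ []]]|[k [_ _ []]]]].
have [k hk] := ext_T_Skel hT; have [c' [hc' h]] := hc.
have ec := Skel_fun SS_PA hk hc'.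
have P : K c' (e 0).
  exists k; rewrite -ec; split=> //; split=> //.
  exact: (ex_intro _ (constant_class k) (conj hk (or_introl erefl))).
case: h => [e1|/hlm [e1|e1]]; [left|right; left|right; right]; by rewrite -e1.
Qed.

Definition famact (g : G) (f : fam) : fam := exist _ _ (symfam_act g (svalP f)).
Definition ext_act (g : G) (z : SS) : SS := cl (famact g (rep z)).

Lemma ext_actE g f : ext_act g (cl f) = cl (famact g f).
Proof.
have h : ultra [set F | sval (rep (cl f)) F = sval f F] by apply/clP; exact: repK.
by apply/clP; apply: filterS h => F /= ->.
Qed.

Lemma ext_act_incl g x : ext_act g (constant_class x) = constant_class (act g x).
Proof. by rewrite ext_actE; apply/clP; apply: ultra_all. Qed.

Lemma clS f : asucc (cl f) = cl (famS symfamS f).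
Proof. exact: clsS. Qed.

Lemma clA f f' : aadd (cl f) (cl f') = cl (famA symfamA f f').
Proof. exact: clsA. Qed.

Lemma clM f f' : amul (cl f) (cl f') = cl (famM symfamM f f').
Proof. exact: clsM. Qed.

Lemma incl0 : constant_class azero = azero.
Proof. by apply/clP; apply: ultra_all. Qed.

Lemma ext_act0 g : ext_act g azero = azero.
Proof. by rewrite -incl0 ext_act_incl act0. Qed.

Lemma ext_actS g z : ext_act g (asucc z) = asucc (ext_act g z).
Proof.
have [f ->] := cl_surj z; rewrite clS !ext_actE clS.
by apply/clP; apply: ultra_all => F /=; rewrite actS.
Qed.

Lemma ext_actA g z w : ext_act g (aadd z w) = aadd (ext_act g z) (ext_act g w).
Proof.
have [f ->] := cl_surj z; have [f' ->] := cl_surj w; rewrite clA !ext_actE clA.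
by apply/clP; apply: ultra_all => F /=; rewrite actA.
Qed.

Lemma ext_actM g z w : ext_act g (amul z w) = amul (ext_act g z) (ext_act g w).
Proof.
have [f ->] := cl_surj z; have [f' ->] := cl_surj w; rewrite clM !ext_actE clM.
by apply/clP; apply: ultra_all => F /=; rewrite actM.
Qed.

Lemma ext_act1 z : ext_act (aut1 lt) z = z.
Proof.
have [f ->] := cl_surj z; rewrite ext_actE.
by apply/clP; apply: ultra_all => F /=; rewrite act1.
Qed.

Lemma ext_actC g h z : ext_act (autC g h) z = ext_act g (ext_act h z).
Proof.
have [f ->] := cl_surj z; rewrite !ext_actE.
by apply/clP; apply: ultra_all => F /=; rewrite actC.
Qed.

Lemma incl_lt x y : arith_lt (constant_class x) (constant_class y) <-> arith_lt x y.
Proof. exact: (iff_trans (los_lt (cst x) (cst y)) (ultra_const (arith_lt x y))). Qed.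

Lemma ext_cof z : exists i, arith_lt z (constant_class (st_d S i)).
Proof.
have [f ->] := cl_surj z; have [i hi] := symfam_bounded (svalP f).
by exists i; apply/los_lt; apply: ultra_all.
Qed.

Lemma ext_fix (g : G) i z : arith_lt z (constant_class (st_d S i)) ->
  (forall j, ile lt j i -> g j = j) -> ext_act g z = z.
Proof.
have [f ->] := cl_surj z => /los_lt hf hg; rewrite ext_actE; apply/clP.
by apply: filterS hf => F /= hF; apply: st_fix hF hg.
Qed.

Lemma ext_supp z : exists J : seq I, forall g : G, fixes g J -> ext_act g z = z.
Proof.
have [f ->] := cl_surj z; have [J hJ] := svalP f; exists J => g hg; rewrite ext_actE.
by apply/clP; apply: ultra_all => F; apply: hJ.
Qed.

Lemma ext_actT (g : G) z : ext_T z -> ext_T (ext_act g z).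
Proof.
move=> [f [k [-> hk h]]]; rewrite ext_actE; exists (famact g f), (act g k); split=> //.
  by apply/los_Skel; move/los_Skel: hk; apply: filterS => F /= /(act_Skel g).
by apply: filterS h => F /= /truthF_act.
Qed.

Lemma ext_child z w : (exists k, z = constant_class k) -> child z w -> exists k, w = constant_class k.
Proof. by move=> [k ->] /child_incl [l [-> _]]; exists l. Qed.

Lemma ext_reg z w : Eqv z w -> ext_T z -> ext_T w.
Proof.
move=> he hT; have [k hk] := ext_T_Skel hT; have hk' := Eqv_Skel SS_PA he hk.
have [f ef] := cl_surj z; have [f' ef'] := cl_surj w; subst z w.
apply: (iffRL (ext_TE hk')); move/los_Eqv: he => he.
apply: filterS (filterI he (iffLR (ext_TE hk) hT)) => F /= [h1 h2].
exact: truthF_reg h1 h2.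
Qed.

Lemma pieces_near (T : S -> Prop) k p : Skel p k -> (Phi T p <-> Phi (pieces T k) p).
Proof.
move=> hk; have H q l : Sent q -> child k l -> Skel q l -> (T q <-> pieces T k q).
  by move=> _ hl hq; split=> [h|[]] //; split=> //; exists l; split=> //; right.
by split; apply: (Phi_near hPA hk) => q l h1 h2 h3; rewrite (H q l).
Qed.

Lemma piece_IND (F : X) (k : S) : IND (fun _ : unit => pieces (truthF hI F) k).
Proof.
apply: IND_subst (@truthF_IND _ _ hI S F) _ => _.
by apply: dfn_pred; apply: dt_var.
Qed.

(** Almost all lists contain [k], and for them [truthF_Phi] applies. The clause is transferred with
    the piece at [k] in place of [ext_T], because only the pieces at old indices are exact
    ultraproducts. *)
Lemma ext_Phi z : (exists k, Skel z (constant_class k)) -> (ext_T z <-> Phi ext_T z).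
Proof.
move=> [k hk]; have [f ef] := cl_surj z; subst z; rewrite (ext_TE hk).
have hs := iffLR (los_Skel f (cst k)) hk.
have hF : ultra [set F | List.In k F].
  by apply: ultra_cone; exists [:: k] => F; apply; left.
have E : Phi (pieces ext_T (constant_class k)) (cl f) <->
    ultra [set F | Phi (pieces (truthF hI F) k) (sval f F)].
  exact: (@sym_los_ud unit (fun F _ => pieces (truthF hI F) k) (fun=> pieces ext_T (constant_class k))
    (fun=> pieces_sym k) (fun F => @piece_IND F k) (fun=> ext_atoms k) _ (fun=> f) ud_Phi).
have E2 : Phi ext_T (cl f) <-> Phi (pieces ext_T (constant_class k)) (cl f).
  have H (q l : SS) : Sent q -> child (constant_class k) l -> Skel q l ->
      (ext_T q <-> pieces ext_T (constant_class k) q).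
    move=> _ hl hq; split=> [h|[_ h]]; last exact: h.
    exact: (conj (ex_intro _ l (conj hq (or_intror hl))) h).
  split; apply: (Phi_near SS_PA hk) => q l h1 h2 h3; first exact: H h1 h2 h3.
  exact: (iff_sym (H q l h1 h2 h3)).
rewrite E2 E.
have K F : Skel (sval f F) k -> List.In k F ->
    (truthF hI F (sval f F) <-> Phi (pieces (truthF hI F) k) (sval f F)).
  move=> h1 h2; rewrite -pieces_near //; apply: truthF_Phi h1 _.
  by right; exists (aut1 lt), k; rewrite act1.
by split=> h; apply: filterS (filterI h (filterI hs hF)) => F [h1 [h2 h3]]; apply/K.
Qed.

(** Transparent, since later facts about the chain, such as [tower_d], hold by computation. *)
Definition next_stage : stage lt.
Proof.
refine (@Stage I lt SS ext_act (fun i => constant_class (st_d S i)) ext_T (fun z => exists k, z = constant_class k)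
  SS_ax ext_IND ext_act0 ext_actS ext_actA ext_actM ext_act1 ext_actC _ _ ext_cof ext_fix ext_supp
  ext_actT _ _ ext_child _ ext_reg).
- by move=> g i; rewrite ext_act_incl actd.
- by move=> i j /(st_lt S) /incl_lt.
- by move=> g _ [k ->]; exists (act g k); rewrite ext_act_incl.
- by move=> p /ext_T_Skel [k hk]; exists (constant_class k); split; [exact: hk|exists k].
- by move=> p k h [k' e]; apply: ext_Phi; exists k'; rewrite -e.
Defined.

(** At a skeleton in [st_A] every [truthF hI F] agrees with [st_T], so the new piece is an
    ultrapower of the old one. This makes least true instances stable along the chain. *)
Lemma incl_elem_piece k phi (r e : nat -> S) : st_A k ->
  ev (fun _ : unit => pieces (@st_T _ _ S) k) r e phi <->
  @ev SS unit (fun=> pieces ext_T (constant_class k)) (constant_class \o r) (constant_class \o e) phi.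
Proof.
move=> hA.
rewrite (@sym_los unit (fun F _ => pieces (truthF hI F) k) (fun=> pieces ext_T (constant_class k))
    (fun=> pieces_sym k) (fun F => @piece_IND F k) (fun=> ext_atoms k) phi (cst \o r) (cst \o e)).
have K F : ev (fun _ : unit => pieces (truthF hI F) k) r e phi <->
    ev (fun _ : unit => pieces (@st_T _ _ S) k) r e phi.
  apply: ev_agree => // c _ x; rewrite /pieces; split=> -[h1 h2]; split=> //;
    have [l [hl hkl]] := h1;
    (have hAl : st_A l by case: hkl => [->|/(st_child hA)]);
    by move: h2; rewrite (truthF_old hI F hl hAl).
split=> [h|/ultra_ex [F /K //]].
by apply: ultra_all => F; apply/K.
Qed.

Lemma incl_elem (phi : fm void) (r e : nat -> S) :
  ev (@nopred S) r e phi <-> @ev SS void (@nopred SS) (constant_class \o r) (constant_class \o e) phi.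
Proof.
rewrite (@sym_los void (fun F => @nopred S) (@nopred SS) _ _ _ phi (cst \o r) (cst \o e)).
- exact: (iff_sym (ultra_const _)).
- by case.
- by move=> F; exact: PA_IND hPA.
- by case.
Qed.

Lemma incl_T p k : Skel p k -> st_A k -> (ext_T (constant_class p) <-> st_T p).
Proof.
move=> hp hA; have hp' : Skel (constant_class p) (constant_class k) by apply/los_Skel; apply: ultra_all.
rewrite (ext_TE hp'); split=> [/ultra_ex [F /= h]|h].
  by apply/(truthF_old hI F hp hA).
by apply: ultra_all => F; apply/(truthF_old hI F hp hA).
Qed.

End Extension.

(** * A definable nonprincipal ultrafilter (MacDowell and Specker) *)

Fixpoint tm_code (t : tm) : GenTree.tree nat :=
  match t with
  | TVar n => GenTree.Node 0 [:: GenTree.Leaf n]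
  | TPar n => GenTree.Node 1 [:: GenTree.Leaf n]
  | TZero => GenTree.Node 2 [::]
  | TSucc t => GenTree.Node 3 [:: tm_code t]
  | TAdd t u => GenTree.Node 4 [:: tm_code t; tm_code u]
  | TMul t u => GenTree.Node 5 [:: tm_code t; tm_code u]
  end.

Lemma tm_code_inj : injective tm_code.
Proof.
elim=> [n|n||t IH|t IHt u IHu|t IHt u IHu] [n'|n'||t'|t' u'|t' u'] //=.
- by case=> ->.
- by case=> ->.
- by case=> /IH ->.
- by case=> /IHt -> /IHu ->.
- by case=> /IHt -> /IHu ->.
Qed.

Fixpoint fm_code (phi : fm void) : GenTree.tree nat :=
  match phi with
  | FEq t u => GenTree.Node 0 [:: tm_code t; tm_code u]
  | FP c _ => match c with end
  | FNeg phi => GenTree.Node 1 [:: fm_code phi]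
  | FAnd phi psi => GenTree.Node 2 [:: fm_code phi; fm_code psi]
  | FEx phi => GenTree.Node 3 [:: fm_code phi]
  end.

Lemma fm_code_inj : injective fm_code.
Proof.
elim=> [t u|[]|phi IH|phi IHp psi IHq|phi IH] [t' u'|[]|phi'|phi' psi'|phi'] //=.
- by case=> /tm_code_inj -> /tm_code_inj ->.
- by case=> /IH ->.
- by case=> /IHp -> /IHq ->.
- by case=> /IH ->.
Qed.

Lemma fm_enum : exists enum : nat -> fm void, forall phi, exists n, enum n = phi.
Proof.
have H n : exists phi, forall psi, pickle (fm_code psi) = n -> psi = phi.
  have [[phi e]|hn] := EM (exists phi, pickle (fm_code phi) = n); last first.
    by exists (FEq TZero TZero) => psi h; case: hn; exists psi.
  exists phi => psi; rewrite -e => /(pcan_inj pickleK); exact: fm_code_inj.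
have [f hf] := choice H; exists f => phi.
by exists (pickle (fm_code phi)); rewrite -(hf _ phi).
Qed.

Fixpoint pcode (N : arith) (m : nat) (E : nat -> N) : N :=
  if m is m'.+1 then cpair (E m') (pcode m' E) else azero.

(** All parameters of a formula are packed into a single element. This reduces the MacDowell and
    Specker construction to binary relations and lets Skolem functions take one argument. *)
Lemma code_formula m (chi : fm void) : exists psi : fm void, forall N, PA N -> forall (E : nat -> N) r G,
  ev (@nopred N) r (scons (pcode m E) G) psi <->
  ev (@nopred N) r (fun n => if n < m then E n else G (n - m)) chi.
Proof.
elim: m => [|m [psi IH]].
  exists (finst (fun n => TVar n.+1) TPar chi) => N hN E r G.
  by rewrite ev_inst; have -> : (fun n => G (n - 0)) = G by apply/funext => n; rewrite subn0.
pose t := TAdd (TMul (TAdd (TVar 1) (TVar 0)) (TAdd (TVar 1) (TVar 0))) (TVar 1).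
pose s n := if n is n'.+2 then TVar n'.+3 else TVar n.
exists (FEx (FEx (FAnd (FEq (TVar 2) t) (finst s TPar psi)))) => N hN E r G.
rewrite [pcode _ _]/=; set c := pcode m E.
have hc u c' : cpair (E m) c = cpair u c' ->
    (ev (@nopred N) r (scons c' (scons u (scons (cpair (E m) c) G))) (finst s TPar psi) <->
     ev (@nopred N) r (fun n => if n < m.+1 then E n else G (n - m.+1)) chi).
  move=> e; rewrite ev_inst.
  have -> : tev r (scons c' (scons u (scons (cpair (E m) c) G))) \o s = scons c' (scons u G).
    by apply/funext; case=> [|[|n]].
  case/(cpair_inj hN): e => <- <-; rewrite IH //.
  have -> // : (fun n => if n < m then E n else scons (E m) G (n - m)) =
    (fun n => if n < m.+1 then E n else G (n - m.+1)).
  apply/funext => n; have [h|h|<-] := ltngtP n m.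
  - by rewrite leqW.
  - by rewrite ltnS leqNgt h -(subnSK h).
  - by rewrite subnn ltnSn.
split=> /= [[u [c' [e]]]|h]; first by rewrite hc.
by exists (E m), c; split=> //; rewrite hc.
Qed.

Definition alternate (D : Type) (r e : nat -> D) n : D := if odd n then r n./2 else e n./2.

Lemma code_env (phi : fm void) : exists m (psi : fm void), forall N, PA N -> forall (r e : nat -> N) a,
  ev (@nopred N) (fun=> azero) (scons (pcode m (alternate r e)) (scons a (fun=> azero))) psi <->
  ev (@nopred N) r (scons a e) phi.
Proof.
(* The relevant values of [r] and [e], interleaved, all sit below [m]; the variable [m] is the first
   one beyond the packed values and stands for [a]. *)
pose m := (fbound phi).*2.+2.
pose chi := finst (fun n => if n is n'.+1 then TVar n'.*2 else TVar m) (fun n => TVar n.*2.+1) phi.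
have [psi h] := code_formula m chi; exists m, psi => N hN r e a.
rewrite h // ev_inst; apply: ev_agree => [//|n hn|[|n] hn]; rewrite /= /alternate /=.
- by rewrite /m !ltnS leq_double ltnW // odd_double /= uphalf_double.
- by rewrite ltnn subnn.
- by rewrite /m ltnS leqW ?odd_double ?doubleK // leq_double ltnW // ltnW.
Qed.

Ltac dfn_hyp := match goal with
  | h : PD _ (fun e => ?R (e 0)) |- Dfn _ _ (fun _ e => ?R _) =>
      refine (dfn_sub1 _ (R := fun _ => R) h _); [dfn_side|dt]
  | h : PD _ (fun e => ?R (e 0) (e 1)) |- Dfn _ _ (fun _ e => ?R _ _) =>
      refine (dfn_sub2 _ (R := fun _ => R) h _ _); [dfn_side|dt|dt]
  end.
Ltac dfn_named ::= first [dfn_lt_tac | dfn_hyp].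

Section MacDowellSpecker.
Variables (M : arith) (hPA : PA M).
Local Notation S := (@asucc M).
Local Notation "x < y" := (arith_lt x y) : pa_scope.
Local Notation "x + y" := (aadd x y) : pa_scope.
Local Open Scope pa_scope.
Local Notation PD0 := (PD (@nopred M)).

Definition unbounded (X : M -> Prop) : Prop := forall z, exists a, X a /\ z < a.

Section Cohesive.
Variables (X : M -> Prop) (phi : M -> M -> Prop).
Hypothesis hX : PD0 (fun e => X (e 0%N)).
Hypothesis hphi : PD0 (fun e => phi (e 0%N) (e 1%N)).
Hypothesis X_unb : unbounded X.

Definition agree a b y : Prop := forall y', y' < y -> (phi a y' <-> phi b y').

Definition often a y : Prop := forall z, exists b, [/\ X b, z < b, agree a b y & phi b y].

(* The elements of X that below y follow the greedy choice: phi(-, y') is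
   taken to be true whenever it remains so on an unbounded set. *)
Definition greedy y a : Prop := X a /\ forall y', y' < y -> (phi a y' <-> often a y').

(** [x] is the least element of [greedy y] not below [y], for some [y]. Taking one point from each
    level gives a definable diagonal intersection of the decreasing sets [greedy y]. *)
Definition thinned x : Prop := exists y, [/\ y < S x, greedy y x &
  forall x', greedy y x' -> x' < x -> x' < y].

Lemma pd_often : PD0 (fun e => often (e 0%N) (e 1%N)).
Proof. by rewrite /PD /often /agree; dfn. Qed.

Lemma pd_greedy : PD0 (fun e => greedy (e 0%N) (e 1%N)).
Proof. by have h := pd_often; rewrite /PD /greedy; dfn. Qed.

Lemma pd_thinned : PD0 (fun e => thinned (e 0%N)).
Proof. by have h := pd_greedy; rewrite /PD /thinned; dfn. Qed.

Lemma agree_often a b y : agree a b y -> (often a y <-> often b y).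
Proof.
move=> h; split=> ha z; have [c [h1 h2 h3 h4]] := ha z; exists c; split=> // y' hy.
  by rewrite -h // h3.
by rewrite h // h3.
Qed.

Lemma agree_sub a b y y' : agree a b y -> y' < S y -> agree a b y'.
Proof. by move=> h hy z hz; apply: h; apply: (lt_leS_trans hPA hz hy). Qed.

Lemma greedy_sub y y' a : greedy y a -> y' < S y -> greedy y' a.
Proof. by move=> [h1 h2] hy; split=> // z hz; apply: h2; apply: (lt_leS_trans hPA hz hy). Qed.

Lemma greedy_agree y a b : greedy y a -> greedy y b -> agree a b y.
Proof.
move=> [_ ha] [_ hb] y'; move: y'; apply: (pa_strong hPA) => [|y' IH hy].
  by rewrite /PD; dfn.
rewrite ha // hb //; apply: agree_often => z hz; apply: IH => //.
exact: (lt_trans hPA hz hy).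
Qed.

Lemma agree_greedy y a b : greedy y a -> X b -> agree a b y -> greedy y b.
Proof.
move=> [_ ha] hb h; split=> // y' hy; rewrite -h // ha //; apply: agree_often.
by apply: (agree_sub h); apply: (lt_trans hPA hy (ltxS hPA y)).
Qed.

Definition choice_at y : Prop := forall z, exists b, [/\ greedy y b, z < b & phi b y].

Lemma choice_often y a : greedy y a -> (often a y <-> choice_at y).
Proof.
move=> ha; split=> h z; have [b [h1 h2 h3]] := h z.
  by exists b; split=> //; apply: agree_greedy ha h1 h3.
by exists b; split=> //; [case: h1|apply: greedy_agree ha h1].
Qed.

Lemma greedy_phi y a : greedy (S y) a -> (phi a y <-> choice_at y).
Proof.
move=> ha; rewrite -(choice_often (a := a)); first by apply: ha.2; apply: ltxS.
by apply: (greedy_sub ha); apply: (lt_trans hPA (ltxS hPA y) (ltxS hPA _)).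
Qed.

Lemma greedyS y a : greedy y a -> (phi a y <-> choice_at y) -> greedy (S y) a.
Proof.
move=> ha h; split=> [|y' /(iffLR (ltxSP hPA _ _)) [hy|->]]; first by case: ha.
  exact: ha.2.
by rewrite h choice_often.
Qed.

(** Induction inside the model. If [phi(-, y)] holds unboundedly often on [greedy y], those elements
    remain; otherwise it fails on [greedy y] beyond some [z0], and that tail remains. *)
Lemma greedy_unbounded y : unbounded (greedy y).
Proof.
move: y; apply: (pa_rect hPA) => [|z|y IH z].
- by have h := pd_greedy; rewrite /PD /unbounded; dfn.
- have [a [h1 h2]] := X_unb z; exists a; split=> //; split=> // y /(ltx0 hPA) [].
- have [h|/existsNP [z0 h]] := EM (choice_at y).
    by have [b [h1 h2 h3]] := h z; exists b; split=> //; apply: greedyS.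
  have [b [h1 h2]] := IH (z + z0); exists b; split; last first.
    exact: (leS_lt_trans hPA (lt_add hPA z z0) h2).
  apply: greedyS => //; split=> hb; last by have [c hc] := hb z0; case: h; exists c.
  case: h; exists b; split=> //.
  exact: (leS_lt_trans hPA (lt_addr hPA z0 z) h2).
Qed.

Lemma thinned_unbounded : unbounded thinned.
Proof.
move=> z; have [|x [[h1 h2] h3]] := least hPA (Q := fun x => greedy (S z) x /\ z < x)
    (PA_IND hPA (U := @nopred M)) _ (greedy_unbounded (S z) z).
  by have h := pd_greedy; rewrite /PD; dfn.
exists x; split=> //; exists (S z); split=> //; first by rewrite -ltSx.
by move=> x' h4 /h3 h5; apply: contrapT => /(iffLR (nlt hPA _ _)) h6; apply: h5; split=> //; rewrite ltSx.
Qed.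

(** Let [a0] be an element of [greedy (S y0)] above [y0]. A thinned element beyond [a0] comes from a
    level above [y0]: at a level [y] up to [y0] it would be the least element of [greedy y] not
    below [y], but [a0] is a smaller one. So all these elements decide [phi(-, y0)] alike. *)
Lemma cohesive : exists X' : M -> Prop, [/\ PD0 (fun e => X' (e 0%N)), unbounded X',
  forall a, X' a -> X a &
  forall y, (exists z, forall a, X' a -> z < a -> phi a y) \/
            (exists z, forall a, X' a -> z < a -> ~ phi a y)].
Proof.
exists thinned; split; [exact: pd_thinned|exact: thinned_unbounded|by move=> a [y [_ [] ]]|].
move=> y0; have [a0 [h1 h2]] := greedy_unbounded (S y0) y0.
suff H a : thinned a -> a0 < a -> (phi a y0 <-> choice_at y0).
  have [h|h] := EM (choice_at y0); [left|right]; exists a0 => a ha ha0; first by apply/(H a).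
  by rewrite H.
move=> [y [h3 h4 h5]] ha; apply: greedy_phi; apply: (greedy_sub h4).
apply: contrapT => /(iffLR (nlt hPA _ _)) /(iffRL (ltSx hPA _ _)) h6.
have h7 := h5 a0 (greedy_sub h1 (lt_trans hPA h6 (ltxS hPA _))) ha.
exact: (ltxx hPA (lt_leS_trans hPA (lt_trans hPA h2 h7) h6)).
Qed.

End Cohesive.

Definition thick_set : Type :=
  {X : M -> Prop | PD0 (fun e => X (e 0%N)) /\ unbounded X}.

Lemma thick_setT : exists X : thick_set, forall a, sval X a.
Proof.
have h : PD0 (fun e => True) /\ unbounded (fun=> True).
  by split; [rewrite /PD; dfn|move=> z; exists (S z); split=> //; apply: ltxS].
by exists (exist _ (fun=> True) h).
Qed.

Lemma thin_out (X : thick_set) (psi : fm void) : exists X' : thick_set,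
  (forall a, sval X' a -> sval X a) /\
  forall c (Y := fun a => ev (@nopred M) (fun=> azero) (scons c (scons a (fun=> azero))) psi),
    (exists z, forall a, sval X' a -> z < a -> Y a) \/
    (exists z, forall a, sval X' a -> z < a -> ~ Y a).
Proof.
case: X => X [h1 h2] /=.
pose phi a c := ev (@nopred M) (fun=> azero) (scons c (scons a (fun=> azero))) psi.
have hphi : PD0 (fun e => phi (e 0%N) (e 1%N)).
  pose s n := if n is n'.+2 then TZero else if n is 1%N then TVar 0 else TVar 1.
  exists (finst s (fun=> TZero) psi), (fun _ _ => azero); split=> // x e; rewrite ev_inst.
  have -> // : tev (fun=> azero) e \o s = scons (e 1%N) (scons (e 0%N) (fun=> azero)).
  by apply/funext; case=> [|[|n]].
have [X' [h3 h4 h5 h6]] := cohesive h1 hphi h2.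
by exists (exist _ X' (conj h3 h4)).
Qed.

(** Each step settles one formula for all values of its parameter at once, so that the countably
    many formulas can be treated in turn. *)
Fixpoint thick (n : nat) : thick_set :=
  if n is n'.+1 then sval (cid (thin_out (thick n') (sval (cid fm_enum) n')))
  else sval (cid thick_setT).

Lemma thick_sub m n a : (m <= n)%N -> sval (thick n) a -> sval (thick m) a.
Proof.
elim: n => [|n IH]; first by rewrite leqn0 => /eqP ->.
rewrite leq_eqVlt ltnS => /orP [/eqP -> //|/IH {}IH] h; apply: IH.
exact: ((svalP (cid (thin_out (thick n) (sval (cid fm_enum) n)))).1 a h).
Qed.

(** A definable type, used as a quantifier: [Y] holds for almost all elements. On definable sets it
    behaves as an ultrafilter containing all final segments. *)
Definition V (Y : M -> Prop) : Prop := exists n z, forall a, sval (thick n) a -> z < a -> Y a.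

Lemma V_mono (Y Y' : M -> Prop) : (forall a, Y a -> Y' a) -> V Y -> V Y'.
Proof. by move=> h [n [z hz]]; exists n, z => a h1 h2; apply/h/hz. Qed.

Lemma V_and (Y Y' : M -> Prop) : V Y -> V Y' -> V (fun a => Y a /\ Y' a).
Proof.
move=> [n [z h]] [n' [z' h']]; exists (maxn n n'), (z + z') => a h1 h2; split.
  apply: h; first by apply: thick_sub h1; apply: leq_maxl.
  exact: (leS_lt_trans hPA (lt_add hPA z z') h2).
apply: h'; first by apply: thick_sub h1; apply: leq_maxr.
exact: (leS_lt_trans hPA (lt_addr hPA z' z) h2).
Qed.

Lemma V_false : ~ V (fun=> False).
Proof. by move=> [n [z h]]; have [_ hu] := svalP (thick n); have [a [/h]] := hu z. Qed.

Lemma V_gt z : V (fun a => z < a).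
Proof. by exists 0%N, z. Qed.

Lemma V_const (Q : Prop) : V (fun=> Q) <-> Q.
Proof.
split=> [h|h]; last by apply: V_mono (V_gt azero).
by apply: contrapT => hn; apply: V_false; apply: V_mono h.
Qed.

Lemma thick_decides (phi : fm void) : exists n, forall r e,
  (exists z, forall a, sval (thick n) a -> z < a -> ev (@nopred M) r (scons a e) phi) \/
  (exists z, forall a, sval (thick n) a -> z < a -> ~ ev (@nopred M) r (scons a e) phi).
Proof.
have [m [psi h]] := code_env phi; have [n hn] := svalP (cid fm_enum) psi.
exists n.+1 => r e; pose c := pcode m (alternate r e).
have hc a : _ <-> _ := h M hPA r e a.
have -> : thick n.+1 = sval (cid (thin_out (thick n) psi)) by rewrite /= hn.
have := (svalP (cid (thin_out (thick n) psi))).2 c.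
by case=> [[z hz]|[z hz]]; [left|right]; exists z => a h1 h2; rewrite -hc; apply: hz.
Qed.

Section DefinableQuantifier.
Variables (E : Type) (P : set (E -> M)).
Hypothesis P_const : forall c, P (fun=> c).
Variable R : E -> M -> (nat -> M) -> Prop.
Hypothesis hR : Dfn (N := fun=> M) (fun=> @nopred M) P (fun x e => R x (e 0%N) (fun n => e n.+1)).

Lemma V_decides x e : V (fun b => R x b e) \/ V (fun b => ~ R x b e).
Proof.
have [phi [r [hr h]]] := hR; have [n hn] := thick_decides phi.
have E1 b : R x b e <-> ev (@nopred M) (r^~ x) (scons b e) phi by exact: (h x (scons b e)).
case: (hn (r^~ x) e) => [[z hz]|[z hz]]; [left|right]; exists n, z => a h1 h2; rewrite E1;
  exact: hz.
Qed.

(** The number [n] from [thick_decides] depends on the formula and not on its parameters, so [V]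
    amounts to eventual truth on the one definable set [thick n]. Definability is what allows the
    quantifier to be iterated. *)
Lemma dfn_V : Dfn (N := fun=> M) (fun=> @nopred M) P (fun x e => V (fun b => R x b e)).
Proof.
have [phi [r [hr h]]] := hR; have [n hn] := thick_decides phi.
have [[theta [r' [_ hX]]] _] := svalP (thick n).
have E1 x b e : R x b e <-> ev (@nopred M) (r^~ x) (scons b e) phi by exact: (h x (scons b e)).
have E2 a : sval (thick n) a <-> ev (@nopred M) (r'^~ tt) (scons a (fun=> azero)) theta.
  exact: (hX tt (scons a (fun=> azero))).
apply: (dfn_ext (R := fun x e => exists z, forall a, sval (thick n) a -> z < a -> R x a e)).
  move=> x e; split=> [[z hz]|hV]; first by exists n, z.
  case: (hn (r^~ x) e) => [[z hz]|[z hz]]; first by exists z => a h1 h2; apply/E1/hz.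
  case: V_false; have [n' [z' h']] := hV; exists (maxn n n'), (z + z') => a h1 h2.
  apply: (hz a).
  - by apply: thick_sub h1; apply: leq_maxl.
  - exact: (leS_lt_trans hPA (lt_add hPA z z') h2).
  apply/E1/h'; first by apply: thick_sub h1; apply: leq_maxr.
  exact: (leS_lt_trans hPA (lt_addr hPA z' z) h2).
have h1 : Dfn (N := fun=> M) (fun=> @nopred M) P (fun x e => sval (thick n) (e 0%N)).
  pose s n := if n is 0%N then TVar 0 else TZero.
  exists (finst s TPar theta), (fun k _ => r' k tt); split=> // x e; rewrite ev_inst E2.
  by have -> // : tev (r'^~ tt) e \o s = scons (e 0%N) (fun=> azero) by apply/funext; case.
apply: dfn_ex; apply: dfn_all; apply: dfn_imp => //; last apply: dfn_imp.
- by have P0 := P_const azero; dfn.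
exact: (dfn_ren (scons 0%N (fun n => n.+2)) hR).
Qed.

End DefinableQuantifier.

(** The least [y] with [f < y] almost everywhere is a successor, and almost everywhere [f] equals
    its predecessor. The least number principle applies because [V] is definable. *)
Lemma V_regressive (E : Type) (P : set (E -> M)) (f : E -> M -> M) (c : M) x :
  (forall c, P (fun=> c)) ->
  Dfn (N := fun=> M) (fun=> @nopred M) P (fun x e => f x (e 0%N) = e 1%N) ->
  V (fun b => f x b < c) -> exists y, V (fun b => f x b = y).
Proof.
move=> hc hf hV; have P0 := hc azero.
pose Q y := V (fun b => f x b < y).
have h1 : Dfn (N := fun=> M) (fun=> @nopred M) P (fun x e => f x (e 0%N) < e 1%N).
  apply: (dfn_ext (R := fun x e => exists y, f x (e 0%N) = y /\ y < e 1%N)).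
    by move=> x' e; split=> [[y [-> ]]|h] //; eexists; split; [reflexivity|].
  apply: dfn_ex; apply: dfn_and => //; last by dfn.
  exact: (dfn_ren (scons 1%N (scons 0%N (fun n => n.+3))) hf).
have hQ : PD0 (fun e => Q (e 0%N)).
  have [phi [r [hr h]]] := dfn_V (R := fun x b e => f x b < e 0%N) hc h1.
  by exists phi, (fun n _ => r n x); split=> // -[] e; exact: (h x e).
have [y [hy1 hy2]] := least hPA (PA_IND hPA) hQ (ex_intro _ c hV).
have [ey|[y' ey]] := zero_or_succ hPA y.
  by case: V_false; apply: V_mono hy1 => b; rewrite ey => /(ltx0 hPA).
exists y'; have hy' : y' < y by rewrite ey; apply: ltxS.
case: (V_decides (R := fun x b e => f x b < e 0%N) h1 x (fun=> y')) => h2; first by case: (hy2 _ hy').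
by apply: V_mono (V_and hy1 h2) => b [] ; rewrite ey => /(iffLR (ltxSP hPA _ _)) [].
Qed.

End MacDowellSpecker.

(** * The iterated ultrapower along I *)

Section Base.
Variable I0 : Type.
Local Notation I := {classic I0}.
Variables (lt : rel I) (hI : good_order lt) (i_0 : I).
Local Notation G := (Aut lt).
Variables (M : arith) (hPA : PA M).
Local Notation E := (I0 -> M).
Local Notation V := (V hPA).

Definition coord (i : I) : E -> M := fun x => x i.

Definition params : set (E -> M) :=
  [set f | (exists i, f = coord i) \/ exists c, f = fun=> c].

Lemma params_const c : params (fun=> c).
Proof. by right; exists c. Qed.

Let P0 : params (fun=> azero) := params_const azero.

Local Notation DE := (Dfn (N := fun _ : E => M) (fun=> @nopred M) params).

Definition setc (x : E) (i : I) b : E := fun j => if (j : I) == i then b else x j.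

Lemma dfn_setc (R : E -> (nat -> M) -> Prop) i :
  DE R -> DE (fun x e => R (setc x i (e 0)) (fun n => e n.+1)).
Proof.
move=> [phi [r [hr h]]].
(* The parameters that read the coordinate [i] become the new variable; the others do not notice the
   change of coordinate. *)
pose sp n := if `[< r n = coord i >] then TVar 0 else TPar n.
exists (finst (fun n => TVar n.+1) sp phi), r; split=> // x e; rewrite h ev_inst.
suff -> : tev (r^~ x) e \o sp = (r^~ (setc x i (e 0))) by [].
apply/funext => n; rewrite /= /sp; case: asboolP => [->|hn] /=; first by rewrite /coord /setc eqxx.
case: (hr n) => [[j ej]|[c ->]] //; rewrite ej /coord /setc; case: eqP => // eji.
by case: hn; rewrite ej eji.
Qed.

(** Iterated quantification, with the head of [J] outermost. For increasing [J] a later coordinate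
    is chosen after the earlier ones and exceeds almost surely anything defined from them. *)
Fixpoint Qs (J : seq I) (R : E -> Prop) (x : E) : Prop :=
  if J is i :: J' then V (fun b => Qs J' R (setc x i b)) else R x.

Lemma Qs_mono J (R R' : E -> Prop) x : (forall x, R x -> R' x) -> Qs J R x -> Qs J R' x.
Proof. by move=> h; elim: J x => [|i J IH] x /=; [exact: h|apply: V_mono => b; apply: IH]. Qed.

Lemma Qs_and J (R R' : E -> Prop) x : Qs J R x -> Qs J R' x -> Qs J (fun x => R x /\ R' x) x.
Proof.
elim: J x => [|i J IH] x //= h h'.
by apply: V_mono (V_and h h') => b []; apply: IH.
Qed.

Lemma Qs_const J (Q : Prop) x : Qs J (fun=> Q) x <-> Q.
Proof.
elim: J x => [|i J IH] x //=; rewrite -[X in _ <-> X](V_const hPA).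
by split; apply: V_mono => b; apply IH.
Qed.

Lemma Qs_all J (R : E -> Prop) x : (forall x, R x) -> Qs J R x.
Proof. by move=> h; apply: Qs_mono (iffRL (Qs_const J True x) Logic.I) => y _; apply: h. Qed.

Lemma Qs_cat J J' R x : Qs (J ++ J') R x = Qs J (Qs J' R) x.
Proof. by elim: J x => [|i J IH] x //=; congr (V _); apply/funext => b. Qed.

Lemma dfn_Qs J R : DE R -> DE (fun x e => Qs J (R^~ e) x).
Proof.
move=> hR; elim: J => [//|i J IH] /=.
exact: (dfn_V hPA (R := fun x b e => Qs J (R^~ e) (setc x i b)) params_const (dfn_setc i IH)).
Qed.

Lemma Qs_decides J R e : DE R -> forall x, Qs J (R^~ e) x \/ Qs J (fun x => ~ R x e) x.
Proof.
move=> hR; elim: J => [|i J IH] x /=; first exact: EM.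
have := V_decides hPA (R := fun x b e => Qs J (R^~ e) (setc x i b)) (dfn_setc i (dfn_Qs J hR)) x e.
case=> h; [by left|right].
by apply: V_mono h => b hb; case: (IH (setc x i b)).
Qed.

Definition depends (K : I -> Prop) (R : E -> Prop) : Prop :=
  forall x x', (forall i, K i -> x i = x' i) -> R x -> R x'.

Lemma depends_sub (K K' : I -> Prop) R : (forall i, K i -> K' i) -> depends K R -> depends K' R.
Proof. by move=> hK h x x' hx; apply: h => i /hK; apply: hx. Qed.

Lemma Qs_depends J K R : depends (fun i => i \in J \/ K i) R -> depends K (Qs J R).
Proof.
elim: J K => [|i J IH] K h; first by apply: depends_sub h => i [].
move=> x x' hx /=; apply: V_mono => b.
apply: (IH (fun j => K j \/ j = i)) => [|j [hj|->]]; last 2 first.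
- by rewrite /setc; case: eqP => // _; apply: hx.
- by rewrite /setc eqxx.
apply: depends_sub h => j [|]; last by right; left.
by rewrite inE => /orP [/eqP ->|hj]; [right; right|left].
Qed.

Lemma sorted_sub i J J0 : sorted lt (i :: J) -> sorted lt J0 -> {subset J0 <= i :: J} ->
  (i \notin J0 /\ {subset J0 <= J}) \/
  exists J1, [/\ J0 = i :: J1, sorted lt J1 & {subset J1 <= J}].
Proof.
have tr := lt_tr hI; rewrite !(sorted_pairwise tr) /= => /andP [/allP h1 h2] h3 h4.
have [hi|hi] := boolP (i \in J0); [right|left]; last first.
  split=> // j hj; have := h4 j hj; rewrite inE => /orP [/eqP e|//].
  by rewrite e (negbTE hi) in hj.
case: J0 h3 h4 hi => [//|j J1] /= /andP [/allP h5 h6] h4 hi; exists J1.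
have e : j = i.
  have := h4 j; rewrite !inE eqxx => /(_ isT) /orP [/eqP //|/h1 hij].
  move: hi; rewrite inE => /orP [/eqP //|/h5 hji].
  by have := tr _ _ _ hij hji; rewrite (lt_irr hI).
subst j; split=> //; first by rewrite (sorted_pairwise tr).
move=> j hj; have := h4 j; rewrite !inE hj orbT => /(_ isT) /orP [/eqP e|//].
by have := h5 j hj; rewrite e (lt_irr hI).
Qed.

(** A quantifier over a coordinate on which [R] does not depend has no effect, by [V_const]. *)
Lemma Qs_extend J J0 K R x : sorted lt J -> sorted lt J0 -> {subset J0 <= J} ->
  depends (fun i => i \in J0 \/ K i) R -> (forall i, K i -> i \notin J) ->
  Qs J R x <-> Qs J0 R x.
Proof.
elim: J J0 K x => [|i J IH] J0 K x hJ hJ0 hsub hR hK.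
  by case: J0 hJ0 hsub {hR} => [//|j J0] _ /(_ j); rewrite inE eqxx => /(_ isT).
have hJ' : sorted lt J by apply: path_sorted hJ.
have [[hi hs]|[J1 [e hJ1 hs]]] := sorted_sub hJ hJ0 hsub.
  have hK' j : K j -> j \notin J by move/hK; rewrite inE negb_or => /andP [].
  have hiK : ~ K i by move/hK; rewrite inE eqxx.
  have IH' b := IH J0 K (setc x i b) hJ' hJ0 hs hR hK'.
  have E1 b : Qs J0 R (setc x i b) <-> Qs J0 R x.
    by split; apply: (Qs_depends hR) => j hj; rewrite /setc; case: eqP => // e; subst j.
  rewrite /= -[X in _ <-> X](V_const hPA).
  by split; apply: V_mono => b; rewrite IH' E1.
subst J0; have hiJ : i \notin J.
  apply/negP => h; move: hJ; rewrite (sorted_pairwise (lt_tr hI)) /= => /andP [/allP /(_ i h)].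
  by rewrite (lt_irr hI).
have IH' b := IH J1 (fun j => K j \/ j = i) (setc x i b) hJ' hJ1 hs.
split; apply: V_mono => b; apply IH'.
- by apply: depends_sub hR => j; rewrite inE => -[/orP [/eqP ->|]|]; auto.
- by move=> j [/hK|-> //]; rewrite inE negb_or => /andP [].
- by apply: depends_sub hR => j; rewrite inE => -[/orP [/eqP ->|]|]; auto.
- by move=> j [/hK|-> //]; rewrite inE negb_or => /andP [].
Qed.

(** Truth under the iterated quantifiers of every sufficiently large finite set of indices. For a
    relation with finite support, one set containing the support decides ([ae_Qs]). *)
Definition ae : set_system E :=
  [set R | exists J0 : seq I, forall J, sorted lt J -> {subset J0 <= J} -> forall x, Qs J R x].

Lemma ae_proper : ProperFilter ae.
Proof.
split.
  move=> [J0 h]; have [J [h1 h2]] := sorted_exists hI J0.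
  apply/(Qs_const J False (fun=> azero)); apply: h => // j; by rewrite h2.
split; first by exists [::] => J _ _ x; apply: Qs_all.
- move=> R R' [J0 h] [J0' h']; exists (J0 ++ J0') => J hJ hs x; apply: Qs_and.
    by apply: h => // j hj; apply: hs; rewrite mem_cat hj.
  by apply: h' => // j hj; apply: hs; rewrite mem_cat hj orbT.
- by move=> R R' hR [J0 h]; exists J0 => J h1 h2 x; apply: Qs_mono (h J h1 h2 x).
Qed.
#[local] Existing Instance ae_proper.

Lemma ae_Qs J R x : sorted lt J -> depends (fun i => i \in J) R -> (ae R <-> Qs J R x).
Proof.
move=> hJ hR; have hR' K : depends (fun i => i \in J \/ K i) R.
  by apply: depends_sub hR => i; left.
split=> [[J0 h]|h].
  have [J' [h1 h2]] := sorted_exists hI (J0 ++ J).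
  apply/(@Qs_extend J' J (fun=> False)) => //; first by move=> j hj; rewrite h2 mem_cat hj orbT.
  by apply: h => // j hj; rewrite h2 mem_cat hj.
exists J => J' h1 h2 y; apply/(@Qs_extend J' J (fun=> False)) => //.
by apply: (Qs_depends (K := fun=> False)) h.
Qed.

Definition deff : set (E -> M) := [set f | DE (fun x e => f x = e 0)].

Lemma deff_params f : params f -> deff f.
Proof. by move=> h; apply: dfn_eq; [exact: dt_par|exact: dt_var]. Qed.

Lemma dfn_deff R : Dfn (N := fun _ : E => M) (fun=> @nopred M) deff R -> DE R.
Proof. exact: dfn_reparam. Qed.

Lemma deff0 : deff (fun=> azero).
Proof. exact: deff_params. Qed.

Lemma deffS f : deff f -> deff (fun x => asucc (f x)).
Proof.
by move=> h; apply/dfn_deff/dfn_eq; [apply/dt_succ/dt_par|apply/dt_var/deff0].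
Qed.

Lemma deffA f f' : deff f -> deff f' -> deff (fun x => aadd (f x) (f' x)).
Proof.
by move=> h h'; apply/dfn_deff/dfn_eq; [apply/dt_add; apply/dt_par|apply/dt_var/deff0].
Qed.

Lemma deffM f f' : deff f -> deff f' -> deff (fun x => amul (f x) (f' x)).
Proof.
by move=> h h'; apply/dfn_deff/dfn_eq; [apply/dt_mul; apply/dt_par|apply/dt_var/deff0].
Qed.

Lemma dfn_support R : DE R -> exists J : seq I, forall e, depends (fun i => i \in J) (R^~ e).
Proof.
move=> [phi [r [hr h]]].
suff [J hJ] : exists J : seq I, forall n, n < fbound phi -> forall x x',
    (forall i, i \in J -> x i = x' i) -> r n x = r n x'.
  exists J => e x x' hx; rewrite !h.
  by apply: (iffLR (ev_agree _ _ _)) => // n hn; apply: hJ hx.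
elim: (fbound phi) => [|m [J hJ]]; first by exists [::].
case: (hr m) => [[i e]|[c e]]; last first.
  exists J => n; rewrite ltnS leq_eqVlt => /orP [/eqP ->|hn] x x' hx; first by rewrite e.
  exact: hJ hx.
exists (i :: J) => n; rewrite ltnS leq_eqVlt => /orP [/eqP ->|hn] x x' hx.
  by rewrite e; apply: hx; rewrite inE eqxx.
by apply: hJ => // j hj; apply: hx; rewrite inE hj orbT.
Qed.

Definition supp_on (J : seq I) (f : E -> M) : Prop :=
  forall x x', (forall i, i \in J -> x i = x' i) -> f x = f x'.

Lemma deff_supp f : deff f -> exists J, sorted lt J /\ supp_on J f.
Proof.
move=> /dfn_support [J hJ]; have [J' [h1 h2]] := sorted_exists hI J; exists J'; split=> // x x' hx.
by apply/esym/(hJ (fun=> f x) x x') => // i hi; apply: hx; rewrite h2.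
Qed.

Lemma ae_decides (R : E -> Prop) : DE (fun x _ => R x) -> ae R \/ ae (~` R).
Proof.
move=> hR; have [J0 h] := dfn_support hR; have [J [h1 h2]] := sorted_exists hI J0.
have h3 : depends (fun i => i \in J) R.
  by apply: depends_sub (h (fun=> azero)) => i; rewrite h2.
case: (Qs_decides J (fun=> azero) hR (fun=> azero)) => hx; [left|right].
  exact: (iffRL (ae_Qs _ h1 h3) hx).
apply: (iffRL (ae_Qs _ h1 _) hx) => x x' hxx hn hx'; apply: hn; apply: h3 hx' => i hi.
exact/esym/hxx.
Qed.

(** The least element is chosen, or zero if there is none. The choice depends on the set [Y x]
    alone, so its support is no larger than that of [Y], which [shrink_support] relies on. *)
Lemma definable_choice (Y : E -> M -> Prop) : DE (fun x e => Y x (e 0)) ->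
  exists f, [/\ deff f, forall x, (exists y, Y x y) -> Y x (f x) &
    forall x x', (forall y, Y x y <-> Y x' y) -> f x = f x'].
Proof.
move=> hY.
pose Z x y := (Y x y /\ forall z, arith_lt z y -> ~ Y x z) \/ (~ (exists z, Y x z) /\ y = azero).
have hZ : DE (fun x e => Z x (e 0)).
  have h1 : DE (fun x e => Y x (e 1)) by exact: (dfn_ren (fun n => n.+1) hY).
  apply: dfn_or; apply: dfn_and => //.
  - apply: dfn_all; apply: dfn_imp; last exact: dfn_not.
    by refine (dfn_sub2 _ (R := fun x => @arith_lt _) (dfn_lt _ _) _ _);
      [exact: P0|exact: P0|exact: dt_var|exact: dt_var].
  - by apply: dfn_not; apply: dfn_ex.
  - by apply: dfn_eq; [exact: dt_var|exact: dt_zero].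
have Zex x : exists y, Z x y.
  have [hex|hex] := EM (exists y, Y x y); last by exists azero; right.
  have [|y hy] := least hPA (Q := Y x) (PA_IND hPA (U := @nopred M)) _ hex; last by exists y; left.
  by have [phi [r [hr h]]] := hY; exists phi, (fun n _ => r n x); split=> // _ e; exact: (h x e).
have Zfun x x' y y' : (forall z, Y x z <-> Y x' z) -> Z x y -> Z x' y' -> y = y'.
  move=> hxx [[h1 h2]|[h1 ->]] [[h3 h4]|[h3 ->]] //.
  - case: (lt_total hPA y y') => [h|[//|h]]; first by case: (h4 _ h); apply/hxx.
    by case: (h2 _ h); apply/hxx.
  - by case: h3; exists y; apply/hxx.
  - by case: h1; exists y'; apply/hxx.
have [f hf] := choice Zex; exists f; split=> [|x hx|x x' hxx].
- apply: dfn_ext hZ => x e; split=> [h|<- //]; exact: (Zfun x x _ _ _ (hf x) h).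
- by case: (hf x) => [[]|[]].
- exact: (Zfun x x' _ _ hxx (hf x) (hf x')).
Qed.

Local Notation fam := (fam (N := fun _ : E => M) deff).
Local Notation B := (RP ae deff0 deffS deffA deffM).
Definition bcl (f : fam) : B := cls ae f.

Lemma dfn_fam (phi : fm void) (r e : nat -> fam) :
  DE (fun x e' => ev (@nopred M) (fenv r x) (scons (e' 0) (fenv e x)) phi).
Proof.
by apply: dfn_deff; apply: (@dfn_inst E (fun=> M) _ _ _ phi (fun n => sval (r n)) (fun n => sval (e n))) => n;
  exact: svalP.
Qed.

Lemma base_decided phi (r e : nat -> fam) :
  ae [set x | ev (@nopred M) (fenv r x) (fenv e x) phi] \/
  ae [set x | ~ ev (@nopred M) (fenv r x) (fenv e x) phi].
Proof.
apply: ae_decides; apply: dfn_ext (dfn_fam (finst (fun n => TVar n.+1) TPar phi) r e) => x e'.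
by rewrite ev_inst.
Qed.

Lemma base_witness phi (r e : nat -> fam) : exists f : fam, ae [set x |
  (exists y, ev (@nopred M) (fenv r x) (scons y (fenv e x)) phi) ->
  ev (@nopred M) (fenv r x) (scons (sval f x) (fenv e x)) phi].
Proof.
pose Y x y := ev (@nopred M) (fenv r x) (scons y (fenv e x)) phi.
have [f [h1 h2 _]] := definable_choice (Y := Y) (dfn_fam phi r e).
by exists (exist _ f h1); apply: filterS filterT => x _; apply: h2.
Qed.

Lemma base_los phi (r e : nat -> fam) :
  @ev B void (@nopred B) (bcl \o r) (bcl \o e) phi <->
  ae [set x | ev (@nopred M) (fenv r x) (fenv e x) phi].
Proof.
exact: (@los E (fun=> M) ae _ deff _ _ _ _ void (fun=> @nopred M) (@nopred B)
  base_decided base_witness (fun c => match c with end)).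
Qed.

Lemma base_los_ud (R : forall N : arith, (void -> N -> Prop) -> (nat -> N) -> Prop) (e : nat -> fam) :
  UD R -> (R B (@nopred B) (bcl \o e) <-> ae [set x | R M (@nopred M) (fenv e x)]).
Proof.
exact: (@los_ud E (fun=> M) ae _ deff _ _ _ _ void (fun=> @nopred M) (@nopred B)
  base_decided base_witness (fun c => match c with end)).
Qed.

Lemma base_lt (f f' : fam) : arith_lt (bcl f) (bcl f') <-> ae [set x | arith_lt (sval f x) (sval f' x)].
Proof. exact: (base_los_ud (env2 f f') (@ud_lt void)). Qed.

Lemma bclP (f f' : fam) : bcl f = bcl f' <-> ae [set x | sval f x = sval f' x].
Proof. exact: clsP. Qed.

Lemma bcl_surj (z : B) : exists f, z = bcl f.
Proof. exact: rp_surj. Qed.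

Lemma ae_all (R : set E) : (forall x, R x) -> ae R.
Proof. by move=> h; apply: filterS filterT => x _; apply: h. Qed.

Definition base_d (i : I) : B := bcl (exist _ _ (deff_params (or_introl (ex_intro _ i erefl)))).
Definition base_c (c : M) : B := bcl (exist _ _ (deff_params (params_const c))).

Lemma deff_act (g : G) f : deff f -> deff (fun x => f (x \o g)).
Proof.
move=> [phi [r [hr h]]]; exists phi, (fun n x => r n (x \o g)).
split=> [n|x e]; last exact: (h (x \o g) e).
by case: (hr n) => [[i ->]|[c ->]]; [left; exists (g i)|right; exists c].
Qed.

Definition bact_fam (g : G) (f : fam) : fam := exist _ _ (deff_act g (svalP f)).
Definition base_act (g : G) (z : B) : B := bcl (bact_fam g (rep z)).

Lemma Qs_act (g : G) J R x : Qs J (fun x => R (x \o g)) x <-> Qs (map (autV g) J) R (x \o g).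
Proof.
elim: J x => [//|i J IH] x /=.
have E1 b : setc x i b \o g = setc (x \o g) (autV g i) b.
  by apply/funext => j; rewrite /setc /= (can2_eq (autK g) (autVK g)).
by split; apply: V_mono => b; rewrite IH E1.
Qed.

(** Automorphisms keep increasing lists of indices increasing, so they merely rename the coordinates
    of iterated quantifiers that all use the same [V]. *)
Lemma ae_act (g : G) (R : E -> Prop) : ae R -> ae [set x : E | R (x \o g)].
Proof.
move=> [J0 h]; exists (map g J0) => J h1 h2 x; apply/Qs_act; apply: h.
  by rewrite sorted_map (eq_sorted (e' := lt)) // => i j /=; exact: (autM (autI g)).
move=> i hi; apply/mapP; exists (g i); last by rewrite autK.
by apply: h2; apply: map_f.
Qed.

Lemma base_actE g f : base_act g (bcl f) = bcl (bact_fam g f).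
Proof.
have h : ae [set x | sval (rep (bcl f)) x = sval f x] by apply/bclP; exact: repK.
by apply/bclP; exact: ae_act h.
Qed.

Lemma base_act_c g c : base_act g (base_c c) = base_c c.
Proof. by rewrite base_actE; apply/bclP; apply: ae_all. Qed.

Lemma base_act_d g i : base_act g (base_d i) = base_d (g i).
Proof. by rewrite base_actE; apply/bclP; apply: ae_all. Qed.

Lemma bclS f : asucc (bcl f) = bcl (famS deffS f).
Proof. exact: clsS. Qed.

Lemma bclA f f' : aadd (bcl f) (bcl f') = bcl (famA deffA f f').
Proof. exact: clsA. Qed.

Lemma bclM f f' : amul (bcl f) (bcl f') = bcl (famM deffM f f').
Proof. exact: clsM. Qed.

Lemma base_c0 : base_c azero = azero.
Proof. by apply/bclP; apply: ae_all. Qed.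

Lemma base_act0 g : base_act g azero = azero.
Proof. by rewrite -base_c0 base_act_c. Qed.

Lemma base_actS g z : base_act g (asucc z) = asucc (base_act g z).
Proof.
have [f ->] := bcl_surj z; rewrite bclS !base_actE bclS.
by apply/bclP; apply: ae_all.
Qed.

Lemma base_actA g z w : base_act g (aadd z w) = aadd (base_act g z) (base_act g w).
Proof.
have [f ->] := bcl_surj z; have [f' ->] := bcl_surj w; rewrite bclA !base_actE bclA.
by apply/bclP; apply: ae_all.
Qed.

Lemma base_actM g z w : base_act g (amul z w) = amul (base_act g z) (base_act g w).
Proof.
have [f ->] := bcl_surj z; have [f' ->] := bcl_surj w; rewrite bclM !base_actE bclM.
by apply/bclP; apply: ae_all.
Qed.

Lemma base_act1 z : base_act (aut1 lt) z = z.
Proof. by have [f ->] := bcl_surj z; rewrite base_actE; apply/bclP; apply: ae_all. Qed.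

Lemma base_actC g h z : base_act (autC g h) z = base_act g (base_act h z).
Proof. by have [f ->] := bcl_surj z; rewrite !base_actE; apply/bclP; apply: ae_all. Qed.

Lemma base_supp z : exists J : seq I, forall g : G, fixes g J -> base_act g z = z.
Proof.
have [f ->] := bcl_surj z; have [J [_ hJ]] := deff_supp (svalP f); exists J => g hg.
rewrite base_actE; apply/bclP; apply: ae_all => x /=; apply: hJ => i /hg /= e.
by rewrite e.
Qed.

Lemma sorted_rcons (J : seq I) (i : I) : sorted lt (rcons J i) <-> sorted lt J /\ forall j, j \in J -> lt j i.
Proof.
rewrite !(sorted_pairwise (lt_tr hI)) pairwise_rcons.
by split=> [/andP [/allP h1 h2]|[h1 h2]] //; apply/andP; split=> //; apply/allP.
Qed.

Lemma setc_out (J : seq I) x i b : (forall j : I, j \in J -> lt j i) -> forall j : I, j \in J -> setc x i b j = x j.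
Proof.
move=> h j /h hj; rewrite /setc; case: eqP => // e; subst j.
by move: hj; rewrite (lt_irr hI).
Qed.

Lemma base_d_lt i j : lt i j -> arith_lt (base_d i) (base_d j).
Proof.
move=> hij; apply/base_lt => /=.
have h1 : sorted lt [:: i; j] by rewrite /= hij.
apply: (iffRL (ae_Qs (J := [:: i; j]) (fun=> azero) h1 _)).
  by move=> x x2 hx; rewrite /mkset /coord (hx i) ?(hx j) // !inE eqxx ?orbT.
have hji : i != j by apply: contraTneq hij => ->; rewrite (lt_irr hI).
apply: V_mono (V_gt hPA azero) => b _ /=.
apply: V_mono (V_gt hPA b) => b' hb.
by rewrite /coord /setc !eqxx (negbTE hji).
Qed.

Lemma supp_on_lt J f i : supp_on J f -> depends (fun j => j \in rcons J i) (fun x => arith_lt (f x) (x i)).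
Proof.
move=> h x x' hx; rewrite (h x x') => [|j hj]; last by apply: hx; rewrite mem_rcons inE hj orbT.
by rewrite (hx i) // mem_rcons inE eqxx.
Qed.

(** Take [i] above the support of a family for [z]. Then the quantifier for [i] is innermost, the
    family is constant under it, and almost all values exceed a constant. *)
Lemma base_cof z : exists i, arith_lt z (base_d i).
Proof.
have [f ->] := bcl_surj z; have [J [h1 h2]] := deff_supp (svalP f).
have [i0 hi0] : exists i0, forall j, j \in J -> ile lt j i0.
  case: J {h1 h2} => [|j0 J]; first by exists i_0.
  exact: (upper_bound_seq hI j0).
have [i hi] := lt_max hI i0; exists i.
have hJi j : j \in J -> lt j i by move=> /hi0 hj; exact: (ile_lt_trans (lt_tr hI) hj hi).
apply/base_lt => /=; have h3 : sorted lt (rcons J i) by apply/sorted_rcons.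
apply: (iffRL (ae_Qs (J := rcons J i) (fun=> azero) h3 (supp_on_lt (i := i) h2))).
rewrite -cats1 Qs_cat; apply: Qs_all => x /=.
apply: V_mono (V_gt hPA (sval f x)) => b hb.
by rewrite (h2 _ x (setc_out x b hJi)) /setc eqxx.
Qed.

(* Coordinates above i are removed from the top, where f is regressive and hence
   constant modulo V. *)
Lemma shrink_support (i : I) J f : sorted lt J -> deff f -> supp_on J f ->
  ae [set x | arith_lt (f x) (x i)] ->
  exists f' J', [/\ deff f', supp_on J' f', forall j, j \in J' -> ile lt j i &
    ae [set x | f x = f' x]].
Proof.
elim/last_ind: J f => [|J j IH] f hJ hf hs hlt.
  by exists f, [::]; split=> //; apply: ae_all.
have [h1 h2] := iffLR (sorted_rcons J j) hJ.
have [hji|hij] := orP (ile_tot hI j i).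
  exists f, (rcons J j); split=> //; last exact: ae_all.
  move=> k; rewrite mem_rcons inE => /orP [/eqP -> //|/h2 hk].
  by rewrite /ile (lt_ile_trans (lt_tr hI) hk hji) orbT.
pose Y x y := V (fun b => f (setc x j b) = y).
have hY : DE (fun x e => Y x (e 0)).
  apply: (dfn_V hPA (R := fun x b e => f (setc x j b) = e 0) params_const).
  exact: (dfn_setc j hf).
have [f1 [k1 k2 k3]] := definable_choice hY.
have s1 : supp_on J f1.
  move=> x x' hx; apply: k3 => y; rewrite /Y.
  suff -> : (fun b => f (setc x j b) = y) = (fun b => f (setc x' j b) = y) by [].
  apply/funext => b; rewrite (hs _ (setc x' j b)) // => k; rewrite mem_rcons inE /setc.
  by case: eqP => //= _; apply: hx.
have hff : ae [set x | f x = f1 x].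
  (* Both [J] and [i] lie below [j], so that the quantifier for [j] can be made innermost, with the
     bound [x i] fixed. *)
  have [L [l1 l2]] := sorted_exists hI (i :: J).
  have hL k : k \in L -> lt k j by rewrite l2 inE => /orP [/eqP -> //|/h2].
  have hLj : sorted lt (rcons L j) by apply/sorted_rcons.
  have sub k : k \in rcons J j -> k \in rcons L j.
    rewrite !mem_rcons !inE => /orP [->//|hk]; by rewrite l2 inE hk !orbT.
  have d1 : depends (fun k => k \in rcons L j) (fun x => arith_lt (f x) (x i)).
    apply: depends_sub (supp_on_lt (i := i) hs) => k; rewrite mem_rcons inE => /orP [/eqP ->|/sub //].
    by rewrite mem_rcons inE l2 inE eqxx orbT.
  have d2 : depends (fun k => k \in rcons L j) (fun x => f x = f1 x).
    move=> x x' hx; rewrite (hs x x') => [|k /sub]; last exact: hx.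
    by rewrite (s1 x x') // => k hk; apply/hx/sub; rewrite mem_rcons inE hk orbT.
  apply: (iffRL (ae_Qs (fun=> azero) hLj d2)).
  have := iffLR (ae_Qs (fun=> azero) hLj d1) hlt.
  rewrite -cats1 !Qs_cat; apply: Qs_mono => x /= hV.
  have hV' : V (fun b => arith_lt (f (setc x j b)) (x i)).
    apply: V_mono hV => b; rewrite {2}/setc; case: eqP => // e.
    by move: hij; rewrite e (lt_irr hI).
  have hYx := k2 x (V_regressive (f := fun x b => f (setc x j b)) params_const (dfn_setc j hf) hV').
  by apply: V_mono hYx => b ->; apply: s1 => k hk; rewrite (setc_out x b h2).
have hlt1 : ae [set x | arith_lt (f1 x) (x i)].
  by apply: filterS (filterI hff hlt) => x [/= ->].
have [f' [J' [q1 q2 q3 q4]]] := IH f1 h1 k1 s1 hlt1.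
exists f', J'; split=> //.
by apply: filterS (filterI hff q4) => x [/= -> ->].
Qed.

Lemma base_fix (g : G) (i : I) z : arith_lt z (base_d i) ->
  (forall j, ile lt j i -> g j = j) -> base_act g z = z.
Proof.
have [f ->] := bcl_surj z; move=> /base_lt hlt hg.
have [J [h1 h2]] := deff_supp (svalP f).
have [f' [J' [q1 q2 q3 q4]]] := shrink_support h1 (svalP f) h2 hlt.
have -> : bcl f = bcl (exist _ f' q1) by apply/bclP.
rewrite base_actE; apply/bclP; apply: ae_all => x /=; apply: q2 => j /q3 /hg /= e.
by rewrite e.
Qed.

Lemma base_ax : PAax B.
Proof. by apply: RP_PAax => _; exact: PA_ax. Qed.

Lemma base_IND : IND (pieces (fun _ : B => False)).
Proof.
have h : @IND B void (@nopred B).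
  apply: (@RP_IND E (fun=> M) ae _ deff _ _ _ _ void (fun=> @nopred M) (@nopred B)
    base_decided base_witness) => [[]|_]; exact: PA_IND.
apply: IND_subst h _ => c.
apply: (dfn_ext (R := fun _ _ => False)); first by move=> _ e; split=> // -[].
exact: dfn_false.
Qed.

Definition base_stage : stage lt.
Proof.
refine (@Stage I lt B base_act base_d (fun=> False) (fun=> False)
  base_ax base_IND base_act0 base_actS base_actA base_actM base_act1 base_actC base_act_d
  base_d_lt base_cof base_fix base_supp _ _ _ _ _ _) => //.
Defined.

Lemma base_elem (phi : fm void) (r e : nat -> M) :
  ev (@nopred M) r e phi <-> @ev B void (@nopred B) (base_c \o r) (base_c \o e) phi.
Proof.
pose k c : fam := exist _ _ (deff_params (params_const c)).
rewrite (base_los phi (k \o r) (k \o e)); split=> [h|[J h]]; first exact: ae_all.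
have [J' [h1 h2]] := sorted_exists hI J.
apply: (iffLR (Qs_const J' _ (fun=> azero))); apply: h => // j hj; by rewrite h2.
Qed.

End Base.

Ltac dfn_named ::= first [dfn_pieces | dfn_syntax].
(** * Least witnesses *)

Section LeastWitness.
Variable N : arith.

Definition is_least (Y : N -> Prop) y : Prop := Y y /\ forall z, arith_lt z y -> ~ Y z.

(** Total by the default value zero, which elementary maps preserve; so the images of least
    witnesses are least witnesses even in the degenerate case ([lmin_elem]). *)
Definition lmin (Y : N -> Prop) : N :=
  if pselect (exists y, is_least Y y) is left h then sval (cid h) else azero.

Lemma lminP Y : (exists y, is_least Y y) -> is_least Y (lmin Y).
Proof. by rewrite /lmin; case: pselect => // h _; case: cid. Qed.

Lemma lmin_none Y : ~ (exists y, is_least Y y) -> lmin Y = azero.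
Proof. by rewrite /lmin; case: pselect. Qed.

Hypothesis hPA : PA N.

Lemma lmin_uniq Y y : is_least Y y -> lmin Y = y.
Proof.
move=> [h1 h2]; have [h3 h4] := lminP (ex_intro _ y (conj h1 h2)).
case: (lt_total hPA (lmin Y) y) => [h|[//|h]]; first by case: (h2 _ h).
by case: (h4 _ h).
Qed.

Lemma lmin_eq x : lmin (fun y => y = x) = x.
Proof. by apply: lmin_uniq; split=> // z h e; subst z; exact: ltxx hPA _ h. Qed.

Lemma pd_ev C (U : C -> N -> Prop) r e phi : PD U (fun e' => ev U r (scons (e' 0) e) phi).
Proof. exact: (@dfn_inst unit (fun=> N) C (fun=> U) setT phi (fun n _ => r n) (fun n _ => e n)). Qed.

Lemma least_ev C (U : C -> N -> Prop) r e phi : IND U ->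
  (exists y, ev U r (scons y e) phi) -> exists y, is_least (fun y => ev U r (scons y e) phi) y.
Proof.
by move=> hU; apply: (least hPA (Q := fun y => ev U r (scons y e) phi) hU); exact: pd_ev.
Qed.

End LeastWitness.

Definition least_fm C (phi : fm C) : fm C :=
  FAnd phi (FNeg (FEx (FAnd (FEx (FEq (TAdd (TVar 1) (TSucc (TVar 0))) (TVar 2)))
    (finst (fun n => if n is n'.+1 then TVar n'.+2 else TVar 0) TPar phi)))).

Lemma least_fmP (N : arith) C (U : C -> N -> Prop) r e phi y :
  ev U r (scons y e) (least_fm phi) <-> is_least (fun y => ev U r (scons y e) phi) y.
Proof.
rewrite /least_fm /is_least /=.
have E z : ev U r (scons z (scons y e)) (finst (fun n => if n is n'.+1 then TVar n'.+2 else TVar 0)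
    TPar phi) <-> ev U r (scons z e) phi.
  rewrite ev_inst; pose s n := if n is n'.+1 then TVar n'.+2 else TVar 0.
  by have -> // : tev r (scons z (scons y e)) \o s = scons z e by apply/funext; case.
split=> -[h1 h2]; split=> //.
  by move=> z hz hzp; apply: h2; exists z; split=> //; apply/E.
by move=> [z [hz /E hp]]; exact: h2 z hz hp.
Qed.

Lemma lmin_elem (N N' : arith) (f : N -> N') C (U : C -> N -> Prop) (U' : C -> N' -> Prop) :
  PA N' -> f azero = azero ->
  (forall phi r e, ev U r e phi <-> ev U' (f \o r) (f \o e) phi) ->
  forall phi r e, f (lmin (fun y => ev U r (scons y e) phi)) =
    lmin (fun y => ev U' (f \o r) (scons y (f \o e)) phi).
Proof.
move=> hPA f0 hf phi r e.
have sc y : f \o scons y e = scons (f y) (f \o e) by apply/funext; case.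
have [[y hy]|hn] := EM (exists y, is_least (fun y => ev U r (scons y e) phi) y).
  apply/esym/lmin_uniq => //; have := lminP (ex_intro _ y hy).
  by rewrite -!least_fmP -sc hf.
rewrite (lmin_none hn) f0 lmin_none // => -[y hy]; apply: hn.
have : ev U' (f \o r) (f \o e) (FEx (least_fm phi)) by exists y; apply/least_fmP.
by rewrite -hf /= => -[z /least_fmP hz]; exists z.
Qed.

Lemma lmin_ext (N : arith) (Y Y' : N -> Prop) : (forall y, Y y <-> Y' y) -> lmin Y = lmin Y'.
Proof. by move=> h; congr lmin; apply/funext => y; apply/propext. Qed.

Definition instance (N : arith) (p q : N) : Prop := Sent p /\
  exists i r x t, [/\ p = cEx i r, Numeral x t & Subst1 i t r q].

Definition true_instance (N : arith) (T : N -> Prop) p q : Prop := instance p q /\ T q.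

Lemma ud_instance C : @UD C (fun N _ e => instance (e 1) (e 0)).
Proof. by apply: ud_dfn; rewrite /instance; dfn. Qed.

Lemma ud_true_instance : @UD unit (fun N U e => true_instance (U tt) (e 1) (e 0)).
Proof. by apply: ud_dfn; rewrite /true_instance /instance; dfn. Qed.

Lemma instance_near (N : arith) (hPA : PA N) (p q k : N) :
  instance p q -> Skel p k -> nearby k q.
Proof.
move=> [hS [i [r [x [t [e h1 h2]]]]]]; subst p => /(Skel_ex hPA) [l [ek hl]]; subst k.
exists l; split; first exact: Subst1_Skel hPA _ _ _ _ _ h2 hl.
by right; do 3!right; exists i.
Qed.

(** The lexicographic order is pulled back along [h]. Below a point there are countably many first
    components, each with countably many second ones. *)
Lemma card_aleph1_lex (W : Type) (R : rel W) (D : Type) (h : D -> W * nat) :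
  well_order R -> (forall w, countable [set v | R v w]) ->
  injective h -> ~ countable [set: D] -> card_aleph1 D.
Proof.
move=> hR hc h_inj hD; split=> //.
pose r x : {classic W} := (h x).1.
pose S x y := (R (r x) (r y) && (r x != r y)) || ((r x == r y) && ((h x).2 <= (h y).2)).
exists S; split; last first.
  move=> x; move/countable_injP: (hc (r x)) => [f hf]; apply/countable_injP.
  have SR y : S y x -> R (r y) (r x).
    by case/orP=> [/andP []|/andP [/eqP -> _]] //; exact: (@wo_refl {classic W} R hR).
  exists (fun y => pickle (f (r y), (h y).2)) => y z; rewrite !inE => hy hz.
  move=> /(pcan_inj pickleK) [e1 e2]; apply: h_inj; rewrite (surjective_pairing (h y)) e2.
  rewrite (surjective_pairing (h z)) /=; congr pair.
  by apply: hf e1; rewrite inE; exact: SR.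
apply: antisymmetric_well_order => [x y /andP [/orP h1 /orP h2]|A [x hx]].
  have exy : r x = r y.
    case: h1 => [/andP [h1 h1']|/andP [/eqP -> //]].
    by case: h2 => [/andP [h2 _]|/andP [/eqP -> //]]; exact: (@wo_anti {classic W} R hR).
  apply: h_inj; rewrite (surjective_pairing (h x)) (surjective_pairing (h y)).
  congr pair; first exact: exy.
  move: h1 h2; rewrite exy eqxx /= !andbF => -[//|h1] [//|h2].
  by apply/eqP; rewrite eqn_leq h1 h2.
have [|w] := @wo_min3 {classic W} R hR [pred w | `[< exists2 y, y \in A & r y = w >]] (r x).
  by apply/asboolP; exists x.
move=> /asboolP [y hy ey] hw.
have [m hm hmin] := ex_minnP (P := fun m => `[< exists z, [/\ z \in A, r z = w & (h z).2 = m] >])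
  (ex_intro _ (h y).2 (asboolT (ex_intro _ y (And3 hy ey erefl)))).
move/asboolP: hm => [z [hz ez em]]; exists z; split=> // z' hz'.
rewrite /S; have [e|hne] := eqVneq (r z) (r z'); rewrite ?andbF ?andbT /= ?orbF.
  by rewrite em; apply: hmin; apply/asboolP; exists z'; rewrite -e.
by rewrite ez; apply: hw; apply/asboolP; exists z'.
Qed.

(** * The limit of a chain, formed by Skolem terms *)

Section Limit.
Variables (I : eqType) (lt : rel I) (hI : good_order lt) (M : arith).
Local Notation G := (Aut lt).
Variable S : nat -> stage lt.
Variable j : forall n, S n -> S n.+1.
Variable c : forall n, M -> S n.
Hypothesis j_elem : forall n phi (r e : nat -> S n),
  ev (@nopred _) r e phi <-> ev (@nopred _) (@j n \o r) (@j n \o e) phi.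
Hypothesis j_piece : forall n (k : S n) phi (r e : nat -> S n), st_A k ->
  ev (fun _ : unit => pieces (@st_T _ _ (S n)) k) r e phi <->
  ev (fun _ : unit => pieces (@st_T _ _ (S n.+1)) (j k)) (@j n \o r) (@j n \o e) phi.
Hypothesis j_T : forall n (p k : S n), Skel p k -> st_A k -> (st_T (j p) <-> st_T p).
Hypothesis j_A : forall n (k : S n), st_A (j k).
Hypothesis j_d : forall n i, j (st_d (S n) i) = st_d (S n.+1) i.
Hypothesis c_elem : forall n phi (r e : nat -> M),
  ev (@nopred _) r e phi <-> ev (@nopred _) (c n \o r) (c n \o e) phi.
Hypothesis c_act : forall n (g : G) m, act g (c n m) = c n m.
Hypothesis c_j : forall n m, j (c n m) = c n.+1 m.

Let PAS n : PA (S n) := st_PA (S n).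

Lemma j_ud n (R : forall N : arith, (void -> N -> Prop) -> (nat -> N) -> Prop) (e : nat -> S n) :
  UD R -> R (S n) (@nopred _) e <-> R (S n.+1) (@nopred _) (@j n \o e).
Proof. by move=> [phi h]; rewrite (h _ _ e) j_elem -h. Qed.

Lemma j0 n : j (azero : S n) = azero.
Proof.
have := j_elem (FEq (TVar 0) TZero) (fun=> azero : S n) (fun=> azero : S n).
by move=> /= [h _]; apply: h.
Qed.

Lemma j_add n (x y : S n) : j (aadd x y) = aadd (j x) (j y).
Proof.
have := j_elem (FEq (TVar 0) (TAdd (TVar 1) (TVar 2))) (fun=> azero : S n)
  (scons (aadd x y) (scons x (fun=> y))).
by move=> /= [h _]; apply: h.
Qed.

Lemma j_mul n (x y : S n) : j (amul x y) = amul (j x) (j y).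
Proof.
have := j_elem (FEq (TVar 0) (TMul (TVar 1) (TVar 2))) (fun=> azero : S n)
  (scons (amul x y) (scons x (fun=> y))).
by move=> /= [h _]; apply: h.
Qed.

Lemma j_cpair n (x y : S n) : j (cpair x y) = cpair (j x) (j y).
Proof. by rewrite /cpair !(j_add, j_mul). Qed.

Lemma c0 n : c n azero = azero.
Proof.
have := c_elem n (FEq (TVar 0) TZero) (fun=> azero) (fun=> azero).
by move=> /= [h _]; apply: h.
Qed.

Lemma j_Sent n (p : S n) : Sent p <-> Sent (j p).
Proof. exact: (j_ud (fun=> p) (@ud_Sent void)). Qed.

Lemma j_Skel n (p k : S n) : Skel p k <-> Skel (j p) (j k).
Proof. exact: (j_ud (env2 p k) (@ud_Skel void)). Qed.

Definition settled n (p : S n) : Prop := exists k, Skel p k /\ st_A k.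

Lemma settledS n (p : S n) : Sent p -> settled (j p).
Proof.
move=> [hF _]; have [k hk] := Form_Skel (PAS n) hF.
by exists (j k); split; [exact: (iffLR (j_Skel p k) hk)|exact: j_A].
Qed.

(** ** Skolem terms *)

(** One argument is enough for [HMin], because pairing packs several arguments into one ([code_env],
    [skolem]). *)
Inductive hterm : Type :=
| HM of M
| HI of I
| HPair of hterm & hterm
| HMin of nat & hterm
| HTr of hterm.

Definition enum_fm : nat -> fm void := sval (cid fm_enum).

Fixpoint hval n (t : hterm) : S n :=
  match t with
  | HM m => c n m
  | HI i => st_d (S n) i
  | HPair t u => cpair (hval n t) (hval n u)
  | HMin k t => lmin (fun y => ev (@nopred _) (fun=> azero)
      (scons (hval n t) (scons y (fun=> azero))) (enum_fm k))
  | HTr t => lmin (true_instance (@st_T _ _ (S n)) (hval n t))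
  end.

Fixpoint hmove (g : I -> I) (t : hterm) : hterm :=
  match t with
  | HM m => HM m
  | HI i => HI (g i)
  | HPair t u => HPair (hmove g t) (hmove g u)
  | HMin k t => HMin k (hmove g t)
  | HTr t => HTr (hmove g t)
  end.

Definition swap_fm (phi : fm void) : fm void :=
  finst (fun n => match n with 0 => TVar 1 | 1 => TVar 0 | n'.+2 => TVar n end) TPar phi.

Lemma swap_fmP (N : arith) (x y : N) r e phi :
  ev (@nopred N) r (scons x (scons y e)) (swap_fm phi) <->
  ev (@nopred N) r (scons y (scons x e)) phi.
Proof.
rewrite ev_inst; pose s n := match n with 0 => TVar 1 | 1 => TVar 0 | n'.+2 => TVar n end.
by have -> // : tev r (scons x (scons y e)) \o s = scons y (scons x e)
  by apply/funext; case=> [|[|n]].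
Qed.

Lemma lmin_swap (N N' : arith) (f : N -> N') :
  PA N' -> f azero = azero ->
  (forall phi r e, ev (@nopred N) r e phi <-> ev (@nopred N') (f \o r) (f \o e) phi) ->
  forall phi x, f (lmin (fun y => ev (@nopred N) (fun=> azero) (scons x (scons y (fun=> azero))) phi)) =
    lmin (fun y => ev (@nopred N') (fun=> azero) (scons (f x) (scons y (fun=> azero))) phi).
Proof.
move=> h1 h2 h3 phi x.
have E1 : f \o (fun=> azero) = (fun=> azero) :> (nat -> N') by apply/funext.
have E2 : f \o scons x (fun=> azero) = scons (f x) (fun=> azero) by apply/funext; case.
have := lmin_elem h1 h2 h3 (swap_fm phi) (fun=> azero) (scons x (fun=> azero)).
rewrite E1 E2 => h; rewrite (lmin_ext (Y' := fun y => ev (@nopred N) (fun=> azero)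
  (scons y (scons x (fun=> azero))) (swap_fm phi))) ?h => [|y]; last by rewrite swap_fmP.
by apply: lmin_ext => y; rewrite swap_fmP.
Qed.

Lemma lmin_true_instance (N N' : arith) (f : N -> N') (T : N -> Prop) (T' : N' -> Prop) :
  PA N' -> f azero = azero ->
  (forall phi r e, ev (fun _ : unit => T) r e phi <-> ev (fun _ : unit => T') (f \o r) (f \o e) phi) ->
  forall p, f (lmin (true_instance T p)) = lmin (true_instance T' (f p)).
Proof.
move=> h1 h2 h3 p; have [phi hphi] := ud_true_instance.
have E1 : f \o (fun=> azero) = (fun=> azero) :> (nat -> N') by apply/funext.
have := lmin_elem h1 h2 h3 phi (fun=> azero) (fun=> p); rewrite E1 => h.
rewrite (lmin_ext (Y' := fun y => ev (fun _ : unit => T) (fun=> azero) (scons y (fun=> p)) phi)).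
  rewrite h; apply: lmin_ext => y.
  exact: (iff_sym (hphi N' (fun=> T') (fun=> azero) (scons y (fun=> f p)))).
move=> y; exact: (hphi N (fun=> T) (fun=> azero) (scons y (fun=> p))).
Qed.

Lemma act_elem n (g : G) C (U U' : C -> S n -> Prop) phi r e :
  (forall a x, U a x <-> U' a (act g x)) ->
  ev U r e phi <-> ev U' (act g \o r) (act g \o e) phi.
Proof.
move=> h; apply: ev_iso => //; [exact: act0|exact: actS|exact: actA|exact: actM|exact: act_inj|].
by move=> y; exists (act (autI g) y); rewrite actVK.
Qed.

Lemma hval_move n (g : G) t : hval n (hmove g t) = act g (hval n t).
Proof.
elim: t => [m|i|t IHt u IHu|k t IH|t IH] /=.
- by rewrite c_act.
- by rewrite actd.
- by rewrite IHt IHu act_cpair.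
- rewrite IH; apply/esym/lmin_swap => //; first exact: act0.
  by move=> phi r e; apply: act_elem.
- rewrite IH; apply/esym/lmin_true_instance => //; first exact: act0.
  by move=> phi r e; apply: act_elem => _ x; apply: actT_iff.
Qed.

(** Only from some stage on: the value of [HTr t] may change until the skeleton of the sentence [t]
    has entered [st_A]. *)
Definition coherent (f : forall n, S n) : Prop :=
  exists m, forall n, m <= n -> f n.+1 = j (f n).

Lemma true_instance_near n (p k : S n) : Skel p k -> forall q,
  true_instance (@st_T _ _ (S n)) p q <-> true_instance (pieces (@st_T _ _ (S n)) k) p q.
Proof.
move=> hk q; split=> [[h1 h2]|[h1 [_ h2]]]; last exact: (conj h1 h2).
exact: (conj h1 (conj (instance_near (PAS n) h1 hk) h2)).
Qed.

Lemma hval_coherent t : coherent (hval^~ t).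
Proof.
elim: t => [m|i|t [N1 h1] u [N2 h2]|k t [N1 h1]|t [N1 h1]].
- by exists 0 => n _ /=; rewrite c_j.
- by exists 0 => n _ /=; rewrite j_d.
- exists (maxn N1 N2) => n hn /=; rewrite h1 ?h2 ?j_cpair //.
    by apply: leq_trans hn; apply: leq_maxr.
  by apply: leq_trans hn; apply: leq_maxl.
- exists N1 => n hn /=; rewrite h1 //; apply/esym/lmin_swap => //; exact: j0.
exists N1.+1 => n hn /=; rewrite h1; last exact: ltnW.
have [hS|hS] := EM (Sent (hval n t)); last first.
  rewrite !lmin_none ?j0 // => -[q [[[h _] _] _]]; apply: hS => //.
  exact: (iffRL (j_Sent _) h).
(* The value at stage [n + 1] is the image of a sentence of stage [n]. So its skeleton lies in
   [st_A], and the embedding is elementary for the piece of truth at it. *)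
case: n hn hS => // n; rewrite ltnS => hn; rewrite h1 // -j_Sent => /settledS [k [hk hA]].
rewrite (lmin_ext (true_instance_near hk)).
rewrite (lmin_ext (true_instance_near (iffLR (j_Skel _ _) hk))).
apply/esym/lmin_true_instance => //; first exact: j0.
by move=> phi r e; apply: j_piece.
Qed.

Fixpoint tcode m (E : nat -> hterm) : hterm :=
  if m is m'.+1 then HPair (E m') (tcode m' E) else HM azero.

Lemma hval_tcode n m E : hval n (tcode m E) = pcode m (hval n \o E).
Proof. by elim: m => [|m IH] /=; rewrite ?c0 ?IH. Qed.

Lemma skolem phi (r e : nat -> hterm) : exists t, forall n, hval n t =
  lmin (fun y => ev (@nopred _) (hval n \o r) (scons y (hval n \o e)) phi).
Proof.
have [m [psi h]] := code_env phi; have [k hk] := svalP (cid fm_enum) psi.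
exists (HMin k (tcode m (alternate r e))) => n /=; rewrite /enum_fm hk hval_tcode.
have -> : hval n \o alternate r e = alternate (hval n \o r) (hval n \o e) :> (nat -> S n).
  by apply/funext => i; rewrite /alternate /=; case: ifP.
by apply: lmin_ext => y; rewrite h.
Qed.

Definition hull : set (forall n, S n) := [set f | exists t, f = hval^~ t].

Lemma hull_fam t : hull (hval^~ t).
Proof. by exists t. Qed.

Lemma hull_eq u (e : nat -> hterm) (f : forall n, S n) :
  (forall n, tev (fun=> azero) (hval n \o e) u = f n) -> hull f.
Proof.
move=> h; have [t ht] := skolem (FEq (TVar 0) (tshift u)) (fun=> HM azero) e.
exists t; apply: functional_extensionality_dep => n; rewrite ht -h.
have -> : hval n \o (fun=> HM azero) = (fun=> azero) :> (nat -> S n).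
  by apply/funext => i /=; rewrite c0.
rewrite -[LHS](lmin_eq (PAS n)); apply: lmin_ext => y /=; by rewrite tev_shift.
Qed.

Lemma hull0 : hull (fun=> azero).
Proof. exact: (@hull_eq TZero (fun=> HM azero)). Qed.

Lemma hullS f : hull f -> hull (fun n => asucc (f n)).
Proof. by move=> [t ->]; apply: (@hull_eq (TSucc (TVar 0)) (fun=> t)). Qed.

Lemma hullA f f' : hull f -> hull f' -> hull (fun n => aadd (f n) (f' n)).
Proof.
by move=> [t ->] [t' ->]; apply: (@hull_eq (TAdd (TVar 0) (TVar 1)) (scons t (fun=> t'))).
Qed.

Lemma hullM f f' : hull f -> hull f' -> hull (fun n => amul (f n) (f' n)).
Proof.
by move=> [t ->] [t' ->]; apply: (@hull_eq (TMul (TVar 0) (TVar 1)) (scons t (fun=> t'))).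
Qed.

(** Modulo the cofinite filter, eventually coherent sections form a direct limit. Keeping only the
    values of Skolem terms gives the hull, which is still elementary. *)
Definition late : set_system nat := [set Y | exists m, forall n, m <= n -> Y n].

Lemma late_proper : ProperFilter late.
Proof.
split; first by move=> [m /(_ m (leqnn m))].
split; first by exists 0.
- move=> Y Z [m hm] [m' hm']; exists (maxn m m') => n; rewrite geq_max => /andP [h h'].
  by split; [apply: hm|apply: hm'].
- by move=> Y Z hYZ [m hm]; exists m => n /hm; apply: hYZ.
Qed.
#[local] Existing Instance late_proper.

Lemma late_all (Y : set nat) : (forall n, Y n) -> late Y.
Proof. by exists 0. Qed.

Lemma late_not (Y : set nat) : late (~` Y) -> ~ late Y.
Proof.
move=> h h'; apply: (@filter_not_empty _ late).
by apply: filterS (filterI h h') => n [].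
Qed.

Lemma late_stable (Y : set nat) m : (forall n, m <= n -> (Y n.+1 <-> Y n)) ->
  late Y \/ late (~` Y).
Proof.
move=> h; have E n : Y (m + n) <-> Y m.
  by elim: n => [|n IH]; rewrite ?addn0 // addnS h ?leq_addr.
have [hY|hY] := EM (Y m); [left|right]; exists m => n hn; rewrite -(subnKC hn).
  by apply/E.
by move=> /E.
Qed.

Local Notation fam := (fam (N := fun n => S n : arith) hull).
Local Notation L := (RP late hull0 hullS hullA hullM).
Definition lcl (f : fam) : L := cls late f.

Lemma lclP (f f' : fam) : lcl f = lcl f' <-> late [set n | sval f n = sval f' n].
Proof. exact: clsP. Qed.

Lemma lcl_surj (z : L) : exists f, z = lcl f.
Proof. exact: rp_surj. Qed.

Definition hfam (t : hterm) : fam := exist _ _ (hull_fam t).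

Lemma fam_coherent (f : fam) : coherent (sval f).
Proof. by case: f => f /= [t ->]; exact: hval_coherent. Qed.

Lemma fams_coherent (e : nat -> fam) b : exists m, forall n, m <= n ->
  forall i, i < b -> sval (e i) n.+1 = j (sval (e i) n).
Proof.
elim: b => [|b [m hm]]; first by exists 0.
have [m' hm'] := fam_coherent (e b); exists (maxn m m') => n; rewrite geq_max => /andP [h h'] i.
by rewrite ltnS leq_eqVlt => /orP [/eqP ->|]; [exact: hm'|exact: hm].
Qed.

Lemma limit_decided phi (r e : nat -> fam) :
  late [set n | ev (@nopred _) (fenv r n) (fenv e n) phi] \/
  late [set n | ~ ev (@nopred _) (fenv r n) (fenv e n) phi].
Proof.
have [m hm] := fams_coherent r (fbound phi); have [m' hm'] := fams_coherent e (fbound phi).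
apply: (@late_stable _ (maxn m m')) => n; rewrite geq_max => /andP [h h'] /=.
rewrite (j_elem phi (fenv r n)); apply: ev_agree => // i hi; first exact: hm.
exact: hm'.
Qed.

Lemma limit_witness phi (r e : nat -> fam) : exists f : fam, late [set n |
  (exists y, ev (@nopred _) (fenv r n) (scons y (fenv e n)) phi) ->
  ev (@nopred _) (fenv r n) (scons (sval f n) (fenv e n)) phi].
Proof.
have [r' hr] := choice (fun i => svalP (r i)); have [e' he] := choice (fun i => svalP (e i)).
have [t ht] := skolem phi r' e'; exists (hfam t); apply: late_all => n /= hex.
have Er : fenv r n = hval n \o r' by apply/funext => i; rewrite /fenv hr.
have Ee : fenv e n = hval n \o e' by apply/funext => i; rewrite /fenv he.
rewrite ht Er Ee; rewrite Er Ee in hex.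
have hI0 : IND (@nopred (S n)) by exact: PA_IND (PAS n).
have := least_ev (PAS n) hI0 hex.
by case/lminP.
Qed.

Lemma limit_los phi (r e : nat -> fam) : @ev L void (@nopred L) (lcl \o r) (lcl \o e) phi <->
  late [set n | ev (@nopred _) (fenv r n) (fenv e n) phi].
Proof.
exact: (@los nat (fun n => S n) late _ hull _ _ _ _ void (fun n => @nopred (S n)) (@nopred L)
  limit_decided limit_witness (fun a => match a with end)).
Qed.

Lemma limit_los_ud (R : forall N : arith, (void -> N -> Prop) -> (nat -> N) -> Prop) (e : nat -> fam) :
  UD R -> (R L (@nopred L) (lcl \o e) <-> late [set n | R (S n) (@nopred _) (fenv e n)]).
Proof.
exact: (@los_ud nat (fun n => S n) late _ hull _ _ _ _ void (fun n => @nopred (S n)) (@nopred L)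
  limit_decided limit_witness (fun a => match a with end)).
Qed.

Lemma limit_PA : PA L.
Proof.
have h : @IND L void (@nopred L).
  apply: (@RP_IND nat (fun n => S n) late _ hull _ _ _ _ void (fun n => @nopred (S n)) (@nopred L)
    limit_decided limit_witness (fun a => match a with end)).
  by move=> n; exact: PA_IND (PAS n).
by apply: IND_PA h; apply: RP_PAax => n; exact: st_ax.
Qed.

Definition limit_T (z : L) : Prop := exists f, z = lcl f /\ late [set n | st_T (sval f n)].

Lemma limit_TE f : limit_T (lcl f) <-> late [set n | st_T (sval f n)].
Proof.
split=> [[f' [/lclP e h]]|h]; last by exists f.
by apply: filterS (filterI e h) => n /= [->].
Qed.

Lemma late_settled f : Sent (lcl f) -> late [set n | settled (sval f n)].
Proof.
move=> /(limit_los_ud (fun=> f) (@ud_Sent void)) [m hm].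
have [m' hm'] := fam_coherent f; exists (maxn m m').+1 => -[//|n].
rewrite ltnS geq_max => /andP [h h'] /=; rewrite hm' //; apply: settledS; exact: hm.
Qed.

Lemma limit_T_decided f : Sent (lcl f) ->
  late [set n | st_T (sval f n)] \/ late [set n | ~ st_T (sval f n)].
Proof.
move=> /late_settled [m hm]; have [m' hm'] := fam_coherent f.
apply: (@late_stable _ (maxn m m')) => n; rewrite geq_max => /andP [h h'] /=.
have [k [h1 h2]] := hm n h; rewrite hm' //; exact: j_T h1 h2.
Qed.

Lemma limit_T_Sent z : limit_T z -> Sent z.
Proof.
have [f ->] := lcl_surj z; rewrite limit_TE => h.
apply: (iffRL (limit_los_ud (fun=> f) (@ud_Sent void))).
apply: filterS h => n /= hT; have [k [h1 h2]] := st_TA hT.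
by have [] := iffLR (st_Phi h1 h2) hT.
Qed.

Lemma limit_reg z w : Eqv z w -> limit_T z -> limit_T w.
Proof.
have [f ->] := lcl_surj z; have [f' ->] := lcl_surj w.
move=> /(limit_los_ud (env2 f f') (@ud_Eqv void)) h1; rewrite !limit_TE => h2.
by apply: filterS (filterI h1 h2) => n /= [/st_reg]; apply.
Qed.

Lemma late_iff (Y Z : set nat) : late [set n | Y n <-> Z n] -> (late Y <-> late Z).
Proof. by move=> h; split=> h'; apply: filterS (filterI h h') => n [/= h1 h2]; apply/h1. Qed.

Lemma settled_Phi n (p : S n) : settled p -> (st_T p <-> Phi (@st_T _ _ (S n)) p).
Proof. by move=> [k [h1 h2]]; exact: st_Phi h1 h2. Qed.

Lemma limit_Phi f : Sent (lcl f) -> late [set n | st_T (sval f n) <-> Phi (@st_T _ _ (S n)) (sval f n)].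
Proof. by move=> /late_settled h; apply: filterS h => n /= /settled_Phi. Qed.

Lemma ud_cEq C : @UD C (fun N _ e => [/\ e 0 = cEq (e 1) (e 2), ClTerm (e 1) & ClTerm (e 2)]).
Proof. by apply: ud_dfn; dfn. Qed.

Lemma ud_values C : @UD C (fun N _ e => exists x, Value (e 0) x /\ Value (e 1) x).
Proof. by apply: ud_dfn; dfn. Qed.

Lemma ud_cNeg C : @UD C (fun N _ e => e 0 = cNeg (e 1) /\ Sent (e 1)).
Proof. by apply: ud_dfn; dfn. Qed.

Lemma ud_cAnd C : @UD C (fun N _ e => [/\ e 0 = cAnd (e 1) (e 2), Sent (e 1) & Sent (e 2)]).
Proof. by apply: ud_dfn; dfn. Qed.

Lemma ud_cEx C : @UD C (fun N _ e => e 0 = cEx (e 1) (e 2) /\ Form1 (e 1) (e 2)).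
Proof. by apply: ud_dfn; dfn. Qed.

Lemma ud_inst C : @UD C (fun N _ e => Numeral (e 0) (e 1) /\ Subst1 (e 2) (e 1) (e 3) (e 4)).
Proof. by apply: ud_dfn; dfn. Qed.

(** All instances of [p] belong to the piece at its skeleton, and that piece satisfies induction;
    hence a least true instance exists although the full truth predicate need not satisfy
    induction. *)
Lemma lmin_instance n (p : S n) : settled p -> (exists q, true_instance (@st_T _ _ (S n)) p q) ->
  true_instance (@st_T _ _ (S n)) p (lmin (true_instance (@st_T _ _ (S n)) p)).
Proof.
move=> [k [hk hA]] [q0 /(true_instance_near hk) hq0].
have h1 : IND (fun _ : unit => pieces (@st_T _ _ (S n)) k).
  apply: IND_subst (@st_ind _ _ (S n)) _ => _.
  by apply: dfn_pred; apply: dt_var.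
have [phi hphi] := ud_true_instance.
have E y : true_instance (pieces (@st_T _ _ (S n)) k) p y <->
    ev (fun _ : unit => pieces (@st_T _ _ (S n)) k) (fun=> p) (scons y (fun=> p)) phi.
  exact: (hphi (S n) (fun=> pieces (@st_T _ _ (S n)) k) (fun=> p) (scons y (fun=> p))).
have hex : exists y, ev (fun _ : unit => pieces (@st_T _ _ (S n)) k) (fun=> p) (scons y (fun=> p)) phi.
  by exists q0; apply/E.
have [h2 _] := lminP (least_ev (PAS n) h1 hex).
rewrite (lmin_ext (true_instance_near hk)) (lmin_ext E).
by apply/(true_instance_near hk)/E.
Qed.

Lemma limit_CT : CTminus (limit_T : set L).
Proof.
split.
- exact: limit_PA.
- exact: limit_T_Sent.
- move=> s t hs ht; have [a ea] := lcl_surj s; have [b eb] := lcl_surj t.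
  have [f ef] := lcl_surj (cEq s t); subst s t; rewrite ef limit_TE.
  have h1 := iffLR (limit_los_ud (scons f (scons a (fun=> b))) (@ud_cEq void))
    (And3 (esym ef) hs ht).
  have hS : Sent (lcl f) by rewrite -ef; apply: (Sent_eq limit_PA).
  rewrite (limit_los_ud (scons a (fun=> b)) (@ud_values void)); apply: late_iff.
  apply: filterS (filterI h1 (limit_Phi hS)) => n /= [[e h2 h3] ->].
  by rewrite /fenv /= in e h2 h3 *; rewrite e Phi_eq.
- move=> p hp; have [a ea] := lcl_surj p; have [f ef] := lcl_surj (cNeg p); subst p.
  have h1 := iffLR (limit_los_ud (scons f (fun=> a)) (@ud_cNeg void)) (conj (esym ef) hp).
  have hS : Sent (lcl f) by rewrite -ef; apply/(Sent_neg limit_PA).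
  have h2 : late [set n | st_T (sval f n) <-> ~ st_T (sval a n)].
    apply: filterS (filterI h1 (limit_Phi hS)) => n /= [[e h2] ->].
    by rewrite /fenv /= in e h2 *; rewrite e Phi_neg.
  rewrite ef !limit_TE (late_iff h2); split=> [/late_not //|hn].
  by case: (limit_T_decided hp).
- move=> p q hp hq; have [a ea] := lcl_surj p; have [b eb] := lcl_surj q.
  have [f ef] := lcl_surj (cAnd p q); subst p q; rewrite ef !limit_TE.
  have h1 := iffLR (limit_los_ud (scons f (scons a (fun=> b))) (@ud_cAnd void))
    (And3 (esym ef) hp hq).
  have hS : Sent (lcl f) by rewrite -ef; apply/(Sent_and limit_PA).
  have h2 : late [set n | st_T (sval f n) <-> st_T (sval a n) /\ st_T (sval b n)].
    apply: filterS (filterI h1 (limit_Phi hS)) => n /= [[e h2 h3] ->].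
    by rewrite /fenv /= in e h2 h3 *; rewrite e Phi_and.
  rewrite (late_iff h2); split=> [h|[]]; last exact: filterI.
  by split; apply: filterS h => n [].
- move=> i p hip; have [a ea] := lcl_surj i; have [b eb] := lcl_surj p.
  have [f ef] := lcl_surj (cEx i p); rewrite ef limit_TE; subst i p.
  have h1 := iffLR (limit_los_ud (scons f (scons a (fun=> b))) (@ud_cEx void)) (conj (esym ef) hip).
  have hS : Sent (lcl f) by rewrite -ef; apply/(Sent_ex limit_PA).
  have FL : Filter late by exact: filter_filter.
  have h2 := @filterI _ _ FL _ _ h1 (@filterI _ _ FL _ _ (late_settled hS) (limit_Phi hS)).
  split=> [h|[x [t [q [hx hq hT]]]]].
    (* The sentence is the value of a Skolem term [u], so its least true instance is the value of
       [HTr u] and belongs to the hull. *)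
    have [u hu] := svalP f; pose w := hfam (HTr u).
    have h3 : late [set n | true_instance (@st_T _ _ (S n)) (sval f n) (sval w n)].
      apply: filterS (filterI h2 h) => n /= [[[e h3] [h4 h5]] h6].
      rewrite -[hval n u]/((hval^~ u) n) -hu; apply: lmin_instance => //.
      rewrite /fenv /= in e h3; have := iffLR h5 h6; rewrite {1}e.
      move=> /(Phi_ex (PAS n) _ h3) [x [t [q [k1 k2 k3]]]]; exists q; split=> //; split.
        by rewrite e; apply/(Sent_ex (PAS n)).
      by exists (sval a n), (sval b n), x, t.
    have h4 : instance (lcl f) (lcl w).
      apply: (iffRL (limit_los_ud (env2 w f) (@ud_instance void))).
      by apply: filterS h3 => n [].
    case: h4 => _ [i' [r [x [t [e k1 k2]]]]]; exists x, t, (lcl w); split=> //; last first.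
      by apply/limit_TE; apply: filterS h3 => n [].
    move: e; rewrite -ef => /(ctag_inj limit_PA) [_ /(cpair_inj limit_PA) [-> ->]].
    exact: k2.
  have [x' ex] := lcl_surj x; have [t' et] := lcl_surj t; have [q' eq] := lcl_surj q; subst x t q.
  have h3 := iffLR (limit_los_ud (scons x' (scons t' (scons a (scons b (fun=> q'))))) (@ud_inst void))
    (conj hx hq).
  move/limit_TE: hT => h4.
  apply: filterS (filterI h2 (filterI h3 h4)) => n /= [[[e k1] [k2 k3]] [[k4 k5] k6]].
  rewrite /fenv /= in e k1 k4 k5; rewrite k3 e; apply/(Phi_ex (PAS n) _ k1).
  by exists (sval x' n), (sval t' n), (sval q' n).
- move=> s t p hs ht hp hv.
  have hv' : SameValues t s.
    case: hv => [[l [h1 h2]] h3]; split; first by exists l.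
    by move=> i u v h4 h5; have [x [h6 h7]] := h3 i v u h5 h4; exists x.
  split=> -[q [h1 h2]].
    have [q' [h3 h4]] := Eqv_Subst limit_PA h1 (ClTermSeq_subst_eqv limit_PA hs ht hv)
      (Eqv_refl_Form limit_PA hp).
    by exists q'; split=> //; exact: limit_reg h4 h2.
  have [q' [h3 h4]] := Eqv_Subst limit_PA h1 (ClTermSeq_subst_eqv limit_PA ht hs hv')
    (Eqv_refl_Form limit_PA hp).
  by exists q'; split=> //; exact: limit_reg h4 h2.
Qed.

Lemma limit_elementary : elementary_embedding (fun m => lcl (hfam (HM m))).
Proof.
move=> phi e; pose r : nat -> M := fun=> azero; pose f (e : nat -> M) i := hfam (HM (e i)).
have h1 := rt_fmP (@nopred M) phi Some r e.
have h2 := rt_fmP (@nopred L) phi Some (lcl \o f r) (lcl \o f e).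
apply: (iff_trans (iff_sym h1)); apply: (iff_trans _ h2); rewrite limit_los.
split=> [h|[n hn]]; first by apply: late_all => n; exact: (iffLR (c_elem n _ r e) h).
exact: (iffRL (c_elem n _ r e) (hn n (leqnn n))).
Qed.

(** ** Counting *)

Fixpoint leaves (t : hterm) : seq I :=
  match t with
  | HM _ => [::]
  | HI i => [:: i]
  | HPair t u => leaves t ++ leaves u
  | HMin _ t | HTr t => leaves t
  end.

Lemma leaves_move g t : leaves (hmove g t) = map g (leaves t).
Proof. by elim: t => //= t -> u ->; rewrite map_cat. Qed.

Section TermCode.
Variables (a : M -> nat) (b : I -> nat) (C : set I).
Hypothesis a_inj : injective a.
Hypothesis b_inj : forall x y, C x -> C y -> b x = b y -> x = y.

Fixpoint hcode (t : hterm) : GenTree.tree nat :=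
  match t with
  | HM m => GenTree.Node 0 [:: GenTree.Leaf (a m)]
  | HI i => GenTree.Node 1 [:: GenTree.Leaf (b i)]
  | HPair t u => GenTree.Node 2 [:: hcode t; hcode u]
  | HMin k t => GenTree.Node 3 [:: GenTree.Leaf k; hcode t]
  | HTr t => GenTree.Node 4 [:: hcode t]
  end.

Lemma hcode_inj t : (forall i, i \in leaves t -> C i) ->
  forall u, (forall i, i \in leaves u -> C i) -> hcode t = hcode u -> t = u.
Proof.
elim: t => [m|i|t IHt t' IHt'|k t IH|t IH] ht [m'|i'|u u'|k' u|u] hu //=.
- by case=> /a_inj ->.
- by case=> /b_inj -> //; [apply: ht|apply: hu]; rewrite /= inE.
- have sub v v' : (forall i, i \in leaves (HPair v v') -> C i) ->
      (forall i, i \in leaves v -> C i) /\ (forall i, i \in leaves v' -> C i).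
    by move=> h; split=> i hi; apply: h; rewrite /= mem_cat hi ?orbT.
  have [ht1 ht2] := sub _ _ ht; have [hu1 hu2] := sub _ _ hu.
  by move=> [/(IHt ht1 u hu1) -> /(IHt' ht2 u' hu2) ->].
- by move=> [-> /(IH ht u hu) ->].
- by move=> [/(IH ht u hu) ->].
Qed.

End TermCode.

Hypothesis hM : countable [set: M].

Lemma countable_terms (C : set I) : countable C ->
  countable [set t | forall i, i \in leaves t -> C i].
Proof.
move=> /countable_injP [b hb]; move/countable_injP: hM => [a ha].
have a_inj : injective a by move=> x y; apply: ha; rewrite inE.
have b_inj x y : C x -> C y -> b x = b y -> x = y by move=> hx hy; apply: hb; rewrite inE.
apply/countable_injP; exists (fun t => pickle (hcode a b t)) => t u.
rewrite !inE => ht hu /(pcan_inj pickleK); exact: (hcode_inj a_inj b_inj).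
Qed.

Section Below.
Variables (i : I) (b : nat -> I).
Hypothesis b_above : lt i (b 0).
Hypothesis b_incr : forall k, lt (b k) (b k.+1).

(** The least element is moved first to [b k]; the images of the others are then above [b k], and
    the induction continues with [b k] in the place of [l]. *)
Lemma move_tuple (J : seq I) l k : sorted lt J -> (forall x, x \in J -> lt l x) -> lt l (b k) ->
  exists g : G, (forall x, ile lt x l -> g x = x) /\ forall x, x \in J -> exists k, g x = b k.
Proof.
elim: (size J) {-2}J (leqnn (size J)) l k => [|m IH] {}J hm l k.
  by case: J hm => // _ _ _ _; exists (aut1 lt).
case: J hm => [|x J] hm hs hl hk; first by exists (aut1 lt).
have [g1 [h1 h2]] := move_above hI (hl x (mem_head _ _)) hk.
move: hs; rewrite (sorted_pairwise (lt_tr hI)) => /andP [/allP h3 h4].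
have [||y|g2 [h5 h6]] := IH (map g1 J) _ (b k) k.+1 _ _ (b_incr k).
- by rewrite size_map.
- by rewrite sorted_map (eq_sorted (e' := lt)) ?(sorted_pairwise (lt_tr hI)) // => u v /=; exact: autM.
- by case/mapP => u hu ->; rewrite -h1 autM; exact: h3.
exists (autC g2 g1); split=> [u hu|u] /=.
  by rewrite h2 // h5 // /ile (ile_lt_trans (lt_tr hI) hu hk) orbT.
rewrite inE => /orP [/eqP ->|hu]; last by apply: h6; apply: map_f.
by exists k; rewrite h1 h5 // /ile eqxx.
Qed.

(** The sequence [b] need not be cofinal: every finite set of indices above [i] can be moved into it
    by an automorphism fixing everything up to [i]. *)
Definition sample : set I := [set x | ile lt x i \/ exists k, x = b k].

Lemma countable_sample : countable sample.
Proof.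
have h1 : countable [set x | ile lt x i].
  by apply: countable_sub (lt_count hI (b 0)) => x /= hx; exact: (ile_lt_trans (lt_tr hI) hx b_above).
pose F n := if n is k.+1 then [set b k] else [set x | ile lt x i].
have hF : countable (\bigcup_(n in [set: nat]) F n).
  apply: bigcup_countable => [|[|k] _]; [exact: countableP|exact: h1|exact: countable1].
apply: countable_sub hF => x [hx|[k ->]]; [by exists 0|by exists k.+1].
Qed.

Lemma countable_below : countable [set z : L | arith_lt z (lcl (hfam (HI i)))].
Proof.
apply: (countable_sub _ (countable_img (fun t => lcl (hfam t)) (countable_terms countable_sample))).
move=> z /= hz; have [f ef] := lcl_surj z; have [t et] := svalP f; subst z.
have [J [hJ1 hJ2]] := sorted_exists hI [seq x <- leaves t | lt i x].
have [|g [h1 h2]] := @move_tuple J i 0 hJ1 _ b_above.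
  by move=> x; rewrite hJ2 mem_filter => /andP [].
exists (hmove g t) => [x|].
  rewrite leaves_move => /mapP [y hy ->].
  have [hyi|hyi] := orP (ile_tot hI y i); first by left; rewrite h1.
  by right; apply: h2; rewrite hJ2 mem_filter hyi.
apply/lclP; move/(limit_los_ud (env2 f (hfam (HI i))) (@ud_lt void)): hz.
apply: filterS => n; rewrite /= /fenv /= et hval_move => hlt.
exact: st_fix hlt h1.
Qed.

End Below.

Lemma limit_below i : countable [set z : L | arith_lt z (lcl (hfam (HI i)))].
Proof.
have [nxt hn] := choice (lt_max hI).
by apply: (@countable_below i (fun k => iter k nxt (nxt i))) => [|k] /=; apply: hn.
Qed.

Lemma j_lt n (x y : S n) : arith_lt x y <-> arith_lt (j x) (j y).
Proof. exact: (j_ud (env2 x y) (@ud_lt void)). Qed.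

Lemma limit_lt f f' : arith_lt (lcl f) (lcl f') <-> late [set n | arith_lt (sval f n) (sval f' n)].
Proof. exact: (limit_los_ud (env2 f f') (@ud_lt void)). Qed.

Lemma limit_cof z : exists i, arith_lt z (lcl (hfam (HI i))).
Proof.
have [f ->] := lcl_surj z; have [m hm] := fam_coherent f; have [i hi] := st_cof (sval f m).
exists i; apply/limit_lt; exists m => n /subnKC <- /=.
elim: (n - m) => [|k IH]; first by rewrite addn0.
by rewrite addnS hm ?leq_addr // -j_d -j_lt.
Qed.

Lemma limit_d_lt i i' : lt i i' -> arith_lt (lcl (hfam (HI i))) (lcl (hfam (HI i'))).
Proof. by move=> h; apply/limit_lt; apply: late_all => n; exact: st_lt. Qed.

Lemma limit_omega1_like (W : Type) (R : rel W) (w : W -> I) :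
  well_order R -> (forall v, countable [set u | R u v]) -> ~ countable [set: W] ->
  injective w -> (forall i, exists v, lt i (w v)) -> omega1_like L.
Proof.
move=> hR hc hW w_inj w_cof; pose d v := lcl (hfam (HI (w v))).
have d_inj : injective d.
  move=> u v e; apply: w_inj; apply/eqP; apply: contrapT => /negP /(lt_tot hI) /orP [] /limit_d_lt;
    by rewrite -/(d u) -/(d v) e => /(ltxx limit_PA).
have d_cof z : exists v, arith_lt z (d v).
  have [i hi] := limit_cof z; have [v hv] := w_cof i; exists v.
  exact: (lt_trans limit_PA hi (limit_d_lt hv)).
have hL : ~ countable [set: L].
  move/countable_injP => [f hf]; apply: hW; apply/countable_injP.
  by exists (f \o d) => u v _ _ /hf; rewrite !in_setT => /(_ isT isT); exact: d_inj.
split; last first.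
  move=> J hJ hJT; have [x hx] : exists x, ~ J x.
    apply: contrapT => hn; apply: hJT; apply/seteqP; split=> // x _.
    by apply: contrapT => hx; apply: hn; exists x.
  have [v hv] := d_cof x; apply: countable_sub (limit_below (w v)) => y hy /=.
  case: (lt_total limit_PA y x) => [h|[h|h]]; first exact: (lt_trans limit_PA h hv).
    by case: hx; rewrite -h.
  by case: hx; exact: hJ hy h.
have hr z : exists v, arith_lt z (d v) /\ forall u, arith_lt z (d u) -> R v u.
  have [v hv] := d_cof z.
  have [|u] := @wo_min3 {classic W} R hR [pred v | `[< arith_lt z (d v) >]] v; first by apply/asboolP.
  by move=> /asboolP h1 h2; exists u; split=> // u' hu'; apply: h2; apply/asboolP.
have [r hr'] := choice hr; have [e he] := choice (fun v => elimT (countable_injP _) (limit_below (w v))).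
(* An element [z] is determined by the least [v] with [z] below [d v] and by its number among the
   countably many elements below that [d v]. *)
apply: (card_aleph1_lex hR hc (h := fun z => (r z, e (r z) z))) => // z z' [e1 e2].
have [h1 _] := hr' z; have [h2 _] := hr' z'; rewrite -e1 in h2 e2.
by apply: (he (r z)) e2; rewrite inE.
Qed.

End Limit.

(** * The chain of stages over the iterated ultrapower *)

Section Chain.
Variables (I0 : Type) (lt : rel {classic I0}) (hI : good_order lt) (i_0 : {classic I0}).
Variables (M : arith) (hPA : PA M).

Fixpoint tower (n : nat) : stage lt := if n is n'.+1 then next_stage hI (tower n') else base_stage hI i_0 hPA.

Definition tower_incl n : tower n -> tower n.+1 := @constant_class _ _ (tower n).

Fixpoint tower_cst (n : nat) (m : M) : tower n :=
  if n is n'.+1 then tower_incl (tower_cst n' m) else base_c lt hPA m.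

Lemma tower_elem n phi (r e : nat -> tower n) :
  ev (@nopred _) r e phi <-> ev (@nopred _) (@tower_incl n \o r) (@tower_incl n \o e) phi.
Proof. exact: (@incl_elem _ _ (tower n) phi r e). Qed.

Lemma tower_piece n (k : tower n) phi (r e : nat -> tower n) : st_A k ->
  ev (fun _ : unit => pieces (@st_T _ _ (tower n)) k) r e phi <->
  ev (fun _ : unit => pieces (@st_T _ _ (tower n.+1)) (tower_incl k))
    (@tower_incl n \o r) (@tower_incl n \o e) phi.
Proof. exact: (@incl_elem_piece _ _ hI (tower n) k phi r e). Qed.

Lemma tower_T n (p k : tower n) : Skel p k -> st_A k -> (st_T (tower_incl p) <-> st_T p).
Proof. exact: (@incl_T _ _ hI (tower n) p k). Qed.

Lemma tower_A n (k : tower n) : st_A (tower_incl k).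
Proof. by exists k. Qed.

Lemma tower_d n i : tower_incl (st_d (tower n) i) = st_d (tower n.+1) i.
Proof. by []. Qed.

Lemma tower_cst_elem n phi (r e : nat -> M) :
  ev (@nopred _) r e phi <-> ev (@nopred _) (tower_cst n \o r) (tower_cst n \o e) phi.
Proof.
elim: n => [|n IH]; first exact: (base_elem hI hPA phi r e).
by rewrite IH; exact: tower_elem.
Qed.

Lemma tower_cst_act n (g : Aut lt) m : act g (tower_cst n m) = tower_cst n m.
Proof.
elim: n => [|n IH]; first exact: (base_act_c hI hPA g m).
exact: (etrans (@ext_act_incl _ _ (tower n) g (tower_cst n m)) (congr1 (@tower_incl n) IH)).
Qed.

Lemma tower_cst_incl n m : tower_incl (tower_cst n m) = tower_cst n.+1 m.
Proof. by []. Qed.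

End Chain.

Theorem theorem27 (M : arith) (hPA : PA M) (hM : countable [set: M]) :
  exists (M' : arith) (f : M -> M'),
    [/\ elementary_embedding f, omega1_like M'
      & exists T : set M', CTminus T].
Proof.
have [I0 [lt [W [R [w [hI [hR hc] hW w_inj w_cof]]]]]] := index_exists.
(* If there were no index, [W], which maps into the indices, would be empty and hence countable. *)
have [i_0 _] : exists i : {classic I0}, True.
  apply: contrapT => hn; apply: hW.
  rewrite (_ : [set: W] = set0) ?countable0 //; apply/seteqP; split=> // v _.
  by case: hn; exists (w v).
have el := @tower_elem I0 lt hI i_0 M hPA; have pc := @tower_piece I0 lt hI i_0 M hPA.
have tr := @tower_T I0 lt hI i_0 M hPA; have ha := @tower_A I0 lt hI i_0 M hPA.
have hd := @tower_d I0 lt hI i_0 M hPA; have ce := @tower_cst_elem I0 lt hI i_0 M hPA.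
have ca := @tower_cst_act I0 lt hI i_0 M hPA; have cj := @tower_cst_incl I0 lt hI i_0 M hPA.
eexists; eexists; split.
- exact: (limit_elementary el pc ha hd ce cj).
- exact: (limit_omega1_like hI el pc ha hd ce ca cj hM hR hc hW w_inj w_cof).
- by eexists; exact: (limit_CT el pc tr ha hd ce cj).
Qed.
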